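(* Let $K_2=\overline{B}(0,1)\subseteq\mathbb{R}^2$ be the closed unit ball and let $\mathcal{S}(K_2)$ be the set of all $f\in C^1(K_2)$ such that the planar system $\dot x=f(x)$ is structurally stable on $K_2$. For $f\in C^1(K_2)$ let $Zero(f)=\{x\in K_2: f(x)=0\}$ be the set of equilibrium points of $\dot x = f(x)$ in $K_2$. Then the operator that assigns to each $f\in\mathcal{S}(K_2)$ the set $Zero(f)$ and the exact size of $Zero(f)$ is computable. More precisely, there is an algorithm $\mathcal{E}$ which, when given as input any $C^1$-name of any $f\in\mathcal{S}(K_2)$ and any $n_0\in\mathbb{N}$, halts and outputs an integer $n\ge n_0$, a nonnegative integer $\#_0(f)$, and a finite list $C$ of squares with rational vertices, such that: (1) $\#_0(f)$ is the exact number of equilibrium points of $\dot x=f(x)$ in $K_2$ (i.e. the cardinality of $Zero(f)$); (2) each square in $C$ has side length $1/n$ and contains exactly one equilibrium point; furthermore every zero of $f$ in $K_2$ is contained in some square of $C$. In particular $d_H(Zero(f),\cup C)\le 1/n$, where $d_H$ denotes the Hausdorff distance and $\cup C$ the union of the squares in $C$.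
   Context: $C^1(K)$ denotes the set of continuously differentiable functions defined on some open subset of $\mathbb{R}^d$ containing $K$, with values in $\mathbb{R}^d$ (here $d=2$); $Df(x)$ is the derivative (Jacobian) of $f$ at $x$. The paper takes the closed unit ball with respect to the maximum norm $\|\cdot\|_\infty$. For $f\in C^1(K)$, $\|f\|_{1,\infty}=\max_{x\in K}\|f(x)\|+\max_{x\in K}\|Df(x)\|$. The system $\dot x=f(x)$ is structurally stable on $K$ if there is $\varepsilon>0$ such that for every $g\in C^1(K)$ with $\|f-g\|_{1,\infty}<\varepsilon$ on $K$ there exists a homeomorphism $h:K\to K$ mapping every trajectory of $\dot x=f(x)$ onto a trajectory of $\dot y=g(y)$ preserving time orientation. A $C^1$-name of a function $f$ on a compact set $\Omega$ is a sequence $(P_k)$ of polynomial maps with rational coefficients with $\|f-P_k\|_{1,\infty}<2^{-k}$ on $\Omega$ (for vector-valued $f$, a name consists of names of its components). The algorithm is a Turing machine reading the name as an infinite input sequence (computable analysis in the sense of type-2 computability). *)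

(* Defs.v *)
(* MathComp-Analysis. The norm of 'rV[R]_2 is the maximum norm. *)
From HB Require Import structures.
From mathcomp Require Import all_boot all_order all_algebra.
From mathcomp Require Import all_classical all_reals all_analysis.
Set Implicit Arguments.
Unset Strict Implicit.
Unset Printing Implicit Defensive.
Import Order.TTheory GRing.Theory Num.Theory numFieldNormedType.Exports.
Local Open Scope classical_set_scope.
Local Open Scope ring_scope.

Definition K2 (R : realType) : set 'rV[R]_2 := closed_ball 0 1.
Arguments K2 : clear implicits.

(* C^1(K) is modelled by total functions; their values off the open set U are
   irrelevant. *)
Definition C1_on (R : realType) (K : set 'rV[R]_2)
    (f : 'rV[R]_2 -> 'rV[R]_2) : Prop :=
  exists U : set 'rV[R]_2, [/\ open U, K `<=` U &
    forall x, U x -> differentiable f x /\ {for x, continuous (jacobian f)}].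

(* Operator norm induced by the norms of V and W. *)
Definition opnorm (R : realType) (V W : normedModType R) (L : V -> W) : R :=
  sup [set `|L v| | v in [set v : V | `|v| <= 1]].

(* The suprema are maxima when K is compact and f is C^1. *)
Definition C1norm (R : realType) (W : normedModType R) (K : set 'rV[R]_2)
    (f : 'rV[R]_2 -> W) : R :=
  sup [set `|f x| | x in K] + sup [set opnorm ('d f x) | x in K].

Definition zeros (R : realType) (K : set 'rV[R]_2)
    (f : 'rV[R]_2 -> 'rV[R]_2) : set 'rV[R]_2 :=
  [set x | K x /\ f x = 0].

(* The derivative of phi at t is taken relative to J, hence it is one-sided at
   an endpoint of J; no condition is imposed when J = {t}, which occurs when a
   trajectory meets K in a single point of its boundary. *)
Definition solution_in (R : realType) (K : set 'rV[R]_2)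
    (f : 'rV[R]_2 -> 'rV[R]_2) (J : set R) (phi : R -> 'rV[R]_2) : Prop :=
  [/\ is_interval J, J !=set0, (forall t, J t -> K (phi t)) &
    forall t, J t ->
      (fun s => (s - t)^-1 *: (phi s - phi t))
        @ within (J `\ t) (nbhs t) --> f (phi t)].

(* A trajectory in K, together with a parametrization: a solution staying in K
   which cannot be prolonged inside K. *)
Definition trajectory_in (R : realType) (K : set 'rV[R]_2)
    (f : 'rV[R]_2 -> 'rV[R]_2) (J : set R) (phi : R -> 'rV[R]_2) : Prop :=
  solution_in K f J phi /\
  forall J' phi', solution_in K f J' phi' -> J `<=` J' ->
    (forall t, J t -> phi' t = phi t) -> J' `<=` J.

Definition homeomorphism_on (R : realType) (K : set 'rV[R]_2)
    (h : 'rV[R]_2 -> 'rV[R]_2) : Prop :=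
  [/\ set_bij K K h, {within K, continuous h} &
    exists k : 'rV[R]_2 -> 'rV[R]_2,
      {within K, continuous k} /\ forall x, K x -> k (h x) = x].

(* h maps the trajectory (J, phi) onto the trajectory (J', psi); since tau is an
   increasing bijection from J onto J', time orientation is preserved. *)
Definition maps_trajectories (R : realType) (K : set 'rV[R]_2)
    (f g h : 'rV[R]_2 -> 'rV[R]_2) : Prop :=
  forall J phi, trajectory_in K f J phi ->
    exists J' psi (tau : R -> R),
      [/\ trajectory_in K g J' psi,
          tau @` J = J',
          (forall s t, J s -> J t -> s < t -> tau s < tau t) &
          forall t, J t -> h (phi t) = psi (tau t)].

Definition structurally_stable (R : realType) (K : set 'rV[R]_2)
    (f : 'rV[R]_2 -> 'rV[R]_2) : Prop :=
  exists2 eps : R, 0 < eps &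
    forall g, C1_on K g -> C1norm K (f \- g) < eps ->
      exists h, homeomorphism_on K h /\ maps_trajectories K f g h.

Definition stable_systems (R : realType) (K : set 'rV[R]_2) :
    set ('rV[R]_2 -> 'rV[R]_2) :=
  [set f | C1_on K f /\ structurally_stable K f].

(* The outer indeterminate of P stands for the second coordinate. *)
Definition peval (R : realType) (P : {poly {poly rat}}) (x : 'rV[R]_2) : R :=
  (map_poly (map_poly (ratr : rat -> R)) P).[(x 0 1)%:P].[x 0 0].

(* P k i is the k-th polynomial of a name of the i-th component of f. *)
Definition is_C1_name (R : realType) (K : set 'rV[R]_2)
    (f : 'rV[R]_2 -> 'rV[R]_2) (P : nat -> 'I_2 -> {poly {poly rat}}) : Prop :=
  forall k i, C1norm K (fun x => f x 0 i - peval (P k i) x) < 2^-1 ^+ k.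

(* Self-delimiting codes: numbers are written in unary, a list is preceded by
   its length, and a polynomial is the list of its coefficients. *)
Definition code_nat (n : nat) : seq bool := rcons (nseq n true) false.

Definition code_seq (T : Type) (code : T -> seq bool) (s : seq T) : seq bool :=
  code_nat (size s) ++ flatten (map code s).

Definition code_rat (q : rat) : seq bool :=
  (q < 0) :: code_nat `|numq q|%N ++ code_nat `|denq q|%N.

Definition code_poly (P : {poly {poly rat}}) : seq bool :=
  code_seq (fun p : {poly rat} => code_seq code_rat p) P.

(* The infinite concatenation ws 0 ++ ws 1 ++ ... of nonempty words: the first
   i.+1 of them have total length greater than i. *)
Definition concat_stream (ws : nat -> seq bool) : nat -> bool :=
  fun i => nth false (flatten (mkseq ws i.+1)) i.

(* Input sequence: the number n0 followed by the name P. *)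
Definition code_input (n0 : nat) (P : nat -> 'I_2 -> {poly {poly rat}}) :
    nat -> bool :=
  concat_stream (fun k =>
    if k is k'.+1 then code_poly (P k' 0) ++ code_poly (P k' 1)
    else code_nat n0).

Definition code_output (n N : nat) (C : seq (rat * rat)) : seq bool :=
  code_nat n ++ code_nat N ++
  code_seq (fun q => code_rat q.1 ++ code_rat q.2) C.

(* A deterministic type-2 Turing machine: finite control, a one-way read-only
   input tape carrying an infinite binary sequence, finitely many two-way
   infinite work tapes, and a one-way write-only output tape. *)
Inductive move := Left | Stay | Right.

Definition shift (m : move) (z : int) : int :=
  match m with Left => z - 1 | Stay => z | Right => z + 1 end.

(* Effect of one transition: next state, whether the input head advances, symbol
   written and move on each work tape, bit appended to the output (if any). *)
Record action (Q S : finType) (k : nat) := Action {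
  next : Q;
  advance : bool;
  work : {ffun 'I_k -> S * move};
  emit : option bool }.

Record machine := Machine {
  state : finType;
  symbol : finType;
  blank : symbol;
  ntapes : nat;
  start : state;
  final : {set state};
  delta : state -> bool -> {ffun 'I_ntapes -> symbol} ->
          action state symbol ntapes }.

Record config (M : machine) := Config {
  cur_state : state M;
  input_head : nat;
  tape : 'I_(ntapes M) -> int -> symbol M;
  head : 'I_(ntapes M) -> int;
  output : seq bool }.

Definition init (M : machine) : config M :=
  Config (start M) 0 (fun _ _ => blank M) (fun _ => 0) [::].

Definition step (M : machine) (p : nat -> bool) (c : config M) : config M :=
  if cur_state c \in final M then c else
  let a := delta (cur_state c) (p (input_head c))
             [ffun j => tape c j (head c j)] in
  Config (next a)
    (input_head c + advance a)%N
    (fun j z => if z == head c j then (work a j).1 else tape c j z)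
    (fun j => shift (work a j).2 (head c j))
    (if emit a is Some b then rcons (output c) b else output c).

Definition halts_with (M : machine) (p : nat -> bool) (w : seq bool) : Prop :=
  exists t : nat, let c := iter t (@step M p) (init M) in
    cur_state c \in final M /\ output c = w.

(* The square of side 1/n with lower left vertex q. *)
Definition square (R : realType) (n : nat) (q : rat * rat) : set 'rV[R]_2 :=
  [set x | ratr q.1 <= x 0 0 <= ratr q.1 + n%:R^-1 /\
           ratr q.2 <= x 0 1 <= ratr q.2 + n%:R^-1].

(* The outer maximum with 0 makes the distance of two empty sets 0. *)
Definition hausdorff_dist (R : realType) (A B : set 'rV[R]_2) : \bar R :=
  let excess (X Y : set 'rV[R]_2) :=
    ereal_sup [set ereal_inf [set `|x - y|%:E | y in Y] | x in X] in
  maxe 0%E (maxe (excess A B) (excess B A)).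

(* Main.v *)
(* Structural stability provides a homeomorphism matching the zeros of f with the
   zeros of every map C^1-close to f. Comparing f with a polynomial map plus
   (d x^a, d y^a), f has finitely many zeros; comparing it with f ((1 - eta) x),
   no zero is on the boundary; comparing it with f - c Q, where Q vanishes at the
   zeros, the Jacobian is invertible at each zero.

   For such an f, finitely many inequalities between rationals, involving the
   values of one polynomial pair of the name on a fine grid, certify disjoint
   squares such that f is bounded away from 0 outside of them and small at their
   centers, while det (grad f_0 (x), grad f_1 (y)) is bounded away from 0 for x, y
   in the same square. The mean value theorem then gives at most one zero in each
   square, and the minimum of |f|^2 on the square is one. The algorithm searches
   for a certificate; the test is primitive recursive, and is compiled to a
   register program, then to a Turing machine. *)
Require Import Defs.
From mathcomp Require Import all_boot all_order all_algebra.
From mathcomp Require Import all_classical all_reals all_analysis.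
From mathcomp Require Import zify ring lra.
Set Implicit Arguments.
Unset Strict Implicit.
Unset Printing Implicit Defensive.
Import Order.TTheory GRing.Theory Num.Theory numFieldNormedType.Exports.
Local Open Scope classical_set_scope.
Local Open Scope ring_scope.

Local Open Scope nat_scope.

(** * Primitive recursive functions *)

(** Structural stability is a topological condition and says nothing directly about the derivative
    of [f]. What is taken from it is the correspondence of zeros, hence their number: each excluded
    behaviour (infinitely many zeros, a zero on the boundary, a singular zero) would let an
    arbitrarily C^1-small change of [f] alter that number. The polynomials needed in these
    comparisons are supplied by the name itself. The homeomorphism forgets the speed along orbits,
    so an equilibrium has to be recognized as a trajectory that lasts more than one instant and does
    not move. Pulling a zero of [g] back to a zero of [f] rests on uniqueness of solutions at
    equilibria of [g] and on maximality of trajectories. On the effective side, a name contains no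
    explicit modulus of continuity. It is read off the coefficients of one polynomial pair whose
    distance to [f] is known, and the mesh of the grid is chosen after that pair. All inequalities
    of a certificate hold with room to spare, so no exact comparison of real numbers is ever
    decided, and an accepted certificate proves its own claims. *)

Definition next_pair (p : nat * nat) : nat * nat :=
  if p.1 is a.+1 then (a, p.2.+1) else (p.2.+1, 0).
(** The Cantor enumeration of pairs along antidiagonals. It is defined by iteration so that a
    register program can follow it step by step; [cpair] is its inverse in closed form. *)
Definition unpair n := iter n next_pair (0, 0).
Definition cpair a b := 'C((a + b).+1, 2) + b.
Definition cleft n := (unpair n).1.
Definition cright n := (unpair n).2.

Lemma cpair_next p :
  cpair (next_pair p).1 (next_pair p).2 = (cpair p.1 p.2).+1.
Proof.
case: p => -[|a] b; rewrite /next_pair /cpair /=; last by rewrite !addnS addSn.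
by rewrite !addn0 add0n binS bin1 addnS addnC.
Qed.

Lemma unpairK n : cpair (unpair n).1 (unpair n).2 = n.
Proof.
elim: n => [//|n IH]; rewrite /unpair iterS -/(unpair n).
by rewrite cpair_next IH.
Qed.

Lemma cpairK a b : unpair (cpair a b) = (a, b).
Proof.
move: {2}(cpair a b) (erefl (cpair a b)) => n.
elim: n a b => [|n IH] a b e.
  move: e; case: b => [|b]; last by rewrite /cpair addnS.
  case: a => [|a] //; rewrite /cpair addn0 addn0 => e.
  by have := bin_gt0 a.+2 2; rewrite e.
(* Every pair other than [(0, 0)] is a successor in the enumeration. *)
have [[a' b'] eq] : exists p, next_pair p = (a, b) \/ (a, b) = (0, 0).
  case: b a {e} => [|b] [|a]; [by exists (0,0); right|by exists (0, a); left|..].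
    by exists (1, b); left.
  by exists (a.+2, b); left.
case: eq => [eq|[a0 b0]]; last by move: e; rewrite a0 b0.
have e' : cpair a b = (cpair a' b').+1.
  by have := cpair_next (a', b'); rewrite eq.
rewrite e' /unpair iterS -/(unpair _) IH ?eq //.
by move: e; rewrite e' => -[].
Qed.

Lemma cpairKl a b : cleft (cpair a b) = a. Proof. by rewrite /cleft cpairK. Qed.
Lemma cpairKr a b : cright (cpair a b) = b. Proof. by rewrite /cright cpairK. Qed.
Lemma cunpairK n : cpair (cleft n) (cright n) = n. Proof. exact: unpairK. Qed.
Lemma leq_cpairr a b : b <= cpair a b. Proof. exact: leq_addl. Qed.
Lemma leq_cright n : cright n <= n.
Proof. by rewrite -{2}[n]cunpairK leq_cpairr. Qed.

(** All functions have one argument, with tuples packed by [cpair], and recursion is plain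
    iteration; a program can then work in place on a single register. *)
Inductive prcode :=
  | PZero | PSucc | PPred | PLeft | PRight
  | PPair of prcode & prcode
  | PComp of prcode & prcode
  | PIter of prcode.

Fixpoint pr_eval (c : prcode) (n : nat) : nat :=
  match c with
  | PZero => 0
  | PSucc => n.+1
  | PPred => n.-1
  | PLeft => cleft n
  | PRight => cright n
  | PPair f g => cpair (pr_eval f n) (pr_eval g n)
  | PComp f g => pr_eval f (pr_eval g n)
  | PIter f => iter (cright n) (pr_eval f) (cleft n)
  end.

(** The last field says that normalizing an arbitrary number into a valid code is primitive
    recursive. This is what makes decoding admissible in [pr_dec], also on numbers that code
    nothing. *)
Structure encType := EncType {
  enc_sort :> Type;
  enc : enc_sort -> nat;
  dec : nat -> enc_sort;
  encK : cancel enc dec;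
  enc_dec_pr : exists c, forall n, pr_eval c n = enc (dec n) }.
Arguments enc {e} _.
Arguments dec {e} _.

(* encTypes are typed views of the arguments: a function of several variables
   is presented as a function of the code of their tuple. *)
Definition pr (A : encType) (F : nat -> A) : Prop :=
  exists c, forall n, pr_eval c n = enc (F n).

Canonical nat_enc := @EncType nat id id (fun _ => erefl)
  (ex_intro _ (PPair PLeft PRight) cunpairK).

Section PrBasic.
Variables A B : encType.

Lemma eq_pr (F G : nat -> A) : F =1 G -> pr F -> pr G.
Proof. by move=> FG [c h]; exists c => n; rewrite h FG. Qed.

Lemma pr_id : pr (fun n : nat => n).
Proof. by exists (PPair PLeft PRight) => n /=; rewrite cunpairK. Qed.

Lemma pr_comp (F : nat -> A) (g : nat -> nat) :
  pr F -> pr g -> pr (fun n => F (g n)).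
Proof. by move=> [c hc] [d hd]; exists (PComp c d) => n /=; rewrite hd hc. Qed.

Lemma pr_succ (g : nat -> nat) : pr g -> pr (fun n => (g n).+1).
Proof. by move=> [c h]; exists (PComp PSucc c) => n /=; rewrite h. Qed.

Lemma pr_pred (g : nat -> nat) : pr g -> pr (fun n => (g n).-1).
Proof. by move=> [c h]; exists (PComp PPred c) => n /=; rewrite h. Qed.

Lemma pr_cleft (g : nat -> nat) : pr g -> pr (fun n => cleft (g n)).
Proof. by move=> [c h]; exists (PComp PLeft c) => n /=; rewrite h. Qed.

Lemma pr_cright (g : nat -> nat) : pr g -> pr (fun n => cright (g n)).
Proof. by move=> [c h]; exists (PComp PRight c) => n /=; rewrite h. Qed.

Lemma pr_cpair (f g : nat -> nat) :
  pr f -> pr g -> pr (fun n => cpair (f n) (g n)).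
Proof.
by move=> [c h] [d k]; exists (PPair c d) => n /=; rewrite h k.
Qed.

Lemma pr_const (a : A) : pr (fun _ => a).
Proof.
suff [c hc] : pr (fun _ => enc a) by exists c.
elim: (enc a) => [|n IH]; [by exists PZero | exact: pr_succ].
Qed.

Lemma pr_dec (g : nat -> nat) : pr g -> pr (fun n => dec (g n) : A).
Proof.
move=> [c h]; have [d k] := enc_dec_pr A.
by exists (PComp d c) => n /=; rewrite h k.
Qed.

Lemma pr_enc (F : nat -> A) : pr F -> pr (fun n => enc (F n)).
Proof. by move=> [c h]; exists c. Qed.

Lemma pr_of_enc (F : nat -> A) : pr (fun n => enc (F n)) -> pr F.
Proof. by move=> [c h]; exists c. Qed.

End PrBasic.

Lemma pr_iter_nat (n z : nat -> nat) (s : nat -> nat -> nat) :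
  pr n -> pr z -> pr (fun p => s (cleft p) (cright p)) ->
  pr (fun e => iter (n e) (s e) (z e)).
Proof.
move=> hn hz [c hc].
(* The body of [PIter] sees only the state, so the parameter [e] is carried along in it. *)
have [d hd] : pr (fun e => cpair (cpair e (z e)) (n e)).
  by do !apply: pr_cpair => //; exact: pr_id.
exists (PComp PRight (PComp (PIter (PPair PLeft c)) d)) => e /=.
rewrite hd /= cpairKl cpairKr.
suff -> : iter (n e) (pr_eval (PPair PLeft c)) (cpair e (z e)) =
  cpair e (iter (n e) (s e) (z e)) by rewrite cpairKr.
by elim: (n e) => [//|k IH]; rewrite !iterS IH /= hc cpairKl cpairKr.
Qed.

Lemma pr_iter (A : encType) (n : nat -> nat) (z : nat -> A)
    (s : nat -> A -> A) :
  pr n -> pr z -> pr (fun p => s (cleft p) (dec (cright p))) ->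
  pr (fun e => iter (n e) (s e) (z e)).
Proof.
move=> hn hz hs; apply: pr_of_enc.
have := pr_iter_nat (s := fun e x => enc (s e (dec x))) hn (pr_enc hz) (pr_enc hs).
apply: eq_pr => e; elim: (n e) => [//|k IH]; by rewrite !iterS IH encK.
Qed.

Lemma bool_encK : cancel nat_of_bool (fun n => n != 0).
Proof. by case. Qed.

Lemma pr_eq0_nat (x : nat -> nat) : pr x -> pr (fun e => nat_of_bool (x e == 0)).
Proof.
move=> hx; have := pr_iter (s := fun _ _ => 0) hx (pr_const (1 : nat_enc)) (pr_const (0 : nat_enc)).
by apply: eq_pr => e; case: (x e).
Qed.

Lemma bool_enc_dec_pr :
  exists c, forall n, pr_eval c n = nat_of_bool (n != 0).
Proof.
have [c hc] := pr_eq0_nat (pr_eq0_nat pr_id).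
by exists c => n; rewrite hc; case: n.
Qed.

Canonical bool_enc := EncType bool_encK bool_enc_dec_pr.

Lemma pr_eq0 (x : nat -> nat) : pr x -> pr (fun e => x e == 0).
Proof. by move=> /pr_eq0_nat [c hc]; exists c. Qed.

(** A conditional is an iteration performed once or not at all. *)
Lemma pr_if (A : encType) (b : nat -> bool) (x y : nat -> A) :
  pr b -> pr x -> pr y -> pr (fun e => if b e then x e else y e).
Proof.
move=> hb hx hy.
have := pr_iter (s := fun e _ => x e) (pr_enc hb) hy (pr_comp hx (pr_cleft pr_id)).
by apply: eq_pr => e; case: (b e).
Qed.

Section PrPair.
Variables A B : encType.
Definition enc_pair (p : A * B) := cpair (enc p.1) (enc p.2).
Definition dec_pair n : A * B := (dec (cleft n), dec (cright n)).
Lemma enc_pairK : cancel enc_pair dec_pair.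
Proof. by case=> a b; rewrite /dec_pair cpairKl cpairKr !encK. Qed.
Lemma enc_dec_pair_pr : exists c, forall n, pr_eval c n = enc_pair (dec_pair n).
Proof.
have [c hc] := enc_dec_pr A; have [d hd] := enc_dec_pr B.
exists (PPair (PComp c PLeft) (PComp d PRight)) => n /=.
by rewrite hc hd.
Qed.
End PrPair.
Canonical pair_enc A B :=
  EncType (@enc_pairK A B) (@enc_dec_pair_pr A B).

Section PrPairTheory.
Variables A B : encType.
Lemma pr_pair (x : nat -> A) (y : nat -> B) :
  pr x -> pr y -> pr (fun e => (x e, y e)).
Proof. by move=> [c h] [d k]; exists (PPair c d) => n /=; rewrite h k. Qed.
Lemma pr_fst (p : nat -> A * B) : pr p -> pr (fun e => (p e).1).
Proof.
by move=> [c h]; exists (PComp PLeft c) => n /=; rewrite h cpairKl.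
Qed.
Lemma pr_snd (p : nat -> A * B) : pr p -> pr (fun e => (p e).2).
Proof.
by move=> [c h]; exists (PComp PRight c) => n /=; rewrite h cpairKr.
Qed.
End PrPairTheory.

Definition enc_seq (A : encType) : seq A -> nat :=
  foldr (fun x c => (cpair (enc x) c).+1) 0.
Fixpoint dec_seq_fuel (A : encType) (k n : nat) : seq A :=
  match k, n with
  | k'.+1, n'.+1 => dec (cleft n') :: dec_seq_fuel A k' (cright n')
  | _, _ => [::]
  end.
Definition dec_seq (A : encType) n := dec_seq_fuel A n n.

Lemma dec_seq_fuel_indep A k l n :
  n <= k -> n <= l -> dec_seq_fuel A k n = dec_seq_fuel A l n.
Proof.
elim: k l n => [|k IH] [|l] [|n] //= nk nl.
by rewrite (IH l) // (leq_trans (leq_cright _)).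
Qed.

Lemma dec_seqS (A : encType) n :
  dec_seq A n.+1 = dec (cleft n) :: dec_seq A (cright n).
Proof.
by rewrite /dec_seq /= (@dec_seq_fuel_indep _ n (cright n)) ?leq_cright.
Qed.

Lemma enc_seqK A : cancel (@enc_seq A) (dec_seq A).
Proof. by elim=> //= x s IH; rewrite dec_seqS cpairKl cpairKr encK IH. Qed.

(* This works on codes because seq A is not yet known to be an encType. *)
Lemma pr_foldl_raw (A : encType) (l z : nat -> nat) (s : nat -> nat -> nat -> nat) :
  pr l -> pr z ->
  pr (fun p => s (cleft p) (cleft (cright p)) (cright (cright p))) ->
  pr (fun e => foldl (s e) (z e) (dec_seq nat_enc (l e))).
Proof.
move=> hl hz hs.
(* The state is the accumulator paired with the code of the remaining list. Once that list is empty,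
   further rounds change nothing, so the code of the list, which is at least its length, can serve
   as the number of rounds. *)
pose t e (st : nat) :=
  if cright st == 0 then st else
  cpair (s e (cleft st) (cleft (cright st).-1)) (cright (cright st).-1).
have ht : pr (fun p => t (cleft p) (cright p)).
  apply: pr_if; [|exact: pr_cright pr_id|apply: pr_cpair].
  - exact: pr_eq0 (pr_cright (pr_cright pr_id)).
  - have h : pr (fun p => cpair (cleft p) (cpair (cleft (cright p))
        (cleft (cright (cright p)).-1))).
      apply: pr_cpair; first exact: pr_cleft pr_id.
      apply: pr_cpair; first exact: pr_cleft (pr_cright pr_id).
      exact: pr_cleft (pr_pred (pr_cright (pr_cright pr_id))).
    by have := pr_comp hs h; apply: eq_pr => p; rewrite !(cpairKl, cpairKr).
  - exact: pr_cright (pr_pred (pr_cright (pr_cright pr_id))).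
have := pr_cleft (pr_iter_nat hl (pr_cpair hz hl) ht).
apply: eq_pr => e.
suff /(_ (l e) (l e) (z e) (leqnn _)) : forall k m a, m <= k -> cleft (iter k (t e) (cpair a m)) =
  foldl (s e) a (dec_seq nat_enc m) by [].
elim=> [|k IH] m a.
  by rewrite leqn0 => /eqP ->; rewrite /= cpairKl.
case: m => [_|m mk].
  rewrite -[RHS](IH 0 a) // iterSr; congr (cleft (iter _ _ _)).
  by rewrite /t cpairKr.
rewrite iterSr dec_seqS.
have -> : t e (cpair a m.+1) = cpair (s e a (cleft m)) (cright m).
  by rewrite /t cpairKr cpairKl.
by rewrite IH // (leq_trans (leq_cright _)).
Qed.

Lemma dec_seq_nat (A : encType) n :
  dec_seq A n = map dec (dec_seq nat_enc n).
Proof.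
rewrite /dec_seq; move: {1 3}n => m.
by elim: m n => [|m IH] [|n] //=; rewrite IH.
Qed.

Lemma enc_seq_map (A : encType) (s : seq A) :
  enc_seq s = @enc_seq nat_enc (map enc s).
Proof. by elim: s => //= x s ->. Qed.

Lemma pr_map_raw (l : nat -> nat) (s : nat -> nat -> nat) :
  pr l -> pr (fun p => s (cleft p) (cright p)) ->
  pr (fun e => @enc_seq nat_enc (map (s e) (dec_seq nat_enc (l e)))).
Proof.
(* A left fold builds the image backwards; a second pass of [revm], with the identity, restores the
   order. *)
have revm (l' : nat -> nat) (s' : nat -> nat -> nat) :
    pr l' -> pr (fun p => s' (cleft p) (cright p)) ->
    pr (fun e => @enc_seq nat_enc (rev (map (s' e) (dec_seq nat_enc (l' e))))).
  move=> hl hs.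
  have /(_ nat_enc) h := pr_foldl_raw _ hl (pr_const (0 : nat_enc)).
  have {}h := h (fun e acc x => (cpair (s' e x) acc).+1) _.
  have {h} := h (pr_succ (pr_cpair _ (pr_cleft (pr_cright pr_id)))).
  case.
    have := pr_comp hs (pr_cpair (pr_cleft pr_id) (pr_cright (pr_cright pr_id))).
    by apply: eq_pr => p; rewrite cpairKl cpairKr.
  move=> c hc; exists c => e; rewrite hc /=.
  rewrite /rev -[X in foldl _ X]/(@enc_seq nat_enc [::]).
  elim: (dec_seq nat_enc (l' e)) [::] => //= x r IH acc.
  by rewrite -IH.
move=> hl hs; have := revm _ (fun _ => id) (revm _ s hl hs) (pr_cright pr_id).
apply: eq_pr => e; congr (@enc_seq nat_enc _).
by rewrite enc_seqK map_id revK.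
Qed.

Lemma enc_dec_seq_pr A :
  exists c, forall n, pr_eval c n = enc_seq (dec_seq A n).
Proof.
have [c hc] := enc_dec_pr A.
have hs : pr (fun p => enc (dec (cright p) : A)).
  by exists (PComp c PRight) => n /=; rewrite hc.
have [d hd] := @pr_map_raw id (fun _ x => enc (dec x : A)) pr_id hs.
by exists d => n; rewrite hd [RHS]enc_seq_map (dec_seq_nat A) -map_comp.
Qed.

Canonical seq_enc A := EncType (@enc_seqK A) (@enc_dec_seq_pr A).

Lemma pr_foldl (A B : encType) (l : nat -> seq A) (z : nat -> B)
    (s : nat -> B -> A -> B) :
  pr l -> pr z ->
  pr (fun p => s (cleft p) (dec (cleft (cright p))) (dec (cright (cright p)))) ->
  pr (fun e => foldl (s e) (z e) (l e)).
Proof.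
move=> hl hz hs; apply: pr_of_enc.
have := pr_foldl_raw nat_enc (pr_enc hl) (pr_enc hz)
  (s := fun e b a => enc (s e (dec b) (dec a))) (pr_enc hs).
apply: eq_pr => e /=; rewrite enc_seq_map enc_seqK.
by elim: (l e) (z e) => //= x r IH b; rewrite !encK IH.
Qed.

Section PrSeq.
Variables A B : encType.
Implicit Types (l : nat -> seq A).

Lemma pr_cons (x : nat -> A) l : pr x -> pr l -> pr (fun e => x e :: l e).
Proof.
move=> hx hl; apply: pr_of_enc.
exact: pr_succ (pr_cpair (pr_enc hx) (pr_enc hl)).
Qed.

Lemma pr_rev l : pr l -> pr (fun e => rev (l e)).
Proof.
move=> hl; have := pr_foldl hl (pr_const ([::] : seq A))
  (s := fun _ acc x => x :: acc).
case=> [|c hc]; last first.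
  exists c => n; rewrite hc /=; congr (enc_seq _).
  by rewrite /rev; elim: (l n) [::] => //= x r IH acc.
apply: (@pr_cons (fun p => dec (cright (cright p)))
  (fun p => dec (cleft (cright p)))); apply: pr_dec.
  exact: pr_cright (pr_cright pr_id).
exact: pr_cleft (pr_cright pr_id).
Qed.

Lemma pr_foldr l (z : nat -> B) (s : nat -> A -> B -> B) :
  pr l -> pr z ->
  pr (fun p => s (cleft p) (dec (cright (cright p))) (dec (cleft (cright p)))) ->
  pr (fun e => foldr (s e) (z e) (l e)).
Proof.
move=> hl hz hs.
have := pr_foldl (pr_rev hl) hz (s := fun e b a => s e a b) hs.
by apply: eq_pr => e; rewrite foldl_rev.
Qed.

Lemma pr_map l (f : nat -> A -> B) :
  pr l -> pr (fun p => f (cleft p) (dec (cright p))) ->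
  pr (fun e => map (f e) (l e)).
Proof.
move=> hl hf; apply: pr_of_enc.
have := pr_map_raw (s := fun e x => enc (f e (dec x))) (pr_enc hl) (pr_enc hf).
apply: eq_pr => e /=; rewrite (enc_seq_map (l e)) enc_seqK [RHS]enc_seq_map.
rewrite -!map_comp.
by congr (@enc_seq nat_enc _); apply: eq_map => x /=; rewrite encK.
Qed.

Lemma pr_behead l : pr l -> pr (fun e => behead (l e)).
Proof.
move=> hl; apply: pr_of_enc.
have := pr_cright (pr_pred (pr_enc hl)).
by apply: eq_pr => e; case: (l e) => //= x r; rewrite cpairKr.
Qed.

Lemma pr_head (x : A) l : pr l -> pr (fun e => seq.head x (l e)).
Proof.
move=> hl.
have := pr_if (pr_eq0 (pr_enc hl)) (pr_const x)
  (pr_dec A (pr_cleft (pr_pred (pr_enc hl)))).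
by apply: eq_pr => e; case: (l e) => //= y r; rewrite cpairKl encK.
Qed.

Lemma pr_nth (x : A) l (i : nat -> nat) :
  pr l -> pr i -> pr (fun e => nth x (l e) (i e)).
Proof.
move=> hl hi.
have := pr_head x (pr_iter hi hl (s := fun _ => behead) _).
case; first by apply: pr_behead; apply: pr_dec; exact: pr_cright pr_id.
move=> c hc; exists c => n; rewrite hc; congr enc.
by rewrite -nth0; elim: (i n) (l n) => [|k IH] [|y r] //=;
  rewrite -?iterS iterSr /= IH ?nth_nil.
Qed.

End PrSeq.

Lemma pr_cat (A : encType) (l l' : nat -> seq A) : pr l -> pr l' -> pr (fun e => l e ++ l' e).
Proof.
move=> hl hl'; have := pr_foldr hl hl' (s := fun _ => cons).
case; last first.
  by move=> c hc; exists c => n; rewrite hc; congr enc; elim: (l n) => //= x s ->.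
by apply: pr_cons; apply: pr_dec;
  [exact: pr_cright (pr_cright pr_id)|exact: pr_cleft (pr_cright pr_id)].
Qed.

Lemma pr_size (A : encType) (l : nat -> seq A) :
  pr l -> pr (fun e => size (l e)).
Proof.
move=> hl; have := pr_foldr hl (pr_const 0) (s := fun _ _ => succn).
by case; [exact: pr_succ (pr_dec _ (pr_cleft (pr_cright pr_id)))|
  move=> c hc; exists c => n; rewrite hc /=; elim: (l n) => //= _ r ->].
Qed.

Lemma pr_flatten (A : encType) (l : nat -> seq (seq A)) :
  pr l -> pr (fun e => flatten (l e)).
Proof.
move=> hl; apply: (pr_foldr hl (pr_const [::]) (s := fun _ => cat)).
by apply: pr_cat; apply: pr_dec;
  [exact: pr_cright (pr_cright pr_id)|exact: pr_cleft (pr_cright pr_id)].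
Qed.

Section PrArith.
Variables x y : nat -> nat.
Hypotheses (hx : pr x) (hy : pr y).

Lemma pr_addn : pr (fun e => x e + y e).
Proof.
have := pr_iter_nat hy hx (s := fun _ => succn) (pr_succ (pr_cright pr_id)).
by apply: eq_pr => e; elim: (y e) => [|k IH]; rewrite ?addn0 // iterS IH addnS.
Qed.

Lemma pr_subn : pr (fun e => x e - y e).
Proof.
have := pr_iter_nat hy hx (s := fun _ => predn) (pr_pred (pr_cright pr_id)).
by apply: eq_pr => e; elim: (y e) => [|k IH]; rewrite ?subn0 // iterS IH subnS.
Qed.

End PrArith.

Lemma pr_muln (x y : nat -> nat) : pr x -> pr y -> pr (fun e => x e * y e).
Proof.
move=> hx hy.
have := pr_iter_nat hy (pr_const 0) (s := fun e => addn (x e)) (pr_addn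
  (pr_comp hx (pr_cleft pr_id)) (pr_cright pr_id)).
by apply: eq_pr => e; elim: (y e) => [|k IH]; rewrite ?muln0 // iterS IH mulnS.
Qed.

Lemma pr_expn (x y : nat -> nat) : pr x -> pr y -> pr (fun e => x e ^ y e).
Proof.
move=> hx hy.
have := pr_iter_nat hy (pr_const 1) (s := fun e => muln (x e)) (pr_muln
  (pr_comp hx (pr_cleft pr_id)) (pr_cright pr_id)).
by apply: eq_pr => e; elim: (y e) => [|k IH]; rewrite ?expn0 // iterS IH expnS.
Qed.

Lemma pr_leq (x y : nat -> nat) : pr x -> pr y -> pr (fun e => x e <= y e).
Proof. by move=> hx hy; apply: pr_eq0; apply: pr_subn. Qed.

Lemma pr_andb (x y : nat -> bool) : pr x -> pr y -> pr (fun e => x e && y e).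
Proof.
move=> hx hy; have := pr_if hx hy (pr_const false).
by apply: eq_pr => e; case: (x e).
Qed.

Lemma pr_orb (x y : nat -> bool) : pr x -> pr y -> pr (fun e => x e || y e).
Proof.
move=> hx hy; have := pr_if hx (pr_const true) hy.
by apply: eq_pr => e; case: (x e).
Qed.

Lemma pr_negb (x : nat -> bool) : pr x -> pr (fun e => ~~ x e).
Proof.
move=> hx; have := pr_if hx (pr_const false) (pr_const true).
by apply: eq_pr => e; case: (x e).
Qed.

Lemma pr_eqn (x y : nat -> nat) : pr x -> pr y -> pr (fun e => x e == y e).
Proof.
move=> hx hy; have := pr_andb (pr_leq hx hy) (pr_leq hy hx).
by apply: eq_pr => e; rewrite eqn_leq.
Qed.

Lemma pr_eq_seq_bool (x y : nat -> seq bool) :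
  pr x -> pr y -> pr (fun e => x e == y e).
Proof.
move=> hx hy; have := pr_eqn (pr_enc hx) (pr_enc hy).
apply: eq_pr => e; apply/eqP/eqP => [|->] //.
exact: (can_inj (@enc_seqK bool_enc)).
Qed.

Lemma pr_iota (x y : nat -> nat) : pr x -> pr y -> pr (fun e => iota (x e) (y e)).
Proof.
move=> hx hy.
have h : pr (fun e => (iter (y e) (fun p : nat * seq nat => (p.1.+1, p.1 :: p.2))
    (x e, [::])).2).
  apply: pr_snd; apply: (pr_iter hy (pr_pair hx (pr_const [::]))
    (s := fun _ p => (p.1.+1, p.1 :: p.2))).
  have h := pr_dec (pair_enc nat_enc (seq_enc nat_enc)) (pr_cright pr_id).
  exact: pr_pair (pr_succ (pr_fst h)) (pr_cons (pr_fst h) (pr_snd h)).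
have := pr_rev h; apply: eq_pr => e.
suff -> : iter (y e) (fun p : nat * seq nat => (p.1.+1, p.1 :: p.2)) (x e, [::])
  = (x e + y e, rev (iota (x e) (y e))) by rewrite revK.
elim: (y e) => [|k IH]; first by rewrite addn0.
by rewrite iterS IH -[in iota _ k.+1]addn1 iotaD rev_cat addnS.
Qed.

Lemma pr_nseq (A : encType) (x : nat -> nat) (a : nat -> A) :
  pr x -> pr a -> pr (fun e => nseq (x e) (a e)).
Proof.
move=> hx ha; apply: (pr_iter hx (pr_const [::]) (s := fun e => cons (a e))).
by apply: pr_cons; [exact: pr_comp ha (pr_cleft pr_id)|
  apply: pr_dec; exact: pr_cright pr_id].
Qed.

Lemma pr_all (A : encType) (l : nat -> seq A) (f : nat -> A -> bool) :
  pr l -> pr (fun p => f (cleft p) (dec (cright p))) ->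
  pr (fun e => all (f e) (l e)).
Proof.
move=> hl hf.
have := pr_foldr hl (pr_const true) (s := fun e x b => f e x && b).
case; last by move=> c hc; exists c => n; rewrite hc; congr enc.
apply: pr_andb; last by apply: pr_dec; exact: pr_cleft (pr_cright pr_id).
have := pr_comp hf (pr_cpair (pr_cleft pr_id) (pr_cright (pr_cright pr_id))).
by apply: eq_pr => p; rewrite cpairKl cpairKr.
Qed.

Lemma pr_has (A : encType) (l : nat -> seq A) (f : nat -> A -> bool) :
  pr l -> pr (fun p => f (cleft p) (dec (cright p))) ->
  pr (fun e => has (f e) (l e)).
Proof.
move=> hl hf; have := pr_negb (pr_all (f := fun e x => ~~ f e x) hl (pr_negb hf)).
apply: eq_pr => e; rewrite -has_predC.
by apply: eq_has => z /=; rewrite negbK.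
Qed.

Ltac pr_step :=
  match goal with
  | |- pr (fun e => e) => exact: pr_id
  | |- pr dec => exact: (pr_dec _ pr_id)
  | |- pr cleft => exact: (pr_cleft pr_id)
  | |- pr cright => exact: (pr_cright pr_id)
  | H : pr ?x |- pr ?x => exact: H
  | H : pr ?x |- pr (fun e => ?x (@?g e)) => exact: (pr_comp H) || apply: (pr_comp H)
  | |- pr (fun e => ?x) => exact: pr_const
  | |- pr (fun e => dec _) => apply: pr_dec
  | |- pr (fun e => cleft _) => apply: pr_cleft
  | |- pr (fun e => cright _) => apply: pr_cright
  | |- pr (fun e => cpair _ _) => apply: pr_cpair
  | |- pr (fun e => if _ then _ else _) => apply: pr_if
  | |- pr (fun e => (_, _)) => apply: pr_pair
  | |- pr (fun e => fst _) => apply: pr_fst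
  | |- pr (fun e => snd _) => apply: pr_snd
  | |- pr (fun e => (_).+1) => apply: pr_succ
  | |- pr (fun e => (_).-1) => apply: pr_pred
  | |- pr (fun e => _ + _) => apply: pr_addn
  | |- pr (fun e => _ - _) => apply: pr_subn
  | |- pr (fun e => _ * _) => apply: pr_muln
  | |- pr (fun e => _ ^ _) => apply: pr_expn
  | |- pr (fun e => _ <= _) => apply: pr_leq
  | |- pr (fun e => _ && _) => apply: pr_andb
  | |- pr (fun e => _ || _) => apply: pr_orb
  | |- pr (fun e => ~~ _) => apply: pr_negb
  | |- pr (fun e => (_ : nat) == _) => apply: pr_eqn
  | |- pr (fun e => (_ : seq bool) == _) => apply: pr_eq_seq_bool
  | |- pr (fun e => _ :: _) => apply: pr_cons
  | |- pr (fun e => _ ++ _) => apply: pr_cat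
  | |- pr (fun e => rev _) => apply: pr_rev
  | |- pr (fun e => size _) => apply: pr_size
  | |- pr (fun e => flatten _) => apply: pr_flatten
  | |- pr (fun e => iota _ _) => apply: pr_iota
  | |- pr (fun e => nseq _ _) => apply: pr_nseq
  | |- pr (fun e => nth _ _ _) => apply: pr_nth
  | |- pr (fun e => map _ _) => apply: pr_map
  | |- pr (fun e => all _ _) => apply: pr_all
  | |- pr (fun e => has _ _) => apply: pr_has
  | |- pr (fun e => foldr _ _ _) => apply: pr_foldr
  end.
Ltac pr_extra := fail.
Ltac pr_auto := repeat (pr_extra || pr_step).

(** * Register programs and their machines *)

Inductive basic := BInc | BDec | BRead | BEmit.

Inductive cmd :=
  | CBasic of basic & nat
  | CSeq of cmd & cmd
  | CIf of nat & cmd & cmd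
  | CWhile of nat & cmd.

Record cstate := CState {
  reg : nat -> nat;
  ipos : nat;
  outp : seq bool }.

Definition upd (f : nat -> nat) (i v : nat) : nat -> nat :=
  fun j => if j == i then v else f j.

Section Exec.
Variable p : nat -> bool.

Definition run_basic (o : basic) (r : nat) (s : cstate) : cstate :=
  let: CState f i w := s in
  match o with
  | BInc => CState (upd f r (f r).+1) i w
  | BDec => CState (upd f r (f r).-1) i w
  | BRead => CState (upd f r (f r + p i)) i.+1 w
  | BEmit => CState f i (rcons w (f r != 0))
  end.

Inductive exec : cmd -> cstate -> cstate -> Prop :=
  | ExecBasic o r s : exec (CBasic o r) s (run_basic o r s)
  | ExecSeq c d s s' s'' :
      exec c s s' -> exec d s' s'' -> exec (CSeq c d) s s''
  | ExecIfT r c d s s' : reg s r != 0 -> exec c s s' -> exec (CIf r c d) s s'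
  | ExecIfF r c d s s' : reg s r = 0 -> exec d s s' -> exec (CIf r c d) s s'
  | ExecWhileT r c s s' s'' : reg s r != 0 ->
      exec c s s' -> exec (CWhile r c) s' s'' -> exec (CWhile r c) s s''
  | ExecWhileF r c s : reg s r = 0 -> exec (CWhile r c) s s.

Inductive instr := IBasic of basic & nat | ITest of nat & nat | IJump of nat.

Fixpoint csize (c : cmd) : nat :=
  match c with
  | CBasic _ _ => 1
  | CSeq c d => csize c + csize d
  | CIf _ c d => (csize c + csize d).+2
  | CWhile _ c => (csize c).+2
  end.

Fixpoint compile (a : nat) (c : cmd) : seq instr :=
  match c with
  | CBasic o r => [:: IBasic o r]
  | CSeq c d => compile a c ++ compile (a + csize c) d
  | CIf r c d => ITest r (a + csize c).+2 :: compile a.+1 c ++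
      IJump (a + csize c + csize d).+2 :: compile (a + csize c).+2 d
  | CWhile r c => ITest r (a + csize c).+2 :: compile a.+1 c ++ [:: IJump a]
  end.

Lemma size_compile a c : size (compile a c) = csize c.
Proof.
elim: c a => [b r|c IHc d IHd|r c IHc d IHd|r c IHc] a //=;
  by rewrite ?size_cat /= ?IHc ?IHd ?addnS ?addn0.
Qed.

Definition fstep (prog : seq instr) (c : nat * cstate) : nat * cstate :=
  match nth (IJump (size prog)) prog c.1 with
  | IBasic o r => (c.1.+1, run_basic o r c.2)
  | ITest r l => (if reg c.2 r == 0 then l else c.1.+1, c.2)
  | IJump l => (l, c.2)
  end.

Lemma compile_correct c s s' : exec c s s' ->
  forall pre post, let prog := pre ++ compile (size pre) c ++ post in
  exists t, iter t (fstep prog) (size pre, s) = (size pre + csize c, s').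
Proof.
have iterDx (T : Type) (f : T -> T) m n x : iter m f (iter n f x) = iter (m + n) f x.
  by rewrite iterD.
have nthp (pre post : seq instr) i x : nth x (pre ++ i :: post) (size pre) = i.
  by rewrite nth_cat ltnn subnn.
(* The jump that closes a compiled block, reached right after the last instruction of [c1]. *)
have jmp pre r a c1 l post s1 : fstep (pre ++ ITest r a ::
    compile (size pre).+1 c1 ++ IJump l :: post) ((size pre).+1 + csize c1, s1) = (l, s1).
  have -> : (size pre).+1 + csize c1 = size (pre ++ ITest r a :: compile (size pre).+1 c1).
    by rewrite size_cat /= size_compile addnS.
  by rewrite /fstep -cat_cons catA nthp.
elim=> {c s s'} [b r s|c d s s' s'' _ IHc _ IHd|r c d s s' sr _ IH|r c d s s' sr _ IH
  |r c s s' s'' sr _ IHc _ IHw|r c s sr] pre post prog.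
- exists 1; rewrite /= /fstep /= /prog /= nthp /=.
  by rewrite addn1.
- have [t1] := IHc pre (compile (size pre + csize c) d ++ post).
  have [t2] := IHd (pre ++ compile (size pre) c) post.
  rewrite size_cat size_compile -!catA => e2 e1.
  exists (t2 + t1); rewrite iterD /prog /= -!catA e1 e2 /=.
  by rewrite addnA.
- have := IH (rcons pre (ITest r (size pre + csize c).+2))
    (IJump (size pre + csize c + csize d).+2 ::
       compile (size pre + csize c).+2 d ++ post).
  rewrite size_rcons -cats1 -!catA /= => -[t e].
  exists (1 + (t + 1)); rewrite !iterD /prog /= -!catA /=.
  rewrite {3}/fstep /= nthp (negPf sr) e jmp.
  by congr (_, _); lia.
- have := IH (pre ++ ITest r (size pre + csize c).+2 :: compile (size pre).+1 c ++
    [:: IJump (size pre + csize c + csize d).+2]) post.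
  rewrite !size_cat /= !size_cat size_compile /=.
  have -> : size pre + (csize c + 1).+1 = (size pre + csize c).+2 by lia.
  rewrite -!catA /= -!catA /= => -[t e].
  exists (t + 1); rewrite !iterD /prog /= -!catA /=.
  rewrite {2}/fstep /= nthp sr eqxx e.
  by congr (_, _); lia.
- have := IHc (rcons pre (ITest r (size pre + csize c).+2))
    (IJump (size pre) :: post).
  have := IHw pre post.
  rewrite size_rcons -cats1 -!catA /= -!catA /= => -[t2 e2] [t e].
  exists (t2 + (1 + (t + 1))); rewrite !iterD /prog /= -!catA /=.
  rewrite [fstep _ (size pre, s)]/fstep /= nthp (negPf sr) e.
  by rewrite jmp e2.
- exists 1; rewrite /= /fstep /prog /= nthp sr eqxx.
  by congr (_, _); lia.
Qed.
End Exec.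

Fixpoint creg (c : cmd) : nat :=
  match c with
  | CBasic _ r => r.+1
  | CSeq c d => maxn (creg c) (creg d)
  | CIf r c d => maxn r.+1 (maxn (creg c) (creg d))
  | CWhile r c => maxn r.+1 (creg c)
  end.

Definition instr_ok (k l : nat) (i : instr) : bool :=
  match i with
  | IBasic _ r => r < k
  | ITest r l' => (r < k) && (l' <= l)
  | IJump l' => l' <= l
  end.

Lemma instr_ok_le k l k' l' i :
  k <= k' -> l <= l' -> instr_ok k l i -> instr_ok k' l' i.
Proof.
case: i => [b r|r m|m] /= kk ll; try lia.
Qed.

Lemma compile_ok a c : all (instr_ok (creg c) (a + csize c)) (compile a c).
Proof.
elim: c a => [b r|c IHc d IHd|r c IHc d IHd|r c IHc] a.
- by rewrite /= ltnSn.
- rewrite all_cat; apply/andP; split.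
    by apply: sub_all (IHc a) => i; apply: instr_ok_le => /=; lia.
  by apply: sub_all (IHd (a + csize c)) => i; apply: instr_ok_le => /=; lia.
- rewrite /= all_cat /=; apply/and4P; split; [lia| |lia|].
    by apply: sub_all (IHc a.+1) => i; apply: instr_ok_le => /=; lia.
  by apply: sub_all (IHd (a + csize c).+2) => i; apply: instr_ok_le => /=; lia.
- rewrite /= all_cat /=; apply/and4P; split; [lia| |lia|by []].
  by apply: sub_all (IHc a.+1) => i; apply: instr_ok_le => /=; lia.
Qed.

(** * From register programs to Turing machines *)

Section Machine.
Variables (k : nat) (prog : seq instr).
Let n := size prog.
Hypothesis prog_ok : all (instr_ok k n) prog.

(** [None] is the initial state, in which the marks are written on the blank tapes; [Some i] is the
    program counter, and [i = n] means halting. *)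
Let Q : finType := option 'I_n.+1.

(* A register is a tape whose cell 0 carries the only mark: its value is the
   position of the head. *)
Definition prog_delta (q : Q) (b : bool) (sy : {ffun 'I_k -> bool}) :
    action Q bool k :=
  let zero r := [exists j : 'I_k, (j == r :> nat) && sy j] in
  let stay := [ffun j => (sy j, Stay)] in
  if q is Some i then
    match nth (IJump n) prog i with
    | IBasic BInc r => Action (Some (inord i.+1) : Q) false
        [ffun j : 'I_k => (sy j, if j == r :> nat then Right else Stay)] None
    | IBasic BDec r => Action (Some (inord i.+1) : Q) false
        [ffun j : 'I_k => (sy j, if (j == r :> nat) && ~~ sy j then Left else Stay)] None
    | IBasic BRead r => Action (Some (inord i.+1) : Q) true
        [ffun j : 'I_k => (sy j, if (j == r :> nat) && b then Right else Stay)] None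
    | IBasic BEmit r => Action (Some (inord i.+1) : Q) false stay (Some (~~ zero r))
    | ITest r l => Action (Some (inord (if zero r then l else i.+1)) : Q) false stay None
    | IJump l => Action (Some (inord l) : Q) false stay None
    end
  else Action (Some ord0 : Q) false [ffun=> (true, Stay)] None.

Definition prog_machine : machine :=
  @Machine Q bool false k None [set Some ord_max] prog_delta.

Definition simulates (c : config prog_machine) (a : nat * cstate) : Prop :=
  [/\ a.1 <= n, cur_state c = Some (inord a.1),
      input_head c = ipos a.2, output c = outp a.2 &
      (forall j, Defs.head c j = reg a.2 j) /\ (forall j z, tape c j z = (z == 0%R))].

Lemma simulates_step p c a : simulates c a -> simulates (step p c) (fstep p prog a).
Proof.
case: a => i [f ip w] [/= ile ec ei eo [eh et]].
have [ilt|ige] := ltnP i n; last first.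
  have ein : i = n by apply/eqP; rewrite eqn_leq ile.
  have -> : step p c = c.
    rewrite /step ec ein inE (_ : inord n = ord_max) ?eqxx //.
    by apply: val_inj; rewrite /= inordK.
  rewrite /fstep /= nth_default ?ein //; split=> //=.
  by rewrite ec ein.
have := all_nthP (IJump n) prog_ok i ilt.
have ei' : nat_of_ord (inord i : 'I_n.+1) = i by rewrite inordK.
rewrite /step ec inE.
have -> : (Some (inord i : 'I_n.+1) == Some ord_max) = false.
  apply/negP => /eqP [] /(congr1 val) /=.
  by rewrite inordK // => e; rewrite e ltnn in ilt.
rewrite /fstep /= ei' -/n.
have markE j z : (if z == Defs.head c j then tape c j (Defs.head c j)
    else tape c j z) = (z == 0%R) by case: ifP => [/eqP ->|]; rewrite et.
have zeroP r : r < k -> [exists j : 'I_k, (j == r :> nat) &&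
    [ffun j => tape c j (Defs.head c j)] j] = (f r == 0).
  move=> rk; apply/existsP/idP => [[j /andP[/eqP jr]]|fr].
    by rewrite ffunE et eh jr.
  by exists (Ordinal rk); rewrite eqxx ffunE et eh.
case: (nth _ prog i) => [b r|r l|l] /= ok.
- case: b ok => /= ok; split => //=; rewrite ?ei ?addn0 ?addn1 ?eo ?zeroP //.
  + split=> [j|j z]; rewrite !ffunE /= ?markE //.
    by rewrite eh /upd; case: eqP => [->|] //=; lia.
  + split=> [j|j z]; rewrite !ffunE /= ?markE //.
    rewrite et eh /upd; case: eqP => [->|] //=.
    by case: (f r) => //= m; lia.
  + split=> [j|j z]; rewrite !ffunE /= ?markE //.
    by rewrite eh /upd; case: eqP => [->|] //=; case: (p ip) => /=; lia.
  + split=> [j|j z]; rewrite !ffunE /= ?markE //.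
- case/andP: ok => rk ln; rewrite zeroP //; split => //=.
  + by case: ifP.
  + by rewrite ei addn0.
  + split=> [j|j z]; rewrite !ffunE /= ?markE //.
- split => //=; first by rewrite ei addn0.
  split=> [j|j z]; rewrite !ffunE /= ?markE //.
Qed.

Lemma simulates_iter p t c a :
  simulates c a -> simulates (iter t (@step prog_machine p) c) (iter t (fstep p prog) a).
Proof. by move=> h; elim: t => //= t IH; apply: simulates_step. Qed.

Lemma simulates_init p :
  simulates (step p (init prog_machine)) (0, CState (fun=> 0) 0 [::]).
Proof.
rewrite /step /= inE /=; split => //=.
  by congr Some; apply: val_inj; rewrite /= inordK.
by split=> [j|j z]; rewrite !ffunE //=; case: eqP.
Qed.
End Machine.

Theorem cmd_machine (c : cmd) : exists M : machine, forall p s,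
  exec p c (CState (fun=> 0) 0 [::]) s -> halts_with M p (outp s).
Proof.
pose prog := compile 0 c.
have ok : all (instr_ok (creg c) (size prog)) prog.
  by rewrite size_compile; exact: compile_ok.
exists (prog_machine (creg c) prog) => p s ex.
have [t] := compile_correct ex [::] [::]; rewrite cats0 /= add0n -/prog => e.
(* One additional step for the initial state that writes the marks. *)
exists t.+1; rewrite iterSr.
have := simulates_iter ok p t (simulates_init (creg c) prog p); rewrite e.
case=> /= _ ec _ eo _; split=> //; rewrite ec inE.
have -> : csize c = size prog by rewrite size_compile.
by apply/eqP; congr Some; apply: val_inj; rewrite /= inordK.
Qed.

(** * Register programs for primitive recursive functions *)

Notation Inc r := (CBasic BInc r).
Notation Dec r := (CBasic BDec r).
Notation "c ;; d" := (CSeq c d) (at level 60, right associativity).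

Definition transforms p (c : cmd) (f g : nat -> nat) : Prop :=
  forall ip w, exec p c (CState f ip w) (CState g ip w).

Ltac upd_cases := rewrite /upd; repeat (match goal with
  |- context [if ?a == ?b then _ else _] => case: (a =P b) => ? end); subst.
Ltac regv := upd_cases; first [by [] | lia | congruence].
Ltac regs := apply: funext => ?; regv.

Section Pure.
Variable p : nat -> bool.
Notation tr := (transforms p).

Lemma tr_inc r f : tr (Inc r) f (upd f r (f r).+1).
Proof. by move=> ip w; exact: ExecBasic. Qed.

Lemma tr_dec r f : tr (Dec r) f (upd f r (f r).-1).
Proof. by move=> ip w; exact: ExecBasic. Qed.

Lemma tr_seq c d f g h : tr c f g -> tr d g h -> tr (c ;; d) f h.
Proof. by move=> cf dg ip w; apply: ExecSeq (cf _ _) (dg _ _). Qed.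

Lemma tr_ifT r c d f g : f r != 0 -> tr c f g -> tr (CIf r c d) f g.
Proof. by move=> fr cf ip w; apply: ExecIfT (cf _ _). Qed.

Lemma tr_ifF r c d f g : f r = 0 -> tr d f g -> tr (CIf r c d) f g.
Proof. by move=> fr cf ip w; apply: ExecIfF (cf _ _). Qed.

(** [h t] is the register content after [t] rounds: a loop is described by a closed formula for its
    successive states and by the number of rounds. *)
Lemma tr_while r c (h : nat -> nat -> nat) n :
  (forall t, t < n -> h t r != 0 /\ tr c (h t) (h t.+1)) -> h n r = 0 ->
  tr (CWhile r c) (h 0) (h n).
Proof.
move=> hs hn ip w; suff : forall k, k <= n ->
    exec p (CWhile r c) (CState (h (n - k)) ip w) (CState (h n) ip w).
  by move=> /(_ n (leqnn _)); rewrite subnn.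
elim=> [_|k IH kn]; first by rewrite subn0; apply: ExecWhileF.
have [h1 h2] := hs (n - k.+1) ltac:(lia).
apply: (@ExecWhileT p r c (CState (h (n - k.+1)) ip w) _ _ h1 (h2 ip w)).
have -> : (n - k.+1).+1 = n - k by lia.
by apply: IH; exact: ltnW.
Qed.

Lemma tr_eq c f g g' : g = g' -> tr c f g -> tr c f g'.
Proof. by move=> <-. Qed.

Definition cclear i := CWhile i (Dec i).
Lemma tr_clear i f : tr (cclear i) f (upd f i 0).
Proof.
have := @tr_while i (Dec i) (fun t => upd f i (f i - t)) (f i).
rewrite subnn subn0 (_ : upd f i (f i) = f); last by regs.
apply=> [t ti|]; last by rewrite /upd eqxx.
split; first by rewrite /upd eqxx; lia.
apply: tr_eq (tr_dec _ _); regs.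
Qed.

Definition cmove i j := CWhile i (Dec i ;; Inc j).
Lemma tr_move i j f : i <> j -> tr (cmove i j) f (upd (upd f i 0) j (f i + f j)).
Proof.
move=> ij.
have := @tr_while i (Dec i ;; Inc j)
  (fun t => upd (upd f i (f i - t)) j (f j + t)) (f i).
rewrite subnn subn0 addn0 (_ : upd (upd f i (f i)) j (f j) = f); last by regs.
rewrite addnC; apply=> [t ti|]; last regv.
split; first regv.
apply: tr_seq (tr_dec _ _) _; apply: tr_eq (tr_inc _ _); regs.
Qed.

(* Copies register i into i+1, using i+2. *)
Definition ccopy i :=
  CWhile i (Dec i ;; Inc i.+1 ;; Inc i.+2) ;; cmove i.+2 i.
Lemma tr_copy i f : f i.+1 = 0 -> f i.+2 = 0 -> tr (ccopy i) f (upd f i.+1 (f i)).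
Proof.
move=> f1 f2.
apply: (@tr_seq _ _ _ (upd (upd (upd f i 0) i.+1 (f i)) i.+2 (f i))).
  have := @tr_while i (Dec i ;; Inc i.+1 ;; Inc i.+2)
    (fun t => upd (upd (upd f i (f i - t)) i.+1 t) i.+2 t) (f i).
  rewrite subnn subn0 (_ : upd (upd (upd f i (f i)) i.+1 0) i.+2 0 = f); last by regs.
  apply=> [t ti|]; last regv.
  split; first regv.
  do 2!apply: tr_seq (tr_dec _ _) _ || apply: tr_seq (tr_inc _ _) _.
  apply: tr_eq (tr_inc _ _); regs.
apply: tr_eq (tr_move _ _); last by lia.
regs.
Qed.

(* Replaces n in register i by its two components in i+1 and i+2. *)
Definition cunpair i :=
  CWhile i (Dec i ;;
    CIf i.+1 (Dec i.+1 ;; Inc i.+2) (Inc i.+1 ;; cmove i.+2 i.+1)).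
Lemma tr_unpair i f : f i.+1 = 0 -> f i.+2 = 0 ->
  tr (cunpair i) f (upd (upd (upd f i 0) i.+1 (cleft (f i))) i.+2 (cright (f i))).
Proof.
move=> f1 f2.
(* The loop counts the code down while walking along the antidiagonals: after [t] rounds the
   registers [i+1] and [i+2] hold [unpair t]. *)
have := @tr_while i (Dec i ;;
    CIf i.+1 (Dec i.+1 ;; Inc i.+2) (Inc i.+1 ;; cmove i.+2 i.+1))
  (fun t => upd (upd (upd f i (f i - t)) i.+1 (cleft t)) i.+2 (cright t)) (f i).
rewrite subnn subn0 (_ : upd (upd (upd f i (f i)) i.+1 _) i.+2 _ = f); last first.
  by rewrite /cleft /cright /=; regs.
apply=> [t ti|]; last regv.
split; first regv.
rewrite /cleft /cright /unpair iterS -/(unpair t); case: (unpair t) => a b.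
apply: tr_seq (tr_dec _ _) _; case: a => [|a] /=.
  apply: tr_ifF; first regv.
  apply: tr_seq (tr_inc _ _) _.
  apply: tr_eq (tr_move _ _); last by lia.
  regs.
apply: tr_ifT; first regv.
apply: tr_seq (tr_dec _ _) _; apply: tr_eq (tr_inc _ _); regs.
Qed.

(* Moves the pair of registers i+1 and i+2 into i, using i+3. *)
Definition cmkpair i := Inc i.+3 ;;
  CWhile i.+3
    (CIf i.+2 (Dec i.+2 ;; Inc i.+1 ;; Inc i)
      (CIf i.+1 (Dec i.+1 ;; cmove i.+1 i.+2 ;; Inc i) (Dec i.+3))).
Lemma tr_mkpair i f : f i = 0 -> f i.+3 = 0 ->
  tr (cmkpair i) f
    (upd (upd (upd f i (cpair (f i.+1) (f i.+2))) i.+1 0) i.+2 0).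
Proof.
move=> f0 f3; set n := cpair _ _; rewrite /cmkpair; set body := CIf _ _ _.
(* The loop walks the enumeration backwards to [(0, 0)] and counts its steps in register [i].
   Register [i+3] is the flag that stops it; clearing the flag takes one more round, hence [n.+1]
   rounds below. *)
pose g t := upd (upd (upd (upd f i t) i.+1 (cleft (n - t))) i.+2 (cright (n - t)))
  i.+3 1.
pose h t := if t <= n then g t else upd (g n) i.+3 0.
apply: (@tr_seq _ _ _ (h 0)).
  apply: tr_eq (tr_inc _ _); rewrite /h /g /= subn0 cpairKl cpairKr; regs.
have := @tr_while i.+3 body h n.+1; rewrite [h n.+1]/h ltnn.
have -> : upd (g n) i.+3 0 = upd (upd (upd f i n) i.+1 0) i.+2 0.
  by rewrite /g subnn /cleft /cright /=; regs.
apply=> [t tn|]; last regv.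
rewrite /h -ltnS tn; split; first by rewrite /g; regv.
move: tn; rewrite ltnS leq_eqVlt => /orP[/eqP ->|tn].
  rewrite ltnn /body.
  apply: tr_ifF; first by rewrite /g subnn; regv.
  apply: tr_ifF; first by rewrite /g subnn; regv.
  apply: tr_eq (tr_dec _ _); rewrite /g; regs.
rewrite tn /g (_ : n - t = (n - t.+1).+1); last by lia.
rewrite /cleft /cright /unpair iterS -/(unpair _).
case: (unpair _) => -[|a] b; rewrite /next_pair /=.
  apply: tr_ifF; first regv.
  apply: tr_ifT; first regv.
  apply: tr_seq (tr_dec _ _) _.
  apply: tr_seq (tr_move _ _) _; first by lia.
  apply: tr_eq (tr_inc _ _); regs.
apply: tr_ifT; first regv.
apply: tr_seq (tr_dec _ _) _.
apply: tr_seq (tr_inc _ _) _.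
apply: tr_eq (tr_inc _ _); regs.
Qed.

(* Replaces register i by its image, assuming that all registers above i are
   null, and leaving them null. *)
Fixpoint cmd_of_pr (c : prcode) (i : nat) : cmd :=
  match c with
  | PZero => cclear i
  | PSucc => Inc i
  | PPred => Dec i
  | PLeft => cunpair i ;; cmove i.+1 i ;; cclear i.+2
  | PRight => cunpair i ;; cmove i.+2 i ;; cclear i.+1
  | PPair f g => ccopy i ;; cmd_of_pr f i.+1 ;; cmove i i.+2 ;;
      cmd_of_pr g i.+2 ;; cmkpair i
  | PComp f g => cmd_of_pr g i ;; cmd_of_pr f i
  | PIter f => cunpair i ;; cmove i.+2 i ;;
      CWhile i (Dec i ;; cmd_of_pr f i.+1) ;; cmove i.+1 i
  end.

Lemma cmd_of_pr_correct c i f : (forall j, i < j -> f j = 0) ->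
  tr (cmd_of_pr c i) f (upd f i (pr_eval c (f i))).
Proof.
elim: c i f => [||||| c IHc d IHd|c IHc d IHd|c IHc] i f f0 /=.
- exact: tr_clear.
- exact: tr_inc.
- exact: tr_dec.
1,2: have f1 := f0 i.+1 ltac:(lia); have f2 := f0 i.+2 ltac:(lia);
  apply: tr_seq (tr_unpair f1 f2) _; apply: tr_seq (tr_move _ _) _; [by lia|];
  apply: tr_eq (tr_clear _ _); regs.
- have f1 := f0 i.+1 ltac:(lia); have f2 := f0 i.+2 ltac:(lia).
  have f3 := f0 i.+3 ltac:(lia); have f4 := f0 i.+4 ltac:(lia).
  apply: tr_seq (tr_copy _ _) _ => //.
  apply: tr_seq (IHc _ _ _) _.
    by move=> j ij; rewrite /upd ifF; [apply: f0; lia|apply/eqP; lia].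
  apply: tr_seq (tr_move _ _) _; first by lia.
  apply: tr_seq (IHd _ _ _) _.
    by move=> j ij; rewrite /upd !ifF; [apply: f0; lia|apply/eqP; lia..].
  apply: tr_eq (tr_mkpair _ _).
  - set x := pr_eval c _; set y := pr_eval d _; set z := cpair _ _.
    have -> : z = cpair (pr_eval c (f i)) (pr_eval d (f i)).
      rewrite /z /y /x; congr cpair; rewrite /upd.
        by do !case: eqP => ?; try lia.
      rewrite eqxx; congr pr_eval; do !case: eqP => ?; lia.
    regs.
  - regv.
  - regv.
- apply: tr_seq (IHd _ _ f0) _.
  apply: tr_eq (IHc _ _ _).
    by rewrite {3}/upd eqxx; regs.
  by move=> j ij; rewrite /upd ifF; [apply: f0; lia|apply/eqP; lia].
- have f1 := f0 i.+1 ltac:(lia); have f2 := f0 i.+2 ltac:(lia).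
  apply: tr_seq (tr_unpair _ _) _ => //.
  apply: tr_seq (tr_move _ _) _; first by lia.
  set a := cleft (f i); set b := cright (f i).
  pose h t := upd (upd f i (b - t)) i.+1 (iter t (pr_eval c) a).
  apply: (@tr_seq _ _ _ (h b)).
    rewrite (_ : upd _ i (_ + _) = h 0); last by rewrite /h subn0 /=; regs.
    apply: tr_while => [t tb|]; last by rewrite /h; regv.
    split; first by rewrite /h; regv.
    apply: tr_seq (tr_dec _ _) _.
    apply: tr_eq (IHc _ _ _); last first.
      by move=> j ij; rewrite /h /upd !ifF; [apply: f0; lia|apply/eqP; lia..].
    rewrite /h iterS /upd eqxx; regs.
  apply: tr_eq (tr_move _ _); last by lia.
  rewrite /h; regs.
Qed.
End Pure.

(* Register 1 holds the state of the search and register 0 the flag asking for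
   one more input bit; at the end register 1 holds the list of output bits. *)
Definition search_cmd (c : prcode) : cmd :=
  Inc 0 ;;
  CWhile 0 (Dec 0 ;; CBasic BRead 2 ;; cmkpair 0 ;; cmd_of_pr c 0 ;;
    cunpair 0 ;; cmove 2 0) ;;
  CWhile 1 (Dec 1 ;; cunpair 1 ;; CBasic BEmit 2 ;; cclear 2 ;; cmove 3 1).

Lemma exec_tr p c d f g ip w s :
  transforms p c f g -> exec p d (CState g ip w) s ->
  exec p (c ;; d) (CState f ip w) s.
Proof. by move=> h; apply: ExecSeq. Qed.

Lemma search_cmd_correct (p : nat -> bool) c (st : nat -> nat) (n : nat) (w : seq bool) :
  st 0 = 0 ->
  (forall t, t < n -> pr_eval c (cpair (st t) (p t)) = cpair (st t.+1) 1) ->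
  pr_eval c (cpair (st n) (p n)) = cpair (enc w) 0 ->
  exists2 s, exec p (search_cmd c) (CState (fun=> 0) 0 [::]) s & outp s = w.
Proof.
move=> st0 stS stn.
pose rg a b := upd (upd (fun=> 0) 0 a) 1 b.
exists (CState (fun=> 0) n.+1 w) => //.
apply: exec_tr (tr_inc _ _ _) _.
rewrite (_ : upd _ 0 _ = rg 1 (st 0)); last by rewrite /rg st0; regs.
set loop := CWhile 0 _; set emit := CWhile 1 _.
have body t a fl : pr_eval c (cpair (st t) (p t)) = cpair a fl ->
    exec p (Dec 0 ;; CBasic BRead 2 ;; cmkpair 0 ;; cmd_of_pr c 0 ;;
      cunpair 0 ;; cmove 2 0) (CState (rg 1 (st t)) t [::])
      (CState (rg fl a) t.+1 [::]).
  move=> e; apply: exec_tr (tr_dec _ _ _) _.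
  apply: ExecSeq (ExecBasic _ _ _ _) _; rewrite [run_basic _ _ _ _]/=.
  apply: exec_tr (tr_mkpair _ _ _) _; [by regv|by regv|].
  apply: exec_tr (cmd_of_pr_correct _ _ _) _; first by move=> j ?; rewrite /rg; regv.
  rewrite (_ : upd (upd _ 1 0) 2 0 = upd (fun=> 0) 0 (cpair (st t) (p t))); last first.
    by rewrite /rg; apply: funext => j; upd_cases; rewrite //= /upd /= add0n.
  rewrite [in pr_eval _ _]/upd eqxx e.
  apply: exec_tr (tr_unpair _ _ _) _; [by regv|by regv|].
  rewrite [in cleft _]/upd [in cright _]/upd eqxx cpairKl cpairKr.
  have /(_ t.+1 [::]) := @tr_move p 2 0
    (upd (upd (upd (upd (upd (fun=> 0) 0 (cpair (st t) (p t))) 0 (cpair a fl)) 0 0)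
      1 a) 2 fl) ltac:(lia).
  congr exec; congr CState; rewrite /rg; apply: funext => j; upd_cases => //.
  by rewrite addn0.
apply: (@ExecSeq _ _ _ _ (CState (rg 0 (enc w)) n.+1 [::])).
  suff h : forall k, k <= n ->
      exec p loop (CState (rg 1 (st (n - k))) (n - k) [::])
       (CState (rg 0 (enc w)) n.+1 [::]).
    by have := h n (leqnn n); rewrite subnn.
  elim=> [_|k IH kn].
    rewrite subn0; apply: ExecWhileT (body _ _ _ stn) _ => //.
    by apply: ExecWhileF.
  have e := stS (n - k.+1) ltac:(lia).
  apply: ExecWhileT (body _ _ _ e) _ => //.
  have -> : (n - k.+1).+1 = n - k by lia.
  by apply: IH; exact: ltnW.
rewrite -[w in CState (fun=> 0) _ w](cat0s w).
elim: w [::] {stn} => [|b w IH] v.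
  rewrite cats0 (_ : rg 0 _ = fun=> 0); last by rewrite /rg; regs.
  exact: ExecWhileF.
apply: (@ExecWhileT _ _ _ _ (CState (rg 0 (enc w)) n.+1 (rcons v b))) => //; last first.
  by rewrite -cat_rcons; exact: IH.
apply: exec_tr (tr_dec _ _ _) _.
apply: exec_tr (tr_unpair _ _ _) _; [by regv|by regv|].
rewrite (_ : upd _ _ _ = upd (upd (fun=> 0) 2 b) 3 (enc w)); last first.
  have -> : upd (rg 0 (enc (b :: w))) 1 (rg 0 (enc (b :: w)) 1).-1 1 =
    cpair (enc b) (enc w) by [].
  rewrite cpairKl cpairKr /rg; regs.
apply: ExecSeq (ExecBasic _ _ _ _) _; rewrite [run_basic _ _ _ _]/=.
have -> : (upd (upd (fun=> 0) 2 b) 3 (enc w) 2 != 0) = b by case: b.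
apply: exec_tr (tr_clear _ _ _) _.
have /(_ n.+1 (rcons v b)) := @tr_move p 3 1
  (upd (upd (upd (fun=> 0) 2 b) 3 (enc w)) 2 0) ltac:(lia).
congr exec; congr CState; rewrite /rg; apply: funext => j; upd_cases => //.
by rewrite addn0.
Qed.

(* The machine reads the input bit by bit; after t bits it tests whether the
   certificate coded by cleft t is accepted by these bits. *)
Theorem search_machine (T : encType) (check : T -> seq bool -> bool)
    (out : T -> seq bool) :
  pr (fun e => check (dec (cleft e)) (dec (cright e))) ->
  pr (fun e => out (dec e)) ->
  exists M, forall p : nat -> bool,
    (exists c n, forall k, n <= k -> check c (mkseq p k)) ->
    exists c k, check c (mkseq p k) /\ halts_with M p (out c).
Proof.
move=> hc ho.
(* The argument is the state, time paired with history, together with the bit just read. The history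
   is stored backwards, so that a new bit is a [cons], and the initial state is coded by 0, the
   initial value of all registers. *)
pose hist n := dec (cright (cleft n)) : seq bool.
pose bits n := (cright n != 0) :: hist n.
pose cert n := cleft (cleft (cleft n)).
pose stepf n : nat := if check (dec (cert n)) (rev (bits n))
  then cpair (enc (out (dec (cert n)))) 0
  else cpair (cpair (cleft (cleft n)).+1 (enc (bits n))) 1.
have hbits : pr bits by rewrite /bits /hist; pr_auto; exact: pr_eq0 (pr_cright pr_id).
have [c hcode] : pr stepf.
  apply: pr_if.
  - have h : pr (fun n => cpair (cert n) (enc (rev (bits n)))).
      by apply: pr_cpair; [rewrite /cert; pr_auto|apply: pr_enc; pr_auto].
    by have := pr_comp hc h; apply: eq_pr => n; rewrite cpairKl cpairKr encK.
  - apply: pr_cpair; last exact: pr_const.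
    apply: pr_enc; have := pr_comp ho (_ : pr cert).
    by apply; rewrite /cert; pr_auto.
  - apply: pr_cpair; last exact: pr_const.
    by apply: pr_cpair; [pr_auto|apply: pr_enc; pr_auto].
have [M hM] := cmd_machine (search_cmd c).
exists M => p [c0 [n0 hc0]].
pose ok t := check (dec (cleft t)) (mkseq p t.+1).
have ex : exists t, ok t.
  (* The time [cpair c n] calls for the certificate [c] whatever [n] is, so each certificate is
     tested against arbitrarily long prefixes of the input. *)
  exists (cpair (enc c0) n0); rewrite /ok cpairKl encK; apply: hc0.
  by rewrite leqW // leq_cpairr.
pose st t := cpair t (enc (rev (mkseq p t))).
have stepE t : stepf (cpair (st t) (p t)) =
    if ok t then cpair (enc (out (dec (cleft t)))) 0 else cpair (st t.+1) 1.
  rewrite /stepf /cert /bits /hist !(cpairKl, cpairKr) encK.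
  have -> : ((p t : nat) != 0) = p t by case: (p t).
  have -> : p t :: rev (mkseq p t) = rev (mkseq p t.+1).
    by rewrite /mkseq -addn1 iotaD map_cat rev_cat.
  by rewrite revK -/(ok t).
pose n := ex_minn ex; have okn : ok n by rewrite /n; case: ex_minnP.
have lt_ok t : t < n -> ok t = false.
  rewrite /n; case: ex_minnP => m _ hm tm; apply/negP => /hm.
  by rewrite leqNgt tm.
have [|||s hs ws] := @search_cmd_correct p c st n (out (dec (cleft n))).
- by [].
- by move=> t tn; rewrite hcode stepE lt_ok.
- by rewrite hcode stepE okn.
by exists (dec (cleft n)), n.+1; split=> //; rewrite -ws; apply: hM.
Qed.

(** * Codes of the input *)

Definition prefix_free (T : Type) (code : T -> seq bool) : Prop :=
  forall a b u v, code a ++ u = code b ++ v -> a = b /\ u = v.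

Lemma prefix_free_nat : prefix_free code_nat.
Proof.
elim=> [|a IH] [|b] u v //=; rewrite /code_nat /=; first by case.
by case=> /IH [-> ->].
Qed.

Lemma prefix_free_pair (T U : Type) (f : T -> seq bool) (g : U -> seq bool) :
  prefix_free f -> prefix_free g -> prefix_free (fun p => f p.1 ++ g p.2).
Proof.
move=> hf hg [a b] [a' b'] u v /=; rewrite -!catA.
by case/hf => -> /hg [-> ->].
Qed.

Lemma prefix_free_flatten (T : Type) (code : T -> seq bool) s t u v :
  prefix_free code -> size s <= size t ->
  flatten (map code s) ++ u = flatten (map code t) ++ v -> s = take (size s) t.
Proof.
move=> h; elim: s t => [|a s IH] [|b t] //=; rewrite ?take0 // ltnS => st.
by rewrite -!catA => /h [-> /(IH _ st) {1}->].
Qed.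

Lemma prefix_free_seq (T : Type) (code : T -> seq bool) :
  prefix_free code -> prefix_free (code_seq code).
Proof.
move=> h a b u v; rewrite /code_seq -!catA => /prefix_free_nat [].
elim: a b => [|x a IH] [|y b] //= [ab]; rewrite -!catA.
by move=> /h [-> /(IH _ ab) [-> ->]].
Qed.

(** Sign, numerator and denominator exactly as [code_rat] writes them; the test thus handles
    rationals as tuples of naturals. *)
Definition code_coef (c : bool * (nat * nat)) : seq bool :=
  c.1 :: (code_nat c.2.1 ++ code_nat c.2.2).
Definition coef_of_rat (q : rat) : bool * (nat * nat) :=
  ((q < 0)%R, (`|numq q|, `|denq q|)).
Definition code_coefs (P : seq (seq (bool * (nat * nat)))) : seq bool :=
  code_seq (fun p => code_seq code_coef p) P.
Definition coefs_of_poly (P : {poly {poly rat}}) : seq (seq (bool * (nat * nat))) :=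
  map (fun p : {poly rat} => map coef_of_rat p) P.
Definition code_coefs2 (w : seq (seq (bool * (nat * nat))) *
    seq (seq (bool * (nat * nat)))) : seq bool :=
  code_coefs w.1 ++ code_coefs w.2.

Lemma code_seq_map (T U : Type) (f : U -> seq bool) (g : T -> U) s :
  code_seq f (map g s) = code_seq (f \o g) s.
Proof. by rewrite /code_seq size_map -map_comp. Qed.

Lemma code_polyE P : code_poly P = code_coefs (coefs_of_poly P).
Proof.
rewrite /code_coefs /coefs_of_poly code_seq_map.
rewrite /code_poly {1}/code_seq [RHS]/code_seq; congr (_ ++ flatten _).
by apply: eq_map => p /=; rewrite code_seq_map.
Qed.

Lemma prefix_free_coef : prefix_free code_coef.
Proof.
move=> [s [a d]] [s' [a' d']] u v [<-] /=; rewrite -!catA.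
by move=> /prefix_free_nat [<-] /prefix_free_nat [<- <-].
Qed.

Lemma prefix_free_coefs2 : prefix_free code_coefs2.
Proof.
by apply: prefix_free_pair; do 2!apply: prefix_free_seq; exact: prefix_free_coef.
Qed.

Lemma flatten_mkseqS (ws : nat -> seq bool) m :
  flatten (mkseq ws m.+1) = flatten (mkseq ws m) ++ ws m.
Proof. by rewrite /mkseq -addn1 iotaD map_cat flatten_cat /= cats0. Qed.

Lemma flatten_mkseq_prefix (ws : nat -> seq bool) m k : m <= k ->
  exists s, flatten (mkseq ws k) = flatten (mkseq ws m) ++ s.
Proof.
elim: k => [|k IH]; first by rewrite leqn0 => /eqP ->; exists [::].
rewrite leq_eqVlt => /orP[/eqP <-|/IH [s e]]; first by exists [::]; rewrite cats0.
by exists (s ++ ws k); rewrite flatten_mkseqS e catA.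
Qed.

Lemma concat_stream_prefix (ws : nat -> seq bool) m :
  (forall k, 0 < size (ws k)) ->
  mkseq (concat_stream ws) (size (flatten (mkseq ws m))) = flatten (mkseq ws m).
Proof.
move=> ws0; have szf k : k <= size (flatten (mkseq ws k)).
  by elim: k => // k IH; rewrite flatten_mkseqS size_cat -addn1 leq_add.
apply: (@eq_from_nth _ false); rewrite size_mkseq // => i im.
rewrite nth_mkseq // /concat_stream.
have [le|le] := leqP i.+1 m.
  have [s ->] := flatten_mkseq_prefix ws le.
  by rewrite nth_cat szf.
by have [s ->] := flatten_mkseq_prefix ws (ltnW le); rewrite nth_cat im.
Qed.

Definition input_words (P : nat -> 'I_2 -> {poly {poly rat}}) (k : nat) :=
  (coefs_of_poly (P k ord0), coefs_of_poly (P k (lift ord0 ord0))).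

Definition code_words (n0 : nat) ws : seq bool :=
  code_nat n0 ++ flatten (map code_coefs2 ws).

Section Input.
Variables (n0 : nat) (P : nat -> 'I_2 -> {poly {poly rat}}).

Lemma code_input_prefix k :
  let w := code_words n0 (mkseq (input_words P) k) in
  mkseq (code_input n0 P) (size w) = w.
Proof.
rewrite /=.
set ws := fun k => if k is k'.+1 then code_poly (P k' 0%R) ++ code_poly (P k' 1%R)
    else code_nat n0.
have -> : code_words n0 (mkseq (input_words P) k) = flatten (mkseq ws k.+1).
  rewrite /code_words /mkseq /= -[1]addn0 iotaDl -!map_comp.
  congr (_ ++ flatten _); apply: eq_map => i /=.
  rewrite !code_polyE /code_coefs2 /input_words /=.
  by congr (_ ++ code_coefs (coefs_of_poly (P i _))); apply: val_inj.
apply: concat_stream_prefix => -[|i] /=.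
  by rewrite /code_nat size_rcons.
by rewrite size_cat addn_gt0 /code_poly /code_seq size_cat addn_gt0
  /code_nat size_rcons.
Qed.

Lemma code_input_inj n0' ws' :
  let w := code_words n0' ws' in
  mkseq (code_input n0 P) (size w) = w ->
  n0' = n0 /\ ws' = mkseq (input_words P) (size ws').
Proof.
(* The first summand makes the true list of words at least as long as [ws']; the second makes its
   code at least as long as [w], because every word is nonempty. Then [w] is a prefix of a true
   code, and prefix-freeness identifies the two word by word. *)
move=> w e; set k := size ws' + size w.
have sz2 x : 0 < size (code_coefs2 x).
  by rewrite size_cat addn_gt0 /code_coefs /code_seq size_cat addn_gt0
    /code_nat size_rcons.
have szw : size w <= size (code_words n0 (mkseq (input_words P) k)).
  rewrite /code_words size_cat; apply: leq_trans (leq_addl _ _).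
  apply: leq_trans (leq_addl (size ws') _) _; rewrite -/k.
  elim: (k) => // i IH; rewrite /mkseq -addn1 iotaD !map_cat flatten_cat size_cat.
  by rewrite leq_add //= cats0.
have [u eu] : exists u, w ++ u = code_words n0 (mkseq (input_words P) k).
  set x := code_words n0 _ in szw *.
  exists (drop (size w) x); rewrite -[RHS](cat_take_drop (size w)); congr (_ ++ _).
  have xE : mkseq (code_input n0 P) (size x) = x := code_input_prefix k.
  rewrite -[LHS]e -[in RHS]xE /mkseq -map_take take_iota.
  by rewrite (minn_idPl szw).
move: eu; rewrite /w /code_words -catA => /prefix_free_nat [-> eu].
split=> //; have := @prefix_free_flatten _ _ ws' (mkseq (input_words P) k) u [::]
  prefix_free_coefs2.
rewrite cats0 => /(_ _ eu) {1}-> //; last by rewrite size_mkseq leq_addr.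
by rewrite /mkseq -map_take take_iota (minn_idPl _) ?leq_addr.
Qed.

End Input.

(** An odd number over a power of two is in lowest terms, so its code is known without computing a
    gcd. This is the reason for the shape of the vertices in [vertex_coef]. *)
Lemma code_rat_odd (s : bool) (b j : nat) :
  code_rat ((-1) ^+ s * (2 * b + 1)%:R / (2 ^ j)%:R)%R =
  code_coef (s, (2 * b + 1, 2 ^ j)).
Proof.
rewrite -[((-1) ^+ s * (2 * b + 1)%:R)%R]/((-1) ^+ s * (2 * b + 1)%:R)%R.
have -> : ((-1) ^+ s * (2 * b + 1)%:R = ((-1) ^+ s * (Posz (2 * b + 1)))%:~R :> rat)%R.
  by rewrite rmorphM rmorphXn /= rmorphN1.
have -> : ((2 ^ j)%:R = (Posz (2 ^ j))%:~R :> rat)%R by [].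
have j0 : (0 < (Posz (2 ^ j)))%R by rewrite ltz_nat expn_gt0.
have cop : coprime `|((-1) ^+ s * (Posz (2 * b + 1)))%R| `|(Posz (2 ^ j))|.
  rewrite abszMsign !absz_nat; apply: coprimeXr.
  by rewrite coprimen2 oddD oddM.
rewrite /code_rat /code_coef coprimeq_num // coprimeq_den //=.
rewrite gtr0_sg // mul1r abszMsign absz_nat (gt_eqF j0).
congr (_ :: _ ++ _).
rewrite pmulr_llt0 ?invr_gt0 ?ltr0z // ltrz0.
by case: s {cop}; rewrite ?mulN1r ?mul1r //= oppr_lt0 ltz_nat addn1.
Qed.

(** * Certificates *)

(* Simultaneous Horner evaluation of a polynomial and of its derivatives. *)
Section Dual.
Variables (T : Type) (z : T) (add mul : T -> T -> T).
Definition dual1 (x : T) (p : seq T) : T * T :=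
  foldr (fun c d => (add c (mul x d.1), add d.1 (mul x d.2))) (z, z) p.
Definition dual2 (x y : T) (P : seq (seq T)) : T * (T * T) :=
  foldr (fun p d => (add (dual1 x p).1 (mul y d.1),
    (add (dual1 x p).2 (mul y d.2.1), add d.1 (mul y d.2.2)))) (z, (z, z)) P.
End Dual.

(* ((a, b), d) stands for the fraction (a - b) / d. *)
Notation fnum := (nat * nat * nat)%type.
Definition nzero : fnum := (0, 0, 1).
Definition nadd (x y : fnum) : fnum :=
  (x.1.1 * y.2 + y.1.1 * x.2, x.1.2 * y.2 + y.1.2 * x.2, x.2 * y.2).
Definition nmul (x y : fnum) : fnum :=
  (x.1.1 * y.1.1 + x.1.2 * y.1.2, x.1.1 * y.1.2 + x.1.2 * y.1.1, x.2 * y.2).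
Definition nopp (x : fnum) : fnum := (x.1.2, x.1.1, x.2).
Definition nle (x y : fnum) : bool :=
  x.1.1 * y.2 + y.1.2 * x.2 <= y.1.1 * x.2 + x.1.2 * y.2.
Definition nlt (x y : fnum) : bool := ~~ nle y x.
Definition nfrac (a b : nat) : fnum := (a, 0, b).
Definition nabs_le (x y : fnum) : bool := nle x y && nle (nopp x) y.
Definition nabs_ge (x y : fnum) : bool := nle y x || nle y (nopp x).
Definition num_of_coef (c : bool * (nat * nat)) : fnum :=
  if c.1 then (0, c.2.1, c.2.2) else (c.2.1, 0, c.2.2).
Definition dual2_coefs (x y : fnum) (P : seq (seq (bool * (nat * nat)))) :=
  dual2 nzero nadd nmul x y (map (map num_of_coef) P).

(** A common bound on [[-1, 1]] for the polynomial, its derivative and the Lipschitz constants of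
    both. The 3 comes from the Horner step for the derivative, [p + x p']: if [N] works for [p] and
    [p'], the first term needs [N] and the product [2 N]. Numerators replace coefficients because
    denominators are at least 1. *)
Definition bound1 (p : seq (bool * (nat * nat))) : nat :=
  foldr (fun c b => c.2.1 + 3 * b) 0 p.
Definition bound2 (P : seq (seq (bool * (nat * nat)))) : nat :=
  foldr (fun p b => bound1 p + 3 * b) 0 P.

Definition vertex_coef (j : nat) (v : bool * nat) : bool * (nat * nat) :=
  (v.1, (2 * v.2 + 1, 2 ^ j)).
Definition vertex_num (j : nat) (v : bool * nat) : fnum :=
  num_of_coef (vertex_coef j v).
Definition grid (m a : nat) : fnum := (a, m, m).

(** The margins are one mesh wide: a point within [1/m] of an [inner1] grid point lies in the open
    square, and a grid point within [1/m] of a point of the square passes [near1]. *)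
Definition inner1 n m (q g : fnum) : bool :=
  nlt (nadd q (nfrac 1 m)) g && nlt (nadd g (nfrac 1 m)) (nadd q (nfrac 1 n)).
Definition near1 n m (q g : fnum) : bool :=
  nle q (nadd g (nfrac 1 m)) && nle g (nadd (nadd q (nfrac 1 n)) (nfrac 1 m)).
Definition inside1 n (q : fnum) : bool :=
  nle (0, 1, 1) q && nle (nadd q (nfrac 1 n)) (nfrac 1 1).
Definition apart1 n (q r : fnum) : bool :=
  nlt (nadd q (nfrac 1 n)) r || nlt (nadd r (nfrac 1 n)) q.

(** The same [e] bounds the entries from above and, through [1/e], the determinant from below; these
    two bounds decide how precisely the entries must be known (see [det_perturb]). *)
Definition check_det e (g h : fnum * fnum) : bool :=
  nabs_le g.1 (nfrac e 1) && nabs_le g.2 (nfrac e 1) &&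
  nabs_le h.1 (nfrac e 1) && nabs_le h.2 (nfrac e 1) &&
  nabs_ge (nadd (nmul g.1 h.2) (nopp (nmul g.2 h.1))) (nfrac 1 e).

Notation coefs2 := (seq (seq (bool * (nat * nat)))).
Notation vertex := ((bool * nat) * (bool * nat))%type.

(** Let [u = 1/e]. The bound [1/(2e)] leaves room for the approximation error, so that both
    components of [f] are at most [u] at a center and the squared Euclidean norm is at most [2 u^2].
    The bound [3/e] in [check_far] likewise leaves some component at least [2 u] outside of the
    squares, where the squared norm is thus at least [4 u^2]. *)
Definition check_center j n e (P : coefs2) (v : vertex) : bool :=
  nabs_le (dual2_coefs (nadd (vertex_num j v.1) (nfrac 1 (2 * n)))
    (nadd (vertex_num j v.2) (nfrac 1 (2 * n))) P).1 (nfrac 1 (2 * e)).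
Definition check_far j n m e (P Q : coefs2) (C : seq vertex) a b : bool :=
  has (fun v => inner1 n m (vertex_num j v.1) (grid m a) &&
    inner1 n m (vertex_num j v.2) (grid m b)) C ||
  nabs_ge (dual2_coefs (grid m a) (grid m b) P).1 (nfrac 3 e) ||
  nabs_ge (dual2_coefs (grid m a) (grid m b) Q).1 (nfrac 3 e).
Definition check_unique j n m e (P Q : coefs2) (v : vertex) a b a' b' : bool :=
  ~~ (near1 n m (vertex_num j v.1) (grid m a) &&
      near1 n m (vertex_num j v.2) (grid m b)) ||
  ~~ (near1 n m (vertex_num j v.1) (grid m a') &&
      near1 n m (vertex_num j v.2) (grid m b')) ||
  check_det e (dual2_coefs (grid m a) (grid m b) P).2
    (dual2_coefs (grid m a') (grid m b') Q).2.

Definition check_squares j n (C : seq vertex) : bool :=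
  all (fun v => inside1 n (vertex_num j v.1) && inside1 n (vertex_num j v.2)) C &&
  all (fun i => all (fun k => (i == k) ||
      apart1 n (vertex_num j (nth (false, 0, (false, 0)) C i).1)
        (vertex_num j (nth (false, 0, (false, 0)) C k).1) ||
      apart1 n (vertex_num j (nth (false, 0, (false, 0)) C i).2)
        (vertex_num j (nth (false, 0, (false, 0)) C k).2))
    (iota 0 (size C))) (iota 0 (size C)).

Definition check_zeros j n m e (P Q : coefs2) (C : seq vertex) : bool :=
  all (fun v => check_center j n e P v && check_center j n e Q v) C &&
  all (fun a => all (fun b => check_far j n m e P Q C a b)
    (iota 0 (2 * m + 1))) (iota 0 (2 * m + 1)) &&
  all (fun v => all (fun a => all (fun b => all (fun a' => all (fun b' =>
      check_unique j n m e P Q v a b a' b')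
    (iota 0 (2 * m + 1))) (iota 0 (2 * m + 1)))
    (iota 0 (2 * m + 1))) (iota 0 (2 * m + 1))) C.

Definition coefs2_enc : encType :=
  seq_enc (seq_enc (pair_enc bool_enc (pair_enc nat_enc nat_enc))).
Definition cert_enc : encType :=
  pair_enc (pair_enc nat_enc (pair_enc (seq_enc (pair_enc coefs2_enc coefs2_enc))
    (pair_enc coefs2_enc coefs2_enc)))
  (pair_enc (pair_enc (pair_enc nat_enc nat_enc) (pair_enc nat_enc nat_enc))
    (seq_enc (pair_enc (pair_enc bool_enc nat_enc) (pair_enc bool_enc nat_enc)))).

(* The input is not parsed: a certificate contains the part of the input that it
   uses, which is encoded again and compared with the bits read so far. *)
Definition check_body (n0 k : nat) (P Q : coefs2) (n m e j : nat) (C : seq vertex) :=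
  (n0 <= n) && (0 < n) && (0 < m) && (0 < e) && (32 * (e * e) <= 2 ^ k) &&
  (32 * (bound2 P + bound2 Q) * (e * e) <= m) &&
  check_squares j n C && check_zeros j n m e P Q C.

Definition check (c : cert_enc) (H : seq bool) : bool :=
  let w := code_words c.1.1 (c.1.2.1 ++ [:: c.1.2.2]) in
  (size w <= size H) && (map (nth false H) (iota 0 (size w)) == w) &&
  check_body c.1.1 (size c.1.2.1) c.1.2.2.1 c.1.2.2.2
    c.2.1.1.1 c.2.1.1.2 c.2.1.2.1 c.2.1.2.2 c.2.2.

Definition cert_output (c : cert_enc) : seq bool :=
  code_nat c.2.1.1.1 ++ code_nat (size c.2.2) ++
  code_seq (fun v : vertex => code_coef (vertex_coef c.2.1.2.2 v.1) ++
    code_coef (vertex_coef c.2.1.2.2 v.2)) c.2.2.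

(** * Primitive recursiveness of the test *)

Section PrNum.
Variables (x y : nat -> fnum) (a b : nat -> nat).
Hypotheses (hx : pr x) (hy : pr y) (ha : pr a) (hb : pr b).
Lemma pr_nadd : pr (fun e => nadd (x e) (y e)).
Proof. rewrite /nadd; pr_auto. Qed.
Lemma pr_nmul : pr (fun e => nmul (x e) (y e)).
Proof. rewrite /nmul; pr_auto. Qed.
Lemma pr_nopp : pr (fun e => nopp (x e)).
Proof. rewrite /nopp; pr_auto. Qed.
Lemma pr_nle : pr (fun e => nle (x e) (y e)).
Proof. rewrite /nle; pr_auto. Qed.
Lemma pr_nfrac : pr (fun e => nfrac (a e) (b e)).
Proof. rewrite /nfrac; pr_auto. Qed.
Lemma pr_grid : pr (fun e => grid (a e) (b e)).
Proof. rewrite /grid; pr_auto. Qed.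
End PrNum.

Ltac pr_num := match goal with
  | |- pr (fun e => nadd _ _) => apply: pr_nadd
  | |- pr (fun e => nmul _ _) => apply: pr_nmul
  | |- pr (fun e => nopp _) => apply: pr_nopp
  | |- pr (fun e => nle _ _) => apply: pr_nle
  | |- pr (fun e => nfrac _ _) => apply: pr_nfrac
  | |- pr (fun e => grid _ _) => apply: pr_grid
  end.
Ltac pr_extra ::= pr_num.

Section PrDual.
Variables (n : nat -> nat) (c : nat -> bool * (nat * nat)) (v : nat -> bool * nat).
Variables (x y : nat -> fnum) (p : nat -> seq fnum) (P : nat -> coefs2).
Hypotheses (hn : pr n) (hc : pr c) (hv : pr v) (hx : pr x) (hy : pr y)
  (hp : pr p) (hP : pr P).
Lemma pr_num_of_coef : pr (fun e => num_of_coef (c e)).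
Proof. rewrite /num_of_coef; pr_auto. Qed.
Lemma pr_vertex_coef : pr (fun e => vertex_coef (n e) (v e)).
Proof. rewrite /vertex_coef; pr_auto. Qed.
Lemma pr_dual1 : pr (fun e => dual1 nzero nadd nmul (x e) (p e)).
Proof. rewrite /dual1; pr_auto. Qed.
Lemma pr_bound2 : pr (fun e => bound2 (P e)).
Proof. rewrite /bound2 /bound1; pr_auto. Qed.
End PrDual.

Lemma pr_vertex_num (x : nat -> nat) (v : nat -> bool * nat) :
  pr x -> pr v -> pr (fun e => vertex_num (x e) (v e)).
Proof. move=> hx hv; exact: pr_num_of_coef (pr_vertex_coef hx hv). Qed.

Ltac pr_dual := match goal with
  | |- pr (fun e => num_of_coef _) => apply: pr_num_of_coef
  | |- pr (fun e => vertex_coef _ _) => apply: pr_vertex_coef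
  | |- pr (fun e => vertex_num _ _) => apply: pr_vertex_num
  | |- pr (fun e => dual1 _ _ _ _ _) => apply: pr_dual1
  | |- pr (fun e => bound2 _) => apply: pr_bound2
  end.
Ltac pr_extra ::= first [pr_num | pr_dual].

Section PrCheck.
Variables (n m e : nat -> nat) (q g : nat -> fnum) (u v : nat -> fnum * fnum).
Variable P : nat -> coefs2.
Hypotheses (hn : pr n) (hm : pr m) (he : pr e) (hq : pr q) (hg : pr g)
  (hu : pr u) (hv : pr v) (hP : pr P).
Lemma pr_dual2_coefs : pr (fun i => dual2_coefs (q i) (g i) (P i)).
Proof. rewrite /dual2_coefs /dual2; pr_auto. Qed.
Lemma pr_inner1 : pr (fun i => inner1 (n i) (m i) (q i) (g i)).
Proof. rewrite /inner1 /nlt; pr_auto. Qed.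
Lemma pr_near1 : pr (fun i => near1 (n i) (m i) (q i) (g i)).
Proof. rewrite /near1; pr_auto. Qed.
Lemma pr_check_det : pr (fun i => check_det (e i) (u i) (v i)).
Proof. rewrite /check_det /nabs_le /nabs_ge; pr_auto. Qed.
End PrCheck.

Ltac pr_test := match goal with
  | |- pr (fun e => dual2_coefs _ _ _) => apply: pr_dual2_coefs
  | |- pr (fun e => inner1 _ _ _ _) => apply: pr_inner1
  | |- pr (fun e => near1 _ _ _ _) => apply: pr_near1
  | |- pr (fun e => check_det _ _ _) => apply: pr_check_det
  end.
Ltac pr_extra ::= first [pr_num | pr_dual | pr_test].

Section PrCheck2.
Variables n m e j a b a' b' : nat -> nat.
Variables (P Q : nat -> coefs2) (w : nat -> vertex) (C : nat -> seq vertex).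
Hypotheses (hn : pr n) (hm : pr m) (he : pr e) (hj : pr j) (ha : pr a)
  (hb : pr b) (ha' : pr a') (hb' : pr b')
  (hP : pr P) (hQ : pr Q) (hw : pr w) (hC : pr C).
Lemma pr_check_center :
  pr (fun i => check_center (j i) (n i) (e i) (P i) (w i)).
Proof. rewrite /check_center /nabs_le; pr_auto. Qed.
Lemma pr_check_far :
  pr (fun i => check_far (j i) (n i) (m i) (e i) (P i) (Q i) (C i) (a i) (b i)).
Proof. rewrite /check_far /nabs_ge; pr_auto. Qed.
Lemma pr_check_unique :
  pr (fun i => check_unique (j i) (n i) (m i) (e i) (P i) (Q i) (w i)
    (a i) (b i) (a' i) (b' i)).
Proof. rewrite /check_unique; pr_auto. Qed.
Lemma pr_check_squares : pr (fun i => check_squares (j i) (n i) (C i)).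
Proof. rewrite /check_squares /inside1 /apart1 /nlt; pr_auto. Qed.
Lemma pr_code_nat : pr (fun i => code_nat (a i)).
Proof.
have : pr (fun i => nseq (a i) true ++ [:: false]) by pr_auto.
by apply: eq_pr => i; rewrite cats1.
Qed.
End PrCheck2.

Lemma pr_code_seq (T : encType) (l : nat -> seq T) (f : nat -> T -> seq bool) :
  pr l -> pr (fun p => f (cleft p) (dec (cright p))) ->
  pr (fun e => code_seq (f e) (l e)).
Proof.
move=> hl hf; rewrite /code_seq.
by apply: pr_cat; [apply: pr_code_nat; pr_auto|apply: pr_flatten; exact: pr_map].
Qed.

Ltac pr_extra ::= match goal with
  | |- pr (fun e => check_center _ _ _ _ _) => apply: pr_check_center
  | |- pr (fun e => check_far _ _ _ _ _ _ _ _ _) => apply: pr_check_far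
  | |- pr (fun e => check_unique _ _ _ _ _ _ _ _ _ _ _) => apply: pr_check_unique
  | |- pr (fun e => check_squares _ _ _) => apply: pr_check_squares
  | |- pr (fun e => code_nat _) => apply: pr_code_nat
  | |- pr (fun e => code_seq _ _) => apply: pr_code_seq
  | _ => pr_dual
  end.

Lemma pr_cert_output : pr (fun e => cert_output (dec e)).
Proof. rewrite /cert_output /code_coef; pr_auto. Qed.

Lemma pr_check : pr (fun e => check (dec (cleft e)) (dec (cright e))).
Proof.
pose w c := code_words (dec c : cert_enc).1.1
    ((dec c : cert_enc).1.2.1 ++ [:: (dec c : cert_enc).1.2.2]).
have hw : pr w.
  by rewrite /w /code_words /code_coefs2 /code_coefs /code_coef; pr_auto.
pose T := cert_enc.
have : pr (fun e => (size (w (cleft e)) <= size (dec (cright e) : seq bool)) &&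
  (map (nth false (dec (cright e))) (iota 0 (size (w (cleft e)))) == w (cleft e)) &&
  check_body (dec (cleft e) : T).1.1 (size (dec (cleft e) : T).1.2.1)
    (dec (cleft e) : T).1.2.2.1 (dec (cleft e) : T).1.2.2.2
    (dec (cleft e) : T).2.1.1.1 (dec (cleft e) : T).2.1.1.2
    (dec (cleft e) : T).2.1.2.1 (dec (cleft e) : T).2.1.2.2 (dec (cleft e) : T).2.2).
  by rewrite /check_body /check_zeros; pr_auto.
exact: eq_pr.
Qed.

(** * Certificates as inequalities between elements of a real field *)

Section NumValue.
Variable R : realFieldType.
Local Open Scope ring_scope.

Definition numv (x : fnum) : R := (x.1.1%:R - x.1.2%:R) / x.2%:R.
Definition num_ok (x : fnum) : bool := (0 < x.2)%N.

Lemma num_ok_neq0 x : num_ok x -> x.2%:R != 0 :> R.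
Proof. by rewrite /num_ok pnatr_eq0 lt0n. Qed.

Lemma num_ok_gt0 x : num_ok x -> 0 < x.2%:R :> R.
Proof. by rewrite /num_ok ltr0n. Qed.

Lemma numvN x : numv (nopp x) = - numv x.
Proof. by rewrite /numv /= -mulNr opprB. Qed.

Section Operations.
Variables x y : fnum.
Hypotheses (okx : num_ok x) (oky : num_ok y).

Lemma num_ok_add : num_ok (nadd x y).
Proof. by move: okx oky; rewrite /num_ok /= muln_gt0 => -> ->. Qed.

Lemma num_ok_mul : num_ok (nmul x y).
Proof. exact: num_ok_add. Qed.

Lemma numvD : numv (nadd x y) = numv x + numv y.
Proof.
have hx := num_ok_neq0 okx; have hy := num_ok_neq0 oky.
by rewrite /numv /= !natrD !natrM; field; apply/andP.
Qed.

Lemma numvM : numv (nmul x y) = numv x * numv y.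
Proof.
have hx := num_ok_neq0 okx; have hy := num_ok_neq0 oky.
by rewrite /numv /= !natrD !natrM; field; apply/andP.
Qed.

Lemma nleE : nle x y = (numv x <= numv y).
Proof.
have hx := num_ok_gt0 okx; have hy := num_ok_gt0 oky.
rewrite /numv /nle ler_pdivrMr // mulrAC ler_pdivlMr // -(ler_nat R) !natrD !natrM.
by apply/idP/idP; lra.
Qed.
End Operations.

Lemma nltE x y : num_ok x -> num_ok y -> nlt x y = (numv x < numv y).
Proof. by move=> hx hy; rewrite /nlt nleE // ltNge. Qed.

Lemma nabs_leE x y : num_ok x -> num_ok y -> nabs_le x y = (`|numv x| <= numv y).
Proof. by move=> hx hy; rewrite /nabs_le !nleE // numvN ler_norml andbC lerNl. Qed.

Lemma nabs_geE x y : num_ok x -> num_ok y -> nabs_ge x y = (numv y <= `|numv x|).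
Proof. by move=> hx hy; rewrite /nabs_ge !nleE // numvN ler_normr. Qed.

Lemma numv_frac a b : numv (nfrac a b) = a%:R / b%:R.
Proof. by rewrite /numv subr0. Qed.

Definition vertex_val (j : nat) (v : bool * nat) : R := numv (vertex_num j v).

Lemma vertex_ok j v : num_ok (vertex_num j v).
Proof. by case: v => -[] b; rewrite /num_ok /= expn_gt0. Qed.

Definition coef_val (c : bool * (nat * nat)) : R := numv (num_of_coef c).
Definition coefs_val (P : coefs2) : seq (seq R) := map (map coef_val) P.
Definition coefs_ok (P : coefs2) : bool :=
  all (all (fun c : bool * (nat * nat) => (0 < c.2.2)%N)) P.

Lemma num_of_coef_ok c : (0 < c.2.2)%N -> num_ok (num_of_coef c).
Proof. by case: c => -[] [a d]. Qed.

Definition polyv (x y : R) (P : seq (seq R)) : R * (R * R) := dual2 0 +%R *%R x y P.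

Lemma dual2_val x y P : num_ok x -> num_ok y -> coefs_ok P ->
  let d := dual2_coefs x y P in let r := polyv (numv x) (numv y) (coefs_val P) in
  [/\ num_ok d.1, num_ok d.2.1 & num_ok d.2.2] /\
  [/\ numv d.1 = r.1, numv d.2.1 = r.2.1 & numv d.2.2 = r.2.2].
Proof.
move=> hx hy.
have d1 p : all (fun c : bool * (nat * nat) => (0 < c.2.2)%N) p ->
  let d := dual1 nzero nadd nmul x (map num_of_coef p) in
  let r := dual1 0 +%R *%R (numv x) (map coef_val p) in
  [/\ num_ok d.1, num_ok d.2, numv d.1 = r.1 & numv d.2 = r.2].
  elim: p => [_|c p IH /= /andP[/num_of_coef_ok hc /IH]] /=.
    by rewrite /numv /= subr0 mul0r.
  case=> o1 o2 v1 v2; split; rewrite ?(num_ok_add, num_ok_mul) //.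
    by rewrite numvD ?num_ok_mul // numvM // v1.
  by rewrite numvD ?num_ok_mul // numvM // v1 v2.
elim: P => [_|p P IH /= /andP[/d1 h1 /IH]].
  by split; split => //=; rewrite /numv /= subr0 mul0r.
rewrite /dual2_coefs /polyv /=.
case: h1 => o1 o2 v1 v2 [ [ o3 o4 o5] [v3 v4 v5] ].
split; split; rewrite ?(num_ok_add, num_ok_mul) //.
- by rewrite numvD ?num_ok_mul // numvM // v1 v3.
- by rewrite numvD ?num_ok_mul // numvM // v2 v4.
- by rewrite numvD ?num_ok_mul // numvM // v3 v5.
Qed.

Definition apart (s : R) (q r : R * R) : Prop :=
  [\/ q.1 + s < r.1, r.1 + s < q.1, q.2 + s < r.2 | r.2 + s < q.2].
Definition inner_square (s t : R) (q g : R * R) : bool :=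
  [&& q.1 + t < g.1, g.1 + t < q.1 + s, q.2 + t < g.2 & g.2 + t < q.2 + s].
Definition near_square (s t : R) (q g : R * R) : bool :=
  [&& q.1 <= g.1 + t, g.1 <= q.1 + s + t, q.2 <= g.2 + t & g.2 <= q.2 + s + t].
Definition gridv (m a b : nat) : R * R :=
  ((a%:R - m%:R) / m%:R, (b%:R - m%:R) / m%:R).

(* The squares have side 1/n, the grid has mesh 1/m, and P, Q approximate the
   components of f up to 1/(32 e^2). *)
Record certified (n m e : nat) (P Q : seq (seq R)) (qs : seq (R * R)) : Prop :=
 Certified {
  certified_inside : forall q, q \in qs ->
    [/\ -1 <= q.1, q.1 + n%:R^-1 <= 1, -1 <= q.2 & q.2 + n%:R^-1 <= 1];
  certified_apart : forall i k, (i < size qs)%N -> (k < size qs)%N -> i <> k ->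
    apart n%:R^-1 (nth (0, 0) qs i) (nth (0, 0) qs k);
  certified_center : forall q, q \in qs ->
    let c := (q.1 + (2 * n)%N%:R^-1, q.2 + (2 * n)%N%:R^-1) in
    `|(polyv c.1 c.2 P).1| <= (2 * e)%N%:R^-1 /\
    `|(polyv c.1 c.2 Q).1| <= (2 * e)%N%:R^-1;
  certified_far : forall a b, (a <= 2 * m)%N -> (b <= 2 * m)%N ->
    let g := gridv m a b in
    [\/ exists2 q, q \in qs & inner_square n%:R^-1 m%:R^-1 q g,
        3 / e%:R <= `|(polyv g.1 g.2 P).1| | 3 / e%:R <= `|(polyv g.1 g.2 Q).1|];
  certified_unique : forall q a b a' b', q \in qs ->
    (a <= 2 * m)%N -> (b <= 2 * m)%N -> (a' <= 2 * m)%N -> (b' <= 2 * m)%N ->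
    let g := gridv m a b in let g' := gridv m a' b' in
    near_square n%:R^-1 m%:R^-1 q g -> near_square n%:R^-1 m%:R^-1 q g' ->
    let d := (polyv g.1 g.2 P).2 in let d' := (polyv g'.1 g'.2 Q).2 in
    [/\ `|d.1| <= e%:R, `|d.2| <= e%:R, `|d'.1| <= e%:R, `|d'.2| <= e%:R &
        e%:R^-1 <= `|d.1 * d'.2 - d.2 * d'.1|] }.

Definition squares_val (j : nat) (C : seq vertex) : seq (R * R) :=
  [seq (vertex_val j v.1, vertex_val j v.2) | v <- C].

Lemma checkP n m e j P Q C : (0 < n)%N -> (0 < m)%N -> (0 < e)%N ->
  coefs_ok P -> coefs_ok Q ->
  (check_squares j n C && check_zeros j n m e P Q C) <->
  certified n m e (coefs_val P) (coefs_val Q) (squares_val j C).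
Proof.
move=> n0 m0 e0 hP hQ.
have on : num_ok (nfrac 1 n) by []. have om : num_ok (nfrac 1 m) by [].
have o2n : num_ok (nfrac 1 (2 * n)) by rewrite /num_ok /= muln_gt0.
have o2e : num_ok (nfrac 1 (2 * e)) by rewrite /num_ok /= muln_gt0.
have og a : num_ok (grid m a) by [].
have insE v : inside1 n (vertex_num j v) =
    (-1 <= vertex_val j v) && (vertex_val j v + n%:R^-1 <= 1).
  rewrite /inside1 !nleE ?num_ok_add ?vertex_ok // numvD ?vertex_ok // !numv_frac.
  by rewrite /numv /= sub0r !divr1 mul1r.
have apE u v : apart1 n (vertex_num j u) (vertex_num j v) =
    (vertex_val j u + n%:R^-1 < vertex_val j v) ||
    (vertex_val j v + n%:R^-1 < vertex_val j u).
  by rewrite /apart1 !nltE ?num_ok_add ?vertex_ok // !numvD ?vertex_ok //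
    !numv_frac mul1r.
have innE v a b : inner1 n m (vertex_num j v.1) (grid m a) &&
      inner1 n m (vertex_num j v.2) (grid m b) =
    inner_square n%:R^-1 m%:R^-1 (vertex_val j v.1, vertex_val j v.2) (gridv m a b).
  rewrite /inner1 !nltE ?num_ok_add ?vertex_ok // !numvD ?vertex_ok //.
  by rewrite !numv_frac !mul1r /inner_square !andbA.
have neaE v a b : near1 n m (vertex_num j v.1) (grid m a) &&
      near1 n m (vertex_num j v.2) (grid m b) =
    near_square n%:R^-1 m%:R^-1 (vertex_val j v.1, vertex_val j v.2) (gridv m a b).
  rewrite /near1 !nleE ?num_ok_add ?vertex_ok // !numvD ?num_ok_add ?vertex_ok //.
  by rewrite !numv_frac !mul1r /near_square !andbA.
have cenE v S : coefs_ok S -> check_center j n e S v =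
   (`|(polyv (vertex_val j v.1 + (2 * n)%N%:R^-1) (vertex_val j v.2 + (2 * n)%N%:R^-1)
      (coefs_val S)).1| <= (2 * e)%N%:R^-1).
  move=> hS; rewrite /check_center.
  have [||| [ o1 _ _]] := @dual2_val (nadd (vertex_num j v.1) (nfrac 1 (2 * n)))
    (nadd (vertex_num j v.2) (nfrac 1 (2 * n))) S; rewrite ?num_ok_add ?vertex_ok //.
  rewrite !numvD ?vertex_ok // => -[v1 _ _].
  by rewrite nabs_leE // v1 !numv_frac !mul1r.
have farE a b : check_far j n m e P Q C a b =
   [|| has (fun v => inner_square n%:R^-1 m%:R^-1 (vertex_val j v.1, vertex_val j v.2)
      (gridv m a b)) C,
     3 / e%:R <= `|(polyv (gridv m a b).1 (gridv m a b).2 (coefs_val P)).1| |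
     3 / e%:R <= `|(polyv (gridv m a b).1 (gridv m a b).2 (coefs_val Q)).1|].
  rewrite /check_far.
  have [ [ o1 _ _] [v1 _ _]] := dual2_val (og a) (og b) hP.
  have [ [ o1' _ _] [v1' _ _]] := dual2_val (og a) (og b) hQ.
  rewrite !nabs_geE // v1 v1' !numv_frac -orbA.
  by congr (_ || _); apply: eq_has => v; rewrite innE.
have uniE v a b a' b' : check_unique j n m e P Q v a b a' b' =
   let g := gridv m a b in let g' := gridv m a' b' in
   let q := (vertex_val j v.1, vertex_val j v.2) in
    near_square n%:R^-1 m%:R^-1 q g ==> (near_square n%:R^-1 m%:R^-1 q g' ==>
    let d := (polyv g.1 g.2 (coefs_val P)).2 in
    let d' := (polyv g'.1 g'.2 (coefs_val Q)).2 in
    [&& `|d.1| <= e%:R, `|d.2| <= e%:R, `|d'.1| <= e%:R, `|d'.2| <= e%:R &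
        e%:R^-1 <= `|d.1 * d'.2 - d.2 * d'.1|]).
  rewrite /check_unique /= -!neaE !implybE -orbA; congr (_ || (_ || _)).
  have [ [_ o1 o2] [_ v1 v2]] := dual2_val (og a) (og b) hP.
  have [ [_ o1' o2'] [_ v1' v2']] := dual2_val (og a') (og b') hQ.
  have oe : num_ok (nfrac e 1) by [].
  have okN x : num_ok (nopp x) = num_ok x by [].
  rewrite /check_det !nabs_leE // nabs_geE ?num_ok_add ?okN ?num_ok_mul //.
  rewrite numvD ?okN ?num_ok_mul // numvN !numvM // v1 v2 v1' v2' !numv_frac.
  by rewrite divr1 mul1r !andbA.
have leqio a : (a \in iota 0 (2 * m + 1)) = (a <= 2 * m)%N.
  by rewrite mem_iota add0n addn1 ltnS.
have szq : size (squares_val j C) = size C by rewrite size_map.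
have nthq i : (i < size C)%N -> nth (0, 0) (squares_val j C) i =
   let v := nth (false, 0, (false, 0))%N C i in
   (vertex_val j v.1, vertex_val j v.2).
  by move=> ?; rewrite (nth_map (false, 0, (false, 0))%N).
split.
- case/andP=> /andP[/allP h1 /allP h2] /andP[/andP[/allP h3 /allP h4] /allP h5].
  split.
  + move=> _ /mapP[v vC ->]; have := h1 _ vC.
    by rewrite !insE => /andP[/andP[? ?] /andP[? ?]].
  + rewrite szq => i k iC kC ik; rewrite !nthq //.
    have := h2 i; rewrite mem_iota => /(_ iC) /allP /(_ k).
    rewrite mem_iota => /(_ kC); rewrite !apE /= -orbA.
    case/or3P; [by move=> /eqP|..]; case/orP => ?; rewrite /apart /=.
    * exact: Or41.
    * exact: Or42.
    * exact: Or43.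
    * exact: Or44.
  + move=> _ /mapP[v vC ->]; have := h3 _ vC.
    by rewrite !cenE // => /andP.
  + move=> a b; rewrite -!leqio => /h4/allP h /h; rewrite farE.
    case/or3P; [|exact: Or32|exact: Or33].
    move=> /hasP[v vC iv]; apply: Or31.
    by exists (vertex_val j v.1, vertex_val j v.2) => //; apply/mapP; exists v.
  + move=> _ a b a' b' /mapP[v vC ->]; rewrite -!leqio => ha hb ha' hb' g g' hg hg'.
    have := allP (allP (allP (allP (h5 _ vC) _ ha) _ hb) _ ha') _ hb'.
    by rewrite uniE /= => /implyP/(_ hg)/implyP/(_ hg')/and5P.
- case=> h1 h2 h3 h4 h5.
  have mq v : v \in C -> (vertex_val j v.1, vertex_val j v.2) \in squares_val j C.
    by move=> vC; apply/mapP; exists v.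
  apply/andP; split; [apply/andP; split|apply/andP; split; [apply/andP; split|]].
  + by apply/allP => v /mq/h1[*]; rewrite !insE; do ![apply/andP; split].
  + apply/allP => i; rewrite mem_iota => /= iC; apply/allP => k.
    rewrite mem_iota => /= kC; rewrite add0n in iC kC; have [//|ik] := eqVneq i k.
    have := h2 i k; rewrite szq => /(_ iC kC (elimN eqP ik)); rewrite !nthq // !apE /=.
    by case=> /= ->; rewrite ?orbT.
  + by apply/allP => v /mq/h3[h h']; rewrite !cenE // h h'.
  + apply/allP => a; rewrite leqio => ha; apply/allP => b; rewrite leqio => hb.
    rewrite farE; case: (h4 a b ha hb) => [ [q /mapP[v vC ->] iv]|->|->]; rewrite ?orbT //.
    by apply/orP; left; apply/hasP; exists v.
  + apply/allP => v /mq vC; apply/allP => a; rewrite leqio => ha.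
    apply/allP => b; rewrite leqio => hb; apply/allP => a'; rewrite leqio => ha'.
    apply/allP => b'; rewrite leqio => hb'; rewrite uniE.
    apply/implyP => hg; apply/implyP => hg'.
    by apply/and5P; apply: (h5 _ a b a' b' vC ha hb ha' hb').
Qed.
End NumValue.

Local Open Scope classical_set_scope.
Local Open Scope ring_scope.

(** * Differential calculus in the plane *)

Section Plane.
Variable R : realType.
Notation pt := 'rV[R]_2.
Implicit Types (x y v : pt) (F G : pt -> R) (f g : pt -> pt).

Definition mkpt (a b : R) : pt := \row_i (if i == 0 then a else b).
Definition unitv (i : 'I_2) : pt := delta_mx 0 i.
Definition pd (i : 'I_2) (W : normedModType R) (F : pt -> W) x : W := 'd F x (unitv i).

Lemma mkpt0 a b : mkpt a b 0 0 = a. Proof. by rewrite mxE. Qed.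
Lemma mkpt1 a b : mkpt a b 0 1 = b. Proof. by rewrite mxE. Qed.

Lemma ord2P (i : 'I_2) : i = 0 \/ i = 1.
Proof. by case: i => -[|[|//]] i; [left|right]; apply: val_inj. Qed.

Lemma ptP x y : x 0 0 = y 0 0 -> x 0 1 = y 0 1 -> x = y.
Proof. by move=> h0 h1; apply/rowP => i; case: (ord2P i) => ->. Qed.

Lemma pt_norm_le x c : `|x| <= c <-> `|x 0 0| <= c /\ `|x 0 1| <= c.
Proof.
rewrite [`|x|]/Num.Def.normr /= mx_normrE; split=> [h|[h0 h1]].
  by split; apply: le_trans h; apply/bigmax_geP; right;
    [exists (0, 0)|exists (0, 1)].
apply: bigmax_le => [|[i j] _ /=]; first exact: le_trans (normr_ge0 _) h0.
by rewrite (ord1 i); case: (ord2P j) => ->.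
Qed.

Lemma coord_norm_le x i : `|x 0 i| <= `|x|.
Proof. by have /pt_norm_le[h0 h1] := lexx `|x|; case: (ord2P i) => ->. Qed.

Lemma K2E x : K2 R x <-> `|x| <= 1.
Proof.
by rewrite /K2 closed_ballE // /closed_ball_ /=; rewrite sub0r normrN.
Qed.

Lemma K2P x : K2 R x <-> `|x 0 0| <= 1 /\ `|x 0 1| <= 1.
Proof. by rewrite K2E pt_norm_le. Qed.

Lemma K2_compact : compact (K2 R).
Proof.
apply: bounded_closed_compact; last exact: closed_ball_closed.
by exists 1; split=> // M M1 x /K2E x1; exact: le_trans x1 (ltW M1).
Qed.

Lemma K2_nonempty : K2 R !=set0.
Proof. by exists 0; apply/K2E; rewrite normr0. Qed.

Lemma pt_basis v : v = v 0 0 *: unitv 0 + v 0 1 *: unitv 1.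
Proof. by apply: ptP; rewrite !mxE /= ?mulr1 ?mulr0 ?addr0 ?add0r. Qed.

Lemma diff_pd (W : normedModType R) (F : pt -> W) x v :
  'd F x v = v 0 0 *: pd 0 F x + v 0 1 *: pd 1 F x.
Proof. by rewrite {1}[v]pt_basis linearD !linearZ. Qed.

Lemma unitv_norm i : `|unitv i| <= 1.
Proof.
by apply/pt_norm_le; rewrite !mxE /=; case: (ord2P i) => -> /=;
  rewrite normr0 normr1.
Qed.

Section Norm.
Variables (W : normedModType R) (F : pt -> W).

Lemma diff_norm_le x v : `|v| <= 1 -> `|'d F x v| <= `|pd 0 F x| + `|pd 1 F x|.
Proof.
move=> v1; rewrite diff_pd; apply: le_trans (ler_normD _ _) _; rewrite !normrZ.
by rewrite lerD // ler_piMl // (le_trans (coord_norm_le _ _) v1).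
Qed.

Let opnorm_nonempty x : [set `|'d F x v| | v in [set v | `|v| <= 1]] !=set0.
Proof. by exists `|'d F x 0|; exists 0 => //=; rewrite normr0. Qed.

Lemma opnorm_le x : opnorm ('d F x) <= `|pd 0 F x| + `|pd 1 F x|.
Proof. by apply: ge_sup => // _ [v /= v1 <-]; exact: diff_norm_le. Qed.

Lemma opnorm_ge x i : `|pd i F x| <= opnorm ('d F x).
Proof.
apply: sup_upper_bound; last by exists (unitv i) => //; exact: unitv_norm.
split=> //; exists (`|pd 0 F x| + `|pd 1 F x|) => _ [v /= v1 <-].
exact: diff_norm_le.
Qed.

(** [sup] takes a default value on unbounded sets; pointwise bounds can be drawn from [C1norm] only
    after the suprema are known to be finite. *)
Definition C1_bounded : Prop :=
  exists M : R, forall x, K2 R x ->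
    [/\ `|F x| <= M, `|pd 0 F x| <= M & `|pd 1 F x| <= M].

Lemma C1norm_le (a b : R) :
  (forall x, K2 R x -> `|F x| <= a) ->
  (forall x, K2 R x -> `|pd 0 F x| + `|pd 1 F x| <= b) ->
  C1norm (K2 R) F <= a + b.
Proof.
move=> ha hb; have [x0 x0K] := K2_nonempty.
apply: lerD; apply: ge_sup.
- by exists `|F x0|; exists x0.
- by move=> _ [x xK <-]; exact: ha.
- by exists (opnorm ('d F x0)); exists x0.
- by move=> _ [x xK <-]; exact: le_trans (opnorm_le x) (hb _ xK).
Qed.

Lemma C1norm_ge x : C1_bounded -> K2 R x ->
  `|F x| <= C1norm (K2 R) F /\ forall i, `|pd i F x| <= C1norm (K2 R) F.
Proof.
move=> [M hM] xK.
have h1 : `|F x| <= sup [set `|F x| | x in K2 R].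
  apply: sup_upper_bound; last by exists x.
  split; first by exists `|F x|; exists x.
  by exists M => _ [y yK <-]; case: (hM _ yK).
have h2 : opnorm ('d F x) <= sup [set opnorm ('d F x) | x in K2 R].
  apply: sup_upper_bound; last by exists x.
  split; first by exists (opnorm ('d F x)); exists x.
  exists (M + M) => _ [y yK <-]; case: (hM _ yK) => _ ? ?.
  by apply: le_trans (opnorm_le y) _; exact: lerD.
split.
  apply: le_trans h1 _; rewrite /C1norm lerDl.
  by apply: le_trans h2; apply: le_trans (opnorm_ge x 0).
move=> i; apply: le_trans (opnorm_ge x i) _; apply: le_trans h2 _.
by rewrite /C1norm lerDr; apply: le_trans h1.
Qed.
End Norm.

Lemma C1_bounded_uniform (F : 'I_2 -> pt -> R) : (forall i, C1_bounded (F i)) ->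
  exists2 M, 0 <= M & forall i x, K2 R x ->
    `|F i x| <= M /\ forall l, `|pd l (F i) x| <= M.
Proof.
move=> bF; have [M0 h0] := bF 0; have [M1 h1] := bF 1.
exists (`|M0| + `|M1|); first by rewrite addr_ge0.
have w0 : M0 <= `|M0| + `|M1| by apply: le_trans (ler_norm _) _; rewrite lerDl.
have w1 : M1 <= `|M0| + `|M1| by apply: le_trans (ler_norm _) _; rewrite lerDr.
move=> i x xK; set M := _ + _ in w0 w1 *.
have [a b c] : [/\ `|F i x| <= M, `|pd 0 (F i) x| <= M & `|pd 1 (F i) x| <= M].
  by case: (ord2P i) => ->; [have [a b c] := h0 _ xK|have [a b c] := h1 _ xK];
    split; [exact: (le_trans a)|exact: (le_trans b)|exact: (le_trans c)|
            exact: (le_trans a)|exact: (le_trans b)|exact: (le_trans c)].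
by split=> // l; case: (ord2P l) => ->.
Qed.

Definition C1_close (d : R) F G : Prop := forall x, K2 R x ->
  `|F x - G x| <= d /\ forall l, `|pd l F x - pd l G x| <= d.

Definition is_grad F x (a b : R) : Prop :=
  [/\ differentiable F x, pd 0 F x = a & pd 1 F x = b].

Lemma is_grad_cst c x : is_grad (cst c) x 0 0.
Proof.
split; [exact: differentiable_cst|by rewrite /pd diff_cst|by rewrite /pd diff_cst].
Qed.

Lemma diff_coord i x v : 'd (fun y : pt => y 0 i : R) x v = v 0 i.
Proof.
have @f : {linear pt -> R}.
  by exists (fun N : pt => N 0 i); do 2![eexists]; do ?[constructor];
     rewrite ?mxE// => ? *; rewrite ?mxE//; move=> ?; rewrite !mxE.
have -> : (fun y : pt => y 0 i : R) = f by [].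
by rewrite diff_lin //; exact: coord_continuous.
Qed.

Lemma is_grad_coord0 x : is_grad (fun y => y 0 0) x 1 0.
Proof.
by split; [exact: differentiable_coord|rewrite /pd diff_coord mxE..].
Qed.

Lemma is_grad_coord1 x : is_grad (fun y => y 0 1) x 0 1.
Proof.
by split; [exact: differentiable_coord|rewrite /pd diff_coord mxE..].
Qed.

Lemma is_gradD F G x a b c d : is_grad F x a b -> is_grad G x c d ->
  is_grad (fun y => F y + G y) x (a + c) (b + d).
Proof.
move=> [dF <- <-] [dG <- <-].
by split; [exact: differentiableD|rewrite /pd diffD..].
Qed.

Lemma is_gradN F x a b : is_grad F x a b -> is_grad (fun y => - F y) x (- a) (- b).
Proof.
move=> [dF <- <-].
by split; [exact: differentiableN|rewrite /pd diffN..].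
Qed.

Lemma is_gradB F G x a b c d : is_grad F x a b -> is_grad G x c d ->
  is_grad (fun y => F y - G y) x (a - c) (b - d).
Proof. by move=> hF /is_gradN hG; exact: is_gradD. Qed.

Lemma is_gradM F G x a b c d : is_grad F x a b -> is_grad G x c d ->
  is_grad (fun y => F y * G y) x (F x * c + G x * a) (F x * d + G x * b).
Proof.
move=> [dF <- <-] [dG <- <-].
by split; [exact: differentiableM|rewrite /pd diffM..].
Qed.

Lemma is_grad_comp f x i : differentiable f x ->
  is_grad (fun y => f y 0 i) x (pd 0 f x 0 i) (pd 1 f x 0 i).
Proof.
move=> df; have dc := differentiable_coord (f x) 0 i.
split; first exact: (differentiable_comp df dc).
  rewrite /pd -[(fun y => f y 0 i)]/((fun N : pt => N 0 i) \o f) diff_comp //=.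
  by rewrite diff_coord.
rewrite /pd -[(fun y => f y 0 i)]/((fun N : pt => N 0 i) \o f) diff_comp //=.
by rewrite diff_coord.
Qed.

Lemma is_derive_line F (x v : pt) t : differentiable F (x + t *: v) ->
  is_derive t 1 (fun s : R => F (x + s *: v))
   (v 0 0 * pd 0 F (x + t *: v) + v 0 1 * pd 1 F (x + t *: v)).
Proof.
move=> dF.
have dl : is_diff t (fun s : R => x + s *: v) (fun s => s *: v).
  have -> : (fun s : R => s *: v) = (0 : R -> pt) + ( *:%R^~ v).
    by rewrite add0r.
  have := @is_diffD _ _ _ (cst x : R -> pt) _ _ _ t (is_diff_cst x t) (is_diff_scalel t v).
  exact.
have dc := is_diff_comp dl (differentiableP dF).
have e : is_derive t 1 (F \o (fun s : R => x + s *: v))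
    ('d F (x + t *: v) (1 *: v)).
  apply: DeriveDef; first by apply/derivable1_diffP; case: dc.
  by rewrite deriveE; [case: dc => ? ->|case: dc].
by move: e; rewrite scale1r diff_pd.
Qed.

(** The intermediate point depends on [F]. For the two components of a planar map it gives two
    different points, hence the determinants with rows taken at different points. *)
Lemma MVT_plane F x y :
  (forall t : R, 0 <= t <= 1 -> differentiable F (y + t *: (x - y))) ->
  exists2 t, 0 <= t <= 1 & F x - F y =
    (x - y) 0 0 * pd 0 F (y + t *: (x - y)) +
    (x - y) 0 1 * pd 1 F (y + t *: (x - y)).
Proof.
move=> dF; set v := x - y.
have der (t : R) : 0 <= t <= 1 -> is_derive t 1 (fun s : R => F (y + s *: v))
   (v 0 0 * pd 0 F (y + t *: v) + v 0 1 * pd 1 F (y + t *: v)).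
  by move=> /dF; exact: is_derive_line.
have [||c c01 e] := @MVT_segment R (fun s => F (y + s *: v))
    (fun t => v 0 0 * pd 0 F (y + t *: v) + v 0 1 * pd 1 F (y + t *: v)) 0 1 ler01.
- by move=> t; rewrite in_itv /= => /andP[t0 t1]; apply: der; rewrite !ltW.
- apply: derivable_within_continuous => t; rewrite in_itv /= => /der.
  by case.
exists c; first by move: c01; rewrite in_itv.
by move: e; rewrite scale1r scale0r addr0 subr0 mulr1 /v subrKC.
Qed.
End Plane.

(** * Polynomials as functions on the square *)

Section PolyFun.
Variable R : realType.
Notation pt := 'rV[R]_2.

Definition polyf (P : seq (seq R)) (x : pt) : R := (polyv (x 0 0) (x 0 1) P).1.

Lemma polyf_grad P x :
  is_grad (polyf P) x (polyv (x 0 0) (x 0 1) P).2.1 (polyv (x 0 0) (x 0 1) P).2.2.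
Proof.
have h1 p : is_grad (fun y : pt => (dual1 0 +%R *%R (y 0 0) p).1) x
    (dual1 0 +%R *%R (x 0 0) p).2 0.
  elim: p => [|c p IH]; first exact: is_grad_cst.
  have := is_gradD (is_grad_cst c x) (is_gradM (is_grad_coord0 x) IH).
  by rewrite !add0r !mulr0 !mulr1 addr0 addrC.
elim: P => [|p P IH]; first exact: is_grad_cst.
have := is_gradD (h1 p) (is_gradM (is_grad_coord1 x) IH).
by rewrite /polyf /polyv /= !add0r !mulr0 !mulr1 addr0 [X in is_grad _ _ _ X]addrC.
Qed.

Definition rbound1 (p : seq R) : R := foldr (fun c b => `|c| + 3 * b) 0 p.
Definition rbound2 (P : seq (seq R)) : R := foldr (fun p b => rbound1 p + 3 * b) 0 P.

Section Nice.
Variable d : R.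
Hypothesis d0 : 0 <= d.
(** [a] and [b] are the values of one function at two points at distance at most [d]; a single [N]
    bounds both the values and the Lipschitz constant, which keeps the Horner recursion to one
    number. *)
Definition close (N a b : R) := [/\ `|a| <= N, `|b| <= N & `|a - b| <= N * d].

Lemma close_add N M a b a' b' :
  close N a b -> close M a' b' -> close (N + M) (a + a') (b + b').
Proof.
move=> [h1 h2 h3] [h1' h2' h3']; split.
- exact: le_trans (ler_normD _ _) (lerD h1 h1').
- exact: le_trans (ler_normD _ _) (lerD h2 h2').
- rewrite (_ : _ - _ = (a - b) + (a' - b')); last by ring.
  by rewrite mulrDl; exact: le_trans (ler_normD _ _) (lerD h3 h3').
Qed.

Lemma close_mul N x y a b : `|x| <= 1 -> `|y| <= 1 -> `|x - y| <= d ->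
  close N a b -> close (2 * N) (x * a) (y * b).
Proof.
move=> x1 y1 xy [h1 h2 h3].
have N0 : 0 <= N by exact: le_trans h1.
have N2 : N <= 2 * N by lra.
split.
- by rewrite normrM (le_trans _ N2) // (le_trans _ h1) // ler_piMl.
- by rewrite normrM (le_trans _ N2) // (le_trans _ h2) // ler_piMl.
- rewrite (_ : _ - _ = x * (a - b) + (x - y) * b); last by ring.
  apply: le_trans (ler_normD _ _) _; rewrite !normrM -mulrA mulr2n mulrDl mul1r.
  apply: lerD; first by apply: le_trans h3; rewrite ler_piMl.
  by rewrite mulrC; apply: ler_pM.
Qed.

Lemma close_le N M a b : N <= M -> close N a b -> close M a b.
Proof.
move=> NM [h1 h2 h3]; split; [exact: le_trans h1 NM|exact: le_trans h2 NM|].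
by apply: le_trans h3 _; apply: ler_wpM2r.
Qed.

Lemma close_const c : close `|c| c c.
Proof. by split; rewrite ?subrr ?normr0 ?mulr_ge0. Qed.

Lemma close_ge0 N a b : close N a b -> 0 <= N.
Proof. by case=> h _ _; exact: le_trans h. Qed.

Lemma polyv_close x0 x1 y0 y1 P : `|x0| <= 1 -> `|x1| <= 1 -> `|y0| <= 1 ->
  `|y1| <= 1 -> `|x0 - y0| <= d -> `|x1 - y1| <= d ->
  let r := polyv x0 x1 P in let s := polyv y0 y1 P in let N := rbound2 P in
  [/\ close N r.1 s.1, close N r.2.1 s.2.1 & close N r.2.2 s.2.2].
Proof.
move=> hx0 hx1 hy0 hy1 h0 h1.
have close0 : close 0 0 0 by have := close_const 0; rewrite normr0.
have d1 p : close (rbound1 p) (dual1 0 +%R *%R x0 p).1 (dual1 0 +%R *%R y0 p).1 /\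
    close (rbound1 p) (dual1 0 +%R *%R x0 p).2 (dual1 0 +%R *%R y0 p).2.
  elim: p => [//|c p [IH1 IH2]]; have N0 := close_ge0 IH1; split => /=.
    apply: close_le (close_add (close_const c) (close_mul hx0 hy0 h0 IH1)).
    by rewrite /= -/(rbound1 p); lra.
  apply: close_le (close_add IH1 (close_mul hx0 hy0 h0 IH2)).
  by rewrite /= -/(rbound1 p); have := normr_ge0 c; lra.
elim: P => [//|p P /= [IH1 IH2 IH3]].
have [n1 n2] := d1 p; have N0 := close_ge0 IH1; have n0 := close_ge0 n1.
rewrite /polyv /=; split.
- apply: close_le (close_add n1 (close_mul hx1 hy1 h1 IH1)).
  by rewrite -/(rbound2 P); lra.
- apply: close_le (close_add n2 (close_mul hx1 hy1 h1 IH2)).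
  by rewrite -/(rbound2 P); lra.
- apply: close_le (close_add IH1 (close_mul hx1 hy1 h1 IH3)).
  by rewrite -/(rbound2 P); lra.
Qed.
End Nice.

Lemma rbound2_ge0 P : 0 <= rbound2 P.
Proof.
have h p : 0 <= rbound1 p.
  by elim: p => //= c p IH; rewrite addr_ge0 // mulr_ge0.
by elim: P => //= p P IH; rewrite addr_ge0 // mulr_ge0.
Qed.

Lemma polyf_bounded P : C1_bounded (polyf P).
Proof.
exists (rbound2 P) => x /K2P [x0 x1].
have [_ -> ->] := polyf_grad P x.
have d0 (a : R) : `|a - a| <= 0 by rewrite subrr normr0.
by have [ [? _ _] [? _ _] [? _ _] ] := polyv_close (lexx 0) P x0 x1 x0 x1 (d0 _) (d0 _).
Qed.

Lemma coef_val_le c : (0 < c.2.2)%N -> `|coef_val R c| <= c.2.1%:R.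
Proof.
case: c => s [a d] /= d0.
have d1 : 1 <= d%:R :> R by rewrite ler1n.
have -> : `|coef_val R (s, (a, d))| = a%:R / d%:R.
  rewrite /coef_val /numv; case: s => /=.
    by rewrite sub0r mulNr normrN ger0_norm // divr_ge0.
  by rewrite subr0 ger0_norm // divr_ge0.
by rewrite ler_pdivrMr ?(lt_le_trans _ d1) // ler_peMr.
Qed.

Lemma rbound2_coefs P : coefs_ok P -> rbound2 (coefs_val R P) <= (bound2 P)%:R.
Proof.
have h1 p : all (fun c : bool * (nat * nat) => (0 < c.2.2)%N) p ->
    rbound1 (map (coef_val R) p) <= (bound1 p)%:R.
  elim: p => //= c p IH /andP[/coef_val_le hc /IH {}IH].
  by rewrite natrD natrM lerD // ler_wpM2l.
elim: P => //= p P IH /andP[/h1 hp /IH {}IH].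
by rewrite natrD natrM lerD // ler_wpM2l.
Qed.

Lemma coef_val_rat q : coef_val R (coef_of_rat q) = ratr q.
Proof.
have -> : ratr q = (numq q)%:~R / (denq q)%:~R :> R by [].
have -> : (denq q)%:~R = (`|denq q|%N)%:R :> R.
  by rewrite natr_absz ger0_norm // denq_ge0.
rewrite /coef_val /coef_of_rat /num_of_coef /numv /= -numq_lt0.
case: ltrP => q0 /=.
  by rewrite sub0r natr_absz ltr0_norm // mulrNz opprK.
by rewrite subr0 natr_absz ger0_norm.
Qed.

Lemma coefs_ok_poly P : coefs_ok (coefs_of_poly P).
Proof.
rewrite /coefs_ok /coefs_of_poly all_map; apply/allP => p _ /=.
by rewrite all_map; apply/allP => q _ /=; rewrite absz_gt0 denq_neq0.
Qed.

Lemma horner_polyv (P : seq (seq R)) x y :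
  (Poly (map Poly P)).[y%:P].[x] = (polyv x y P).1.
Proof.
rewrite horner_Poly; elim: P => [|p P IH] /=; first by rewrite hornerC.
rewrite hornerD hornerM hornerC IH /polyv /= addrC mulrC; congr (_ + _).
rewrite horner_Poly; elim: p => //= c s ->.
by rewrite addrC mulrC.
Qed.

Lemma pevalE P (x : pt) : peval P x = polyf (coefs_val R (coefs_of_poly P)) x.
Proof.
rewrite /peval map_polyE.
have -> : map (map_poly (ratr : rat -> R)) P =
    map Poly (coefs_val R (coefs_of_poly P)).
  rewrite /coefs_val /coefs_of_poly -!map_comp; apply: eq_map => p /=.
  rewrite map_polyE -map_comp; congr Poly.
  by apply: eq_map => q /=; rewrite coef_val_rat.
exact: horner_polyv.
Qed.
End PolyFun.

(** * Soundness and completeness of certificates *)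

Section Sound.
Variable R : realType.
Notation pt := 'rV[R]_2.

Definition in_square (s : R) (q : R * R) : set pt := fun x =>
  q.1 <= x 0 0 <= q.1 + s /\ q.2 <= x 0 1 <= q.2 + s.

Lemma in_square_compact s q : compact (in_square s q).
Proof.
pose A (i : 'I_2) : set R :=
  if i == 0 then `[q.1, q.1 + s]%classic else `[q.2, q.2 + s]%classic.
have -> : in_square s q = [set x : pt | forall i, A i (x ord0 i)].
  apply/seteqP; split => x; rewrite /A /in_square /=.
    by case=> h0 h1 i; case: (ord2P i) => -> /=; rewrite in_itv.
  by move=> h; have := h 0; have := h 1; rewrite /= !in_itv.
by apply: rV_compact => i; rewrite /A; case: ifP => _; exact: segment_compact.
Qed.

Lemma in_square_convex s q (x y : pt) (t : R) : 0 <= t <= 1 ->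
  in_square s q x -> in_square s q y -> in_square s q (y + t *: (x - y)).
Proof.
move=> /andP[t0 t1] [/andP[? ?] /andP[? ?]] [/andP[? ?] /andP[? ?]].
by split; rewrite !mxE; apply/andP; split; nra.
Qed.

Lemma grid_near (m : nat) (x : R) : (0 < m)%N -> `|x| <= 1 ->
  exists2 a : nat, (a <= 2 * m)%N &
    `|(a%:R - m%:R) / m%:R| <= (1 : R) /\ `|x - (a%:R - m%:R) / m%:R| <= m%:R^-1.
Proof.
move=> m0 /ler_normlP[x1 x2].
have mR : 0 < m%:R :> R by rewrite ltr0n.
set y := (x + 1) * m%:R.
have y0 : 0 <= y by rewrite mulr_ge0 //; lra.
have /andP[ly yl] := Num.Theory.truncn_itv y0.
set a := Num.truncn y in ly yl.
have a2 : (a <= 2 * m)%N.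
  by rewrite -(ler_nat R) natrM; apply: le_trans ly _; rewrite ler_wpM2r //; lra.
have a2R : a%:R <= 2 * m%:R :> R by rewrite -natrM ler_nat.
have aR : 0 <= a%:R :> R by [].
exists a => //; split.
  by rewrite ler_norml ler_pdivrMr // ler_pdivlMr //; apply/andP; split; lra.
have -> : x - (a%:R - m%:R) / m%:R = (y - a%:R) / m%:R.
  by rewrite /y; field; rewrite gt_eqF.
have im0 : 0 <= m%:R^-1 :> R by rewrite invr_ge0 ltW.
rewrite normrM (ger0_norm im0); apply: ler_piMl => //.
by move: yl; rewrite -natr1 ler_norml => yl; apply/andP; split; lra.
Qed.

Lemma near_square_mem (s t : R) q (g : R * R) (z : pt) : in_square s q z ->
  `|z 0 0 - g.1| <= t -> `|z 0 1 - g.2| <= t -> near_square s t q g.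
Proof.
rewrite /near_square => -[/andP[? ?] /andP[? ?]] /ler_normlP[? ?] /ler_normlP[? ?].
by apply/and4P; split; lra.
Qed.

Lemma inner_square_mem (s t : R) q (g : R * R) (z : pt) : inner_square s t q g ->
  `|z 0 0 - g.1| <= t -> `|z 0 1 - g.2| <= t ->
  [/\ q.1 < z 0 0, z 0 0 < q.1 + s, q.2 < z 0 1 & z 0 1 < q.2 + s].
Proof.
move=> /and4P[? ? ? ?] /ler_normlP[? ?] /ler_normlP[? ?]; split; lra.
Qed.

Lemma det_close (E eps p p' q q' r r' s s' : R) : eps <= 1 ->
  `|p - p'| <= eps -> `|q - q'| <= eps -> `|r - r'| <= eps -> `|s - s'| <= eps ->
  `|p'| <= E -> `|q'| <= E -> `|r'| <= E -> `|s'| <= E ->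
  `|(p * s - q * r) - (p' * s' - q' * r')| <= (4 * E + 2) * eps.
Proof.
move=> eps1 hp hq hr hs p1 q1 r1 s1.
have eps0 : 0 <= eps by exact: le_trans hp.
have prod (a b a' b' : R) : `|a - a'| <= eps -> `|b - b'| <= eps ->
    `|a'| <= E -> `|b'| <= E -> `|a * b - a' * b'| <= (2 * E + 1) * eps.
  move=> ha hb ha' hb'.
  have -> : a * b - a' * b' = a' * (b - b') + (a - a') * b' + (a - a') * (b - b') by ring.
  have n1 : `|a' * (b - b')| <= E * eps by rewrite normrM; apply: ler_pM.
  have n2 : `|(a - a') * b'| <= E * eps by rewrite normrM mulrC; apply: ler_pM.
  have n3 : `|(a - a') * (b - b')| <= 1 * eps.
    by rewrite normrM; apply: ler_pM => //; exact: le_trans eps1.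
  apply: le_trans (ler_normD _ _) _; apply: le_trans (lerD (ler_normD _ _) (lexx _)) _.
  lra.
have h1 := prod _ _ _ _ hp hs p1 s1; have h2 := prod _ _ _ _ hq hr q1 r1.
rewrite (_ : _ - _ - _ = (p * s - p' * s') - (q * r - q' * r')); last by ring.
by apply: le_trans (ler_normB _ _) _; lra.
Qed.

Lemma lower_half (D D' c r : R) :
  `|D' - D| <= c -> c <= `|D| / 2 -> r <= `|D| / 2 -> r <= `|D'|.
Proof.
move=> h1 h2 h3; have h4 : `|D| <= `|D'| + `|D' - D|.
  by rewrite -{1}[D](subrKC D') [`|D' - D|]distrC; exact: ler_normD.
lra.
Qed.

(** As [E = 1/u], an error [eps <= u^2/16] in entries of size [E] moves the determinant by at most
    [(4 E + 2) eps <= 3 u/8], which is less than half of its lower bound [u]. *)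
Lemma det_perturb (E u eps p p' q q' r r' s s' : R) :
  0 < u -> u <= 1 -> E * u = 1 -> eps <= u * u / 16 ->
  `|p - p'| <= eps -> `|q - q'| <= eps -> `|r - r'| <= eps -> `|s - s'| <= eps ->
  `|p'| <= E -> `|q'| <= E -> `|r'| <= E -> `|s'| <= E ->
  u <= `|p' * s' - q' * r'| -> p * s - q * r != 0.
Proof.
move=> u0 u1 Eu epsu hp hq hr hs p1 q1 r1 s1 hu.
have E0 : 0 <= E by exact: le_trans p1.
have uu : u * u <= u by rewrite ler_piMl // ltW.
have Ee : E * eps <= u / 16.
  by apply: le_trans (ler_wpM2l E0 epsu) _; rewrite !mulrA Eu mul1r.
have eps1 : eps <= 1 by lra.
have hD := det_close eps1 hp hq hr hs p1 q1 r1 s1.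
rewrite -normr_gt0; apply: (@lt_le_trans _ _ (u / 2)); first by rewrite divr_gt0.
by apply: lower_half hD _ _; lra.
Qed.

Lemma scaled_le (E u d : R) : E * u = 1 -> 32 * (E * E) * d <= 1 -> d <= u * u / 32.
Proof.
move=> Eu h; have -> : d = (32 * (E * E) * d) * (u * u / 32).
  rewrite (_ : _ * (u * u / 32) = (E * u) * (E * u) * d); last by field.
  by rewrite Eu !mul1r.
by apply: ler_piMl => //; rewrite divr_ge0 // -expr2 sqr_ge0.
Qed.

Lemma solve2_eq0 (p q r s v w : R) : p * s - q * r != 0 ->
  v * p + w * q = 0 -> v * r + w * s = 0 -> v = 0 /\ w = 0.
Proof.
move=> D h0 h1; split; apply: (mulIf D); rewrite mul0r.
  have -> : v * (p * s - q * r) = (v * p + w * q) * s - (v * r + w * s) * q by ring.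
  by rewrite h0 h1 !mul0r subrr.
have -> : w * (p * s - q * r) = (v * r + w * s) * p - (v * p + w * q) * r by ring.
by rewrite h0 h1 !mul0r subrr.
Qed.

Lemma double_eq0 (a b : R) : 0 = a + a + (b + b) -> a + b = 0.
Proof. lra. Qed.

Lemma apart_interior (s : R) q r (z : pt) : in_square s q z -> apart s q r ->
  [/\ r.1 < z 0 0, z 0 0 < r.1 + s, r.2 < z 0 1 & z 0 1 < r.2 + s] -> False.
Proof. by move=> [/andP[? ?] /andP[? ?]] [] ? [? ? ? ?]; lra. Qed.

Lemma in_square_interior (s : R) q (z : pt) l : q.1 < z 0 0 -> z 0 0 < q.1 + s ->
  q.2 < z 0 1 -> z 0 1 < q.2 + s ->
  exists2 tau : R, 0 < tau & forall t : R, `|t| < tau ->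
    in_square s q (z + t *: unitv R l).
Proof.
move=> i1 i2 i3 i4; exists (Num.min (Num.min (z 0 0 - q.1) (q.1 + s - z 0 0))
    (Num.min (z 0 1 - q.2) (q.2 + s - z 0 1))).
  by rewrite !lt_min !subr_gt0 i1 i2 i3 i4.
move=> t; rewrite !lt_min => /andP[/andP[k1 k2] /andP[k3 k4]].
have [t1 t2] := ler_normlP _ _ (lexx `|t|).
by rewrite /in_square !mxE; case: (ord2P l) => -> /=;
  rewrite ?mulr0 ?mulr1; split; apply/andP; split; lra.
Qed.

Variables (f : pt -> pt) (P0 P1 : seq (seq R)) (d : R) (n m e : nat) (B : R).
Variable qs : seq (R * R).
Hypotheses (n0 : (0 < n)%N) (m0 : (0 < m)%N) (e0 : (0 < e)%N).
Hypothesis df : forall x, K2 R x -> differentiable f x.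
Notation F0 := (fun x : pt => f x 0 0).
Notation F1 := (fun x : pt => f x 0 1).
Hypotheses (close0 : C1_close d F0 (polyf P0)) (close1 : C1_close d F1 (polyf P1)).
Hypothesis d_le : 32 * (e%:R * e%:R) * d <= 1.
Hypotheses (B0 : rbound2 P0 <= B) (B1 : rbound2 P1 <= B).
Hypothesis B_le : 32 * B * (e%:R * e%:R) <= m%:R.
Hypothesis cert : certified n m e P0 P1 qs.

Let u : R := e%:R^-1.
Let eps : R := u * u / 16.
Let E1 : 1 <= e%:R :> R. Proof. by rewrite ler1n. Qed.
Let E0 : 0 < e%:R :> R. Proof. exact: lt_le_trans E1. Qed.
Let u0 : 0 < u. Proof. by rewrite invr_gt0. Qed.
Let u1 : u <= 1. Proof. by rewrite invf_le1. Qed.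
Let eu : e%:R * u = 1. Proof. by rewrite divff // gt_eqF. Qed.

(** The two sources of error, the name and the mesh, get half of [eps] each, that is [u^2/32]; this
    is the origin of both factors 32 in [check_body]. *)
Let dB : d + B / m%:R <= eps.
Proof.
have mR : 0 < m%:R :> R by rewrite ltr0n.
have h1 : d <= u * u / 32 by exact: scaled_le eu d_le.
have h2 : B / m%:R <= u * u / 32.
  apply: scaled_le eu _; rewrite mulrA ler_pdivrMr // mul1r.
  by apply: le_trans B_le; rewrite mulrAC.
by rewrite /eps; lra.
Qed.

Let d0 : 0 <= d.
Proof.
have [x xK] := K2_nonempty R.
by have [h _] := close0 xK; exact: le_trans h.
Qed.

Let epsu : eps <= u / 16.
Proof. by rewrite /eps ler_wpM2r // ler_piMl // ltW. Qed.

Let nearby (F : pt -> R) P (x : pt) (a b : nat) :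
  C1_close d F (polyf P) -> rbound2 P <= B -> K2 R x ->
  let g := gridv R m a b in
  `|g.1| <= 1 -> `|g.2| <= 1 ->
  `|x 0 0 - g.1| <= m%:R^-1 -> `|x 0 1 - g.2| <= m%:R^-1 ->
  [/\ `|F x - (polyv g.1 g.2 P).1| <= eps,
      `|pd 0 F x - (polyv g.1 g.2 P).2.1| <= eps &
      `|pd 1 F x - (polyv g.1 g.2 P).2.2| <= eps].
Proof.
move=> hF hB xK g g1 g2 x0 x1; have [hv hd] := hF _ xK.
have /K2P [k0 k1] := xK.
have im0 : 0 <= m%:R^-1 :> R by rewrite invr_ge0.
have [ [_ _ c1] [_ _ c2] [_ _ c3] ] := polyv_close im0 P k0 k1 g1 g2 x0 x1.
have [_ p0 p1] := polyf_grad P x.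
have tri (a1 b1 c1' : R) : `|a1 - b1| <= d -> `|b1 - c1'| <= rbound2 P / m%:R ->
    `|a1 - c1'| <= eps.
  move=> h1 h2; apply: le_trans dB.
  rewrite (_ : a1 - c1' = (a1 - b1) + (b1 - c1')); last by ring.
  apply: le_trans (ler_normD _ _) _; apply: lerD => //.
  by apply: le_trans h2 _; rewrite ler_wpM2r.
split; first exact: tri hv c1.
  by apply: tri c2; have := hd 0; rewrite p0.
by apply: tri c3; have := hd 1; rewrite p1.
Qed.

Let square_K2 q x : q \in qs -> in_square n%:R^-1 q x -> K2 R x.
Proof.
move=> /(certified_inside cert)[h1 h2 h3 h4] [/andP[? ?] /andP[? ?]].
by apply/K2P; rewrite !ler_norml; split; apply/andP; split; lra.
Qed.

Let det_neq0 q x y : q \in qs -> in_square n%:R^-1 q x -> in_square n%:R^-1 q y ->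
  pd 0 F0 x * pd 1 F1 y - pd 1 F0 x * pd 0 F1 y != 0.
Proof.
move=> qq xq yq; have xK := square_K2 qq xq; have yK := square_K2 qq yq.
have /K2P [x0 x1] := xK; have /K2P [y0 y1] := yK.
have [a a2 [ga xa]] := grid_near m0 x0; have [b b2 [gb xb]] := grid_near m0 x1.
have [a' a2' [ga' xa']] := grid_near m0 y0; have [b' b2' [gb' xb']] := grid_near m0 y1.
have [_ h0 h1] := nearby close0 B0 xK ga gb xa xb.
have [_ h0' h1'] := nearby close1 B1 yK ga' gb' xa' xb'.
have [k1 k2 k3 k4 k5] := certified_unique cert qq a2 b2 a2' b2'
  (@near_square_mem _ m%:R^-1 _ (gridv R m a b) _ xq xa xb)
  (@near_square_mem _ m%:R^-1 _ (gridv R m a' b') _ yq xa' xb').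
exact: det_perturb u0 u1 eu (lexx eps) h0 h1 h0' h1' k1 k2 k3 k4 k5.
Qed.

Let far_zero x : K2 R x ->
  [\/ exists2 q, q \in qs & [/\ q.1 < x 0 0, x 0 0 < q.1 + n%:R^-1, q.2 < x 0 1
      & x 0 1 < q.2 + n%:R^-1], 2 * u <= `|F0 x| | 2 * u <= `|F1 x|].
Proof.
move=> xK; have /K2P [x0 x1] := xK.
have [a a2 [ga xa]] := grid_near m0 x0; have [b b2 [gb xb]] := grid_near m0 x1.
have [h0 _ _] := nearby close0 B0 xK ga gb xa xb.
have [h1 _ _] := nearby close1 B1 xK ga gb xa xb.
have val (y z : R) : `|y - z| <= eps -> 3 / e%:R <= `|z| -> 2 * u <= `|y|.
  move=> yz; rewrite -/u => hz; have := ler_normB y (y - z).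
  by rewrite opprB subrKC => hh; have hu := epsu; have hu0 := u0; lra.
case: (certified_far cert a2 b2) => [[q qq iq]|k|k].
- apply: Or31; exists q => //.
  by apply: inner_square_mem iq xa xb.
- by apply: Or32; apply: val h0 k.
- by apply: Or33; apply: val h1 k.
Qed.

Let apart_in q r : q \in qs -> r \in qs -> q <> r -> apart n%:R^-1 q r.
Proof.
move=> qq rr qr; rewrite -(nth_index (0, 0) qq) -(nth_index (0, 0) rr).
apply: certified_apart cert _ _ _ _ _; rewrite ?index_mem //.
by move=> /(congr1 (nth (0, 0) qs)); rewrite !nth_index.
Qed.

Lemma certified_covers x : zeros (K2 R) f x ->
  exists2 q, q \in qs & in_square n%:R^-1 q x.
Proof.
case=> xK fx; case: (far_zero xK) => [[q qq [? ? ? ?]]|h|h].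
- by exists q => //; split; apply/andP; split; exact: ltW.
- by move: h; rewrite fx mxE normr0 leNgt mulr_gt0.
- by move: h; rewrite fx mxE normr0 leNgt mulr_gt0.
Qed.

Lemma certified_inj q x y : q \in qs ->
  zeros (K2 R) f x -> in_square n%:R^-1 q x ->
  zeros (K2 R) f y -> in_square n%:R^-1 q y -> x = y.
Proof.
move=> qq [xK fx] xq [yK fy] yq.
have seg t : 0 <= t <= 1 -> in_square n%:R^-1 q (y + t *: (x - y)).
  by move=> t01; exact: in_square_convex.
have dcomp i (t : R) : 0 <= t <= 1 ->
    differentiable (fun x : pt => f x 0 i) (y + t *: (x - y)).
  by move=> /seg /(square_K2 qq) /df /(is_grad_comp i)[].
have [t t01] := MVT_plane (dcomp 0); have [s s01] := MVT_plane (dcomp 1).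
rewrite fx fy !subrr => /esym h1 /esym h0.
have := det_neq0 qq (seg _ t01) (seg _ s01).
move=> D; have [z0 z1] := solve2_eq0 D h0 h1.
by apply/eqP; rewrite -subr_eq0; apply/eqP; apply: ptP; rewrite [RHS]mxE.
Qed.

(* |f|^2 is smaller at the center of the square than on its boundary, so it has a
   critical point inside, which is a zero since the Jacobian is invertible. *)
Lemma certified_exists q : q \in qs ->
  exists x, zeros (K2 R) f x /\ in_square n%:R^-1 q x.
Proof.
move=> qq; pose Phi := fun x : pt => F0 x * F0 x + F1 x * F1 x.
have gradPhi x : K2 R x -> is_grad Phi x
    (F0 x * pd 0 F0 x + F0 x * pd 0 F0 x + (F1 x * pd 0 F1 x + F1 x * pd 0 F1 x))
    (F0 x * pd 1 F0 x + F0 x * pd 1 F0 x + (F1 x * pd 1 F1 x + F1 x * pd 1 F1 x)).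
  move=> /df dx; have g i : is_grad (fun x : pt => f x 0 i) x
     (pd 0 (fun x : pt => f x 0 i) x) (pd 1 (fun x : pt => f x 0 i) x).
    by have [? _ _] := is_grad_comp i dx; split.
  by apply: is_gradD; apply: is_gradM.
have nR : 0 < n%:R^-1 :> R by rewrite invr_gt0 ltr0n.
pose c : pt := mkpt (q.1 + (2 * n)%N%:R^-1) (q.2 + (2 * n)%N%:R^-1).
have n2 : (2 * n)%N%:R^-1 = n%:R^-1 / 2 :> R by rewrite natrM invfM mulrC.
have cq : in_square n%:R^-1 q c.
  by rewrite /in_square mkpt0 mkpt1 n2; split; apply/andP; split; lra.
have cK := square_K2 qq cq.
have [z zq zmin] : exists2 z, z \in in_square n%:R^-1 q &
    forall t, t \in in_square n%:R^-1 q -> Phi z <= Phi t.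
  apply: EVT_min_rV; [by exists c|exact: in_square_compact|].
  apply: continuous_in_subspaceT => x; rewrite inE => /(square_K2 qq) /gradPhi[dx _ _].
  exact: differentiable_continuous.
rewrite inE in zq; have zK := square_K2 qq zq.
have Phic : Phi c <= 2 * (u * u).
  have [h1 h2] := certified_center cert qq.
  have [k1 _] := close0 cK; have [k2 _] := close1 cK.
  have e2 : (2 * e)%N%:R^-1 = u / 2 :> R by rewrite natrM invfM mulrC.
  have du : d <= u / 16.
    apply: le_trans epsu; apply: le_trans dB; rewrite lerDl divr_ge0 //.
    exact: le_trans (rbound2_ge0 P0) B0.
  have sq (y p : R) : `|y - p| <= d -> `|p| <= (2 * e)%N%:R^-1 -> y * y <= u * u.
    rewrite e2 => h h'; have hy : `|y| <= u.
      by have := ler_normD (y - p) p; have hu0 := u0; rewrite subrK; lra.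
    by rewrite -[y * y]ger0_norm ?normrM; [apply: ler_pM|rewrite -expr2 sqr_ge0].
  have hF0 : F0 c * F0 c <= u * u.
    by apply: sq k1 _; rewrite /polyf mkpt0 mkpt1.
  have hF1 : F1 c * F1 c <= u * u.
    by apply: sq k2 _; rewrite /polyf mkpt0 mkpt1.
  by rewrite /Phi; lra.
have small : Phi z < 4 * (u * u).
  apply: le_lt_trans (zmin c _) _; first by rewrite inE.
  by apply: le_lt_trans Phic _; rewrite ltr_pM2r ?mulr_gt0 // ltr_nat.
have nbig (y : R) : 2 * u <= `|y| -> 4 * (u * u) <= y * y.
  move=> h; rewrite -[y * y]ger0_norm -?expr2 ?sqr_ge0 // expr2 normrM.
  have -> : 4 * (u * u) = (2 * u) * (2 * u) by ring.
  by apply: ler_pM => //; rewrite mulr_ge0 // ltW.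
have sqge0 (y : R) : 0 <= y * y by rewrite -expr2 sqr_ge0.
(* [Phi z] is too small for [z] to be far from the zeros, so [z] lies strictly inside some square;
   since the squares are pairwise apart, this square is [q]. *)
have [i1 i2 i3 i4] : [/\ q.1 < z 0 0, z 0 0 < q.1 + n%:R^-1, q.2 < z 0 1
      & z 0 1 < q.2 + n%:R^-1].
  case: (far_zero zK) => [[r rr [h1 h2 h3 h4]]|h|h].
  - have [->//|/eqP qr] := eqVneq q r.
    by case: (apart_interior zq (apart_in qq rr qr)); split.
  - by have h1 := nbig _ h; have h2 := sqge0 (F1 z); move: small; rewrite /Phi => h3; exfalso; lra.
  - by have h1 := nbig _ h; have h2 := sqge0 (F0 z); move: small; rewrite /Phi => h3; exfalso; lra.
have crit (l : 'I_2) : pd l Phi z = 0.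
  have [tau t0 ht] := in_square_interior l i1 i2 i3 i4.
  have dl (t : R) : `|t| < tau -> is_derive t 1 (fun s : R => Phi (z + s *: unitv R l))
      (unitv R l 0 0 * pd 0 Phi (z + t *: unitv R l) +
       unitv R l 0 1 * pd 1 Phi (z + t *: unitv R l)).
    by move=> /ht /(square_K2 qq) /gradPhi[dx _ _]; exact: is_derive_line.
  have tt (t : R) : t \in `]- tau, tau[%R -> `|t| < tau by rewrite in_itv /= ltr_norml.
  have [||||_] := @derive1_at_min R (fun s => Phi (z + s *: unitv R l)) (- tau) tau 0.
  - by lra.
  - by move=> t /tt /dl; case.
  - by rewrite in_itv /=; apply/andP; split; lra.
  - by move=> t /tt /ht hin; rewrite scale0r addr0; apply: zmin; rewrite inE.
  have t00 : `|0 : R| < tau by rewrite normr0.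
  have [_ ->] := dl 0 t00.
  rewrite scale0r addr0 !mxE; case: (ord2P l) => -> /=.
    by rewrite mul1r mul0r addr0.
  by rewrite mul1r mul0r add0r.
have [_ c0 c1] := gradPhi z zK; rewrite !crit in c0 c1.
(* The gradient of [Phi] is twice the transposed Jacobian applied to [f z]; swapping the factors
   presents the determinant as that of the transposed system. *)
have := det_neq0 qq zq zq; rewrite (mulrC (pd 1 F0 z)) => D.
have [z0 z1] : F0 z = 0 /\ F1 z = 0.
  by apply: solve2_eq0 D _ _; apply: double_eq0.
by exists z; split=> //; split=> //; apply: ptP; rewrite [RHS]mxE.
Qed.
End Sound.

(** * Continuously differentiable maps on the ball *)

Section C1.
Variable R : realType.
Notation pt := 'rV[R]_2.
Implicit Types (f g : pt -> pt) (F : pt -> R).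

Lemma compact_bounded_fun (F : pt -> R) :
  (forall x, K2 R x -> {for x, continuous F}) ->
  exists M : R, forall x, K2 R x -> `|F x| <= M.
Proof.
move=> cF.
have [|c cK hc] := @EVT_max_rV R 2 (fun x => `|F x|) (K2 R) (K2_nonempty R)
  (@K2_compact R).
  apply: continuous_in_subspaceT => x; rewrite inE => /cF cFx.
  exact: cvg_norm cFx.
by exists `|F c| => x xK; apply: hc; rewrite inE.
Qed.

Lemma C1_on_diff f x : C1_on (K2 R) f -> K2 R x -> differentiable f x.
Proof. by move=> [U [_ KU hU]] /KU /hU[]. Qed.

Lemma C1_on_grad f x i : C1_on (K2 R) f -> K2 R x ->
  is_grad (fun y => f y 0 i) x (pd 0 (fun y => f y 0 i) x) (pd 1 (fun y => f y 0 i) x).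
Proof. by move=> Cf /(C1_on_diff Cf)/(is_grad_comp i)[? _ _]; split. Qed.

Lemma pd_coord f x i l : differentiable f x ->
  pd l (fun y => f y 0 i) x = jacobian f x l i.
Proof.
move=> /(is_grad_comp i)[_ h0 h1]; rewrite /jacobian mxE.
by case: (ord2P l) => ->; rewrite ?h0 ?h1.
Qed.

Lemma C1_on_pd_continuous f x i l : C1_on (K2 R) f -> K2 R x ->
  {for x, continuous (fun y => pd l (fun y => f y 0 i) y)}.
Proof.
move=> [U [oU KU hU]] xK; have [df cJ] := hU _ (KU _ xK).
have cE : {for x, continuous (fun y => jacobian f y l i)}.
  exact: (continuous_comp cJ (@coord_continuous _ _ _ l i _)).
rewrite /prop_for /continuous_at (pd_coord i l df).
have nU : nbhs x U by apply: open_nbhs_nbhs; split=> //; exact: KU.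
have eJ : \forall y \near x, jacobian f y l i = pd l (fun y => f y 0 i) y.
  by apply: filterS nU => y /hU[dy _]; rewrite pd_coord.
exact: cvg_trans (near_eq_cvg eJ) cE.
Qed.

Lemma C1_on_bounded f i : C1_on (K2 R) f -> C1_bounded (fun y => f y 0 i).
Proof.
move=> Cf.
have [M0 h0] : exists M : R, forall x, K2 R x -> `|f x 0 i| <= M.
  apply: compact_bounded_fun => x xK; apply: differentiable_continuous.
  by have [] := C1_on_grad i Cf xK.
have [M1 h1] := compact_bounded_fun (fun x => @C1_on_pd_continuous f x i 0 Cf).
have [M2 h2] := compact_bounded_fun (fun x => @C1_on_pd_continuous f x i 1 Cf).
exists (Num.max M0 (Num.max M1 M2)) => x xK.
by split; rewrite !le_max ?h0 ?h1 ?h2 ?orbT.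
Qed.

Lemma name_close f (P : {poly {poly rat}}) i (d : R) :
  C1_on (K2 R) f ->
  C1norm (K2 R) (fun x => f x 0 i - peval P x) < d ->
  C1_close d (fun x => f x 0 i) (polyf (coefs_val R (coefs_of_poly P))).
Proof.
move=> Cf; set h := fun x : pt => f x 0 i - peval P x => hd x xK.
set Q := coefs_val R _.
have gr y : K2 R y -> is_grad h y
    (pd 0 (fun y => f y 0 i) y - pd 0 (polyf Q) y)
    (pd 1 (fun y => f y 0 i) y - pd 1 (polyf Q) y).
  move=> yK; rewrite (_ : h = fun x : pt => f x 0 i - polyf Q x); last first.
    by apply: funext => z; rewrite /h pevalE.
  apply: is_gradB; first exact: C1_on_grad.
  by have [? _ _] := polyf_grad Q y; split.
have [M hM] := C1_on_bounded i Cf; have [N hN] := polyf_bounded Q.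
have bh : C1_bounded h.
  exists (M + N) => y yK; have [_ -> ->] := gr y yK.
  have [a1 a2 a3] := hM y yK; have [b1 b2 b3] := hN y yK.
  rewrite /h pevalE -/Q.
  by split; apply: le_trans (ler_normB _ _) _; exact: lerD.
have [h1 h2] := C1norm_ge bh xK; have [_ g0 g1] := gr x xK.
split; first by rewrite -pevalE; exact: le_trans h1 (ltW hd).
move=> l; apply: le_trans _ (ltW hd); apply: le_trans (h2 l).
by case: (ord2P l) => ->; rewrite ?g0 ?g1.
Qed.

(** Consecutive odd numerators differ by 2, so rounding costs at most [1 / 2^j]. The sign is a
    separate bit, which reduces negative [y] to [- y]. *)
Lemma vertex_approx (j : nat) (y : R) :
  exists v, `|vertex_val R j v - y| <= (2 ^+ j)^-1.
Proof.
have j0 : 0 < 2 ^+ j :> R by rewrite exprn_gt0.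
have pos (z : R) : 0 <= z -> exists b : nat,
    `|(2 * b + 1)%:R / (2 ^ j)%:R - z| <= (2 ^+ j)^-1.
  move=> z0; have z1 : 0 <= z * 2 ^+ j / 2 by rewrite divr_ge0 // mulr_ge0 // ltW.
  have /andP[h1 h2] := Num.Theory.truncn_itv z1.
  exists (Num.truncn (z * 2 ^+ j / 2)); move: h1 h2; set b := Num.truncn _.
  have -> : b.+1%:R = b%:R + 1 :> R by rewrite natr1.
  move=> h1 h2.
  have -> : (2 * b + 1)%:R = 2 * b%:R + 1 :> R by rewrite natrD natrM.
  rewrite natrX.
  have -> : (2 * b%:R + 1) / 2 ^+ j - z = (2 * b%:R + 1 - z * 2 ^+ j) / 2 ^+ j.
    by field; rewrite gt_eqF.
  have ij0 : 0 <= (2 ^+ j)^-1 :> R by rewrite invr_ge0 ltW.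
  rewrite normrM (ger0_norm ij0); apply: ler_piMl => //.
  move: h1 h2; set w := z * 2 ^+ j => h1 h2; clearbody w.
  by rewrite ler_norml; apply/andP; split; lra.
rewrite /vertex_val /vertex_num /num_of_coef /vertex_coef /numv.
have [y0|y0] := lerP 0 y.
  by have [b hb] := pos _ y0; exists (false, b); rewrite /= subr0.
have [b hb] := pos (- y) ltac:(lra); exists (true, b) => /=.
by rewrite sub0r mulNr -opprD normrN -[y in _ + y]opprK.
Qed.
End C1.

(** * Existence of certificates *)

Section Complete.
Variable R : realType.
Notation pt := 'rV[R]_2.

Lemma uniform_radius (T : eqType) (s : seq T) (Q : T -> R -> Prop) :
  (forall z r r', Q z r -> 0 < r' -> r' <= r -> Q z r') ->
  (forall z, z \in s -> exists2 r, 0 < r & Q z r) ->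
  exists2 r, 0 < r & forall z, z \in s -> Q z r.
Proof.
move=> mono; elim: s => [_|z s IH h]; first by exists 1.
have [r r0 hr] := IH (fun y ys => h y ltac:(by rewrite inE ys orbT)).
have [r' r'0 hr'] := h z (mem_head _ _).
have m0 : 0 < Num.min r r' by rewrite lt_min r0.
exists (Num.min r r') => // y; rewrite inE => /predU1P[->|ys].
  by apply: mono hr' m0 _; rewrite ge_min lexx orbT.
by apply: mono (hr _ ys) m0 _; rewrite ge_min lexx.
Qed.

Lemma continuous_radius (G : pt -> R) z (eta : R) :
  {for z, continuous G} -> 0 < eta ->
  exists2 r, 0 < r & forall x, `|x - z| <= r -> `|G x - G z| <= eta.
Proof.
move=> /cvgrPdist_lt cG /cG /nbhs_ballP[r /= r0 hr].
exists (r / 2); first by rewrite divr_gt0.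
move=> x xz; rewrite distrC ltW //; apply: hr.
rewrite -ball_normE /ball_ /= distrC; apply: le_lt_trans xz _.
by rewrite ltr_pdivrMr // ltr_pMr // ltr1n.
Qed.

Lemma nat_above (x : R) : exists n : nat, x < n%:R.
Proof. by exists (Num.truncn x).+1; exact: truncnS_gt. Qed.

Lemma pow_half_small (e : R) : 0 < e -> exists k, 2^-1 ^+ k < e.
Proof.
move=> e0; have [k hk] := nat_above e^-1; exists k.
rewrite exprVn invf_plt ?posrE ?exprn_gt0 //; apply: lt_le_trans hk _.
by rewrite -natrX ler_nat ltnW // ltn_expl.
Qed.

Lemma gridv_in (m a : nat) : (0 < m)%N -> (a <= 2 * m)%N ->
  `|(a%:R - m%:R) / m%:R| <= (1 : R).
Proof.
move=> m0 am; have mR : 0 < m%:R :> R by rewrite ltr0n.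
have aR : a%:R <= 2 * m%:R :> R by rewrite -natrM ler_nat.
have a0 : 0 <= a%:R :> R by [].
by rewrite ler_norml ler_pdivrMr // ler_pdivlMr //; apply/andP; split; lra.
Qed.

(* Real arithmetic of the certificate: h is the side of the squares, t the mesh
   of the grid, tau the precision of the centers. *)
Section Arith.
Variables (h t tau rho : R).
Hypotheses (h0 : 0 < h) (t0 : 0 < t) (th : 16 * t <= h) (tauh : 8 * tau <= h)
  (hrho : 4 * h <= rho).

Lemma arith_inside (z q N : R) : `|z| <= N -> N + rho <= 1 ->
  `|q - (z - h / 2)| <= tau -> -1 <= q /\ q + h <= 1.
Proof.
by move: h0 tauh hrho => ? ? ? /ler_normlP[? ?] ? /ler_normlP[? ?]; split; lra.
Qed.

Lemma arith_apart (z z' q q' : R) : rho < `|z - z'| ->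
  `|q - (z - h / 2)| <= tau -> `|q' - (z' - h / 2)| <= tau ->
  q + h < q' \/ q' + h < q.
Proof.
move: h0 tauh hrho => ? ? ?; rewrite lter_normr => /orP[?|?] /ler_normlP[? ?] /ler_normlP[? ?];
  [right|left]; lra.
Qed.

Lemma arith_center (z q : R) : `|q - (z - h / 2)| <= tau ->
  `|q + h / 2 - z| <= tau.
Proof. by move=> /ler_normlP[? ?]; rewrite ler_norml; apply/andP; split; lra. Qed.

Lemma arith_inner (z q g : R) : `|q - (z - h / 2)| <= tau -> `|g - z| <= h / 8 ->
  q + t < g /\ g + t < q + h.
Proof. by move: h0 th tauh => ? ? ? /ler_normlP[? ?] /ler_normlP[? ?]; split; lra. Qed.

Lemma arith_near (z q g : R) : `|q - (z - h / 2)| <= tau ->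
  q <= g + t -> g <= q + h + t -> `|g - z| <= rho.
Proof.
by move: h0 th tauh hrho => ? ? ? ? /ler_normlP[? ?] ? ?; rewrite ler_norml; apply/andP; split; lra.
Qed.
End Arith.

Lemma arith_far (u d nu x y p q : R) : 0 < u -> 8 * u <= nu -> d <= u ->
  nu <= `|x| + `|y| -> `|x - p| <= d -> `|y - q| <= d ->
  3 * u <= `|p| \/ 3 * u <= `|q|.
Proof.
move=> u0 unu du hnu hx hy.
have px : `|x| <= `|p| + d.
  by apply: le_trans (_ : `|p + (x - p)| <= _); [rewrite subrKC|
    apply: le_trans (ler_normD _ _) (lerD (lexx _) hx)].
have qy : `|y| <= `|q| + d.
  by apply: le_trans (_ : `|q + (y - q)| <= _); [rewrite subrKC|
    apply: le_trans (ler_normD _ _) (lerD (lexx _) hy)].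
have [?|?] := lerP (3 * u) `|p|; [by left|right; lra].
Qed.

Lemma close_norm (a b d c r : R) : `|a - b| <= d -> `|a| <= c -> c + d <= r ->
  `|b| <= r.
Proof.
move=> h1 h2; apply: le_trans; have := ler_normB a (a - b).
by rewrite opprB subrKC => h3; apply: le_trans h3 _; exact: lerD.
Qed.

Variables (f : pt -> pt) (s : seq pt).
Notation F i := (fun x : pt => f x 0 i).
Notation det x y := (pd 0 (F 0) x * pd 1 (F 1) y - pd 1 (F 0) x * pd 0 (F 1) y).
Hypothesis C1f : C1_on (K2 R) f.
Hypothesis uniq_s : uniq s.
Hypothesis zeros_s : zeros (K2 R) f = [set` s].
Hypothesis interior_s : forall z, z \in s -> `|z| < 1.
Hypothesis regular_s : forall z, z \in s -> det z z != 0.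

Let zero_s z : z \in s -> K2 R z /\ f z = 0.
Proof.
by move=> zs; have : zeros (K2 R) f z by rewrite zeros_s.
Qed.

Let pd_bound : exists2 M : R, 0 <= M & forall x i l, K2 R x -> `|pd l (F i) x| <= M.
Proof.
have [M M0 hM] := C1_bounded_uniform (fun i => C1_on_bounded i C1f).
by exists M => // x i l /(hM i)[].
Qed.

(** One number is at once a radius, a lower bound for determinants and a lower bound for distances
    between zeros. The property is therefore inherited by smaller radii, and [uniform_radius] yields
    one radius for all zeros. *)
Definition isolating (z : pt) (r : R) : Prop :=
  [/\ `|z| + r <= 1,
      forall x y, `|x - z| <= r -> `|y - z| <= r -> r <= `|det x y| &
      forall z', z' \in s -> z' <> z -> r < `|z - z'|].

Let isolating_ball z (r : R) x : isolating z r -> `|x - z| <= r -> K2 R x.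
Proof.
move=> [h1 _ _] xz; apply/K2E; apply: le_trans h1.
rewrite -[x](subrKC z); apply: le_trans (ler_normD _ _) _.
by rewrite lerD2l.
Qed.

Let isolating_exists : exists2 r, 0 < r & forall z, z \in s -> isolating z r.
Proof.
apply: uniform_radius => [z r r' [h1 h2 h3] _ rr|z zs].
  split; first by apply: le_trans h1; rewrite lerD2l.
  - by move=> x y xz yz; apply: (le_trans rr); apply: h2;
      [exact: le_trans xz rr|exact: le_trans yz rr].
  - by move=> z' z's /(h3 _ z's); exact: le_lt_trans.
have [zK _] := zero_s zs.
have [M M0 hM] := pd_bound; have dz : 0 < `|det z z| by rewrite normr_gt0 regular_s.
(* Chosen so that [(4 M + 2) * eta], the error allowed by [det_close], is at most half of the
   determinant at [z]. *)
pose eta := Num.min 1 (`|det z z| / (2 * (4 * M + 2))).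
have den : 0 < 2 * (4 * M + 2) by lra.
have eta0 : 0 < eta by rewrite lt_min ltr01 divr_gt0.
have eta1 : eta <= 1 by rewrite ge_min lexx.
have eta2 : (4 * M + 2) * eta <= `|det z z| / 2.
  have e2 : eta <= `|det z z| / (2 * (4 * M + 2)) by rewrite ge_min lexx orbT.
  apply: le_trans (ler_wpM2l _ e2) _; first by lra.
  have c0 : 4 * M + 2 != 0 by rewrite gt_eqF //; lra.
  set c := 4 * M + 2 in c0 *; set D := `|_|.
  by have -> : c * (D / (2 * c)) = D / 2 by field.
have [r1 r10 hr1] : exists2 r, 0 < r & forall il, il \in enum {: 'I_2 * 'I_2} ->
    forall x, `|x - z| <= r -> `|pd il.2 (F il.1) x - pd il.2 (F il.1) z| <= eta.
  apply: uniform_radius => [il r r' hr _ rr x xz|[i l] _].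
    by apply: hr; exact: le_trans xz rr.
  by apply: continuous_radius eta0; exact: C1_on_pd_continuous.
have {}hr1 x i l : `|x - z| <= r1 -> `|pd l (F i) x - pd l (F i) z| <= eta.
  by apply: (hr1 (i, l)); rewrite mem_enum.
have [r2 r20 hr2] : exists2 r, 0 < r & forall z', z' \in s -> z' <> z -> r < `|z - z'|.
  apply: uniform_radius => [z' r r' hr _ rr /hr|z' z's]; first exact: le_lt_trans.
  have [->|/eqP zz] := eqVneq z' z; first by exists 1.
  exists (`|z - z'| / 2).
    by rewrite divr_gt0 // normr_gt0 subr_eq0; apply/eqP => e; apply: zz.
  move=> _; rewrite ltr_pdivrMr // ltr_pMr ?ltr1n //.
  by rewrite normr_gt0 subr_eq0; apply/eqP => e; apply: zz.
have z1 := interior_s zs.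
pose r := Num.min (Num.min r1 r2) (Num.min (1 - `|z|) (`|det z z| / 2)).
exists r; first by rewrite !lt_min r10 r20 subr_gt0 z1 divr_gt0.
split.
- have : r <= 1 - `|z| by rewrite !ge_min lexx orbT.
  by lra.
- move=> x y xz yz; have rr1 : r <= r1 by rewrite !ge_min lexx.
  have xr := le_trans xz rr1; have yr := le_trans yz rr1.
  have := det_close eta1 (hr1 _ 0 0 xr) (hr1 _ 0 1 xr) (hr1 _ 1 0 yr)
    (hr1 _ 1 1 yr) (hM _ _ _ zK) (hM _ _ _ zK) (hM _ _ _ zK) (hM _ _ _ zK).
  have rd : r <= `|det z z| / 2 by rewrite !ge_min lexx !orbT.
  by move=> hD; apply: lower_half hD eta2 rd.
- move=> z' z's zz; apply: le_lt_trans (hr2 _ z's zz).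
  by rewrite !ge_min lexx orbT.
Qed.

(** Removing the open balls of radius [h] around the zeros leaves a compact set, on which the
    continuous function [|f_0| + |f_1|] attains a minimum that cannot be 0. *)
Let far_bound (h : R) : 0 < h -> exists2 nu, 0 < nu & forall x, K2 R x ->
  (forall z, z \in s -> h <= `|x - z|) -> nu <= `|f x 0 0| + `|f x 0 1|.
Proof.
move=> h0; pose B := K2 R `&` \bigcap_(z in [set` s])
  ((fun x : pt => `|x - z|) @^-1` [set t | h <= t]).
have cB : compact B.
  apply: compact_closedI; first exact: K2_compact.
  apply: closed_bigI => z _; apply: closed_comp; last exact: closed_ge.
  by move=> x _; have := cvg_norm (cvgB (@cvg_id _ (nbhs x)) (cvg_cst z)); exact.
have BP x : K2 R x -> (forall z, z \in s -> h <= `|x - z|) -> B x.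
  by move=> xK hx; split.
have [B0|/set0P B0] := eqVneq B set0.
  by exists 1 => // x xK hx; have := BP x xK hx; rewrite B0.
have [|c cB' hc] := @EVT_min_rV R 2 (fun x => `|f x 0 0| + `|f x 0 1|) B B0 cB.
  apply: continuous_in_subspaceT => x; rewrite inE => -[xK _].
  have cF i : {for x, continuous (F i)}.
    by apply: differentiable_continuous; have [] := C1_on_grad i C1f xK.
  have := cvgD (cvg_norm (cF 0)) (cvg_norm (cF 1)); exact.
rewrite inE in cB'; exists (`|f c 0 0| + `|f c 0 1|); last first.
  by move=> x xK hx; apply: hc; rewrite inE; exact: BP.
rewrite lt_neqAle addr_ge0 // andbT eq_sym; apply/negP.
rewrite paddr_eq0 // !normr_eq0 => /andP[/eqP f0 /eqP f1].
case: cB' => cK cz; have : zeros (K2 R) f c.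
  by split=> //; apply: ptP; rewrite [RHS]mxE.
rewrite zeros_s => /= cs; have := cz c cs.
by rewrite /= subrr normr0 leNgt h0.
Qed.

(** [n], [e], [j] and the squares come from [f] alone. The precision [d] and the mesh are quantified
    after them because the test also requires [m] to exceed a bound computed from the coefficients
    of the polynomials, which are known only once the precision is fixed. *)
Theorem certified_data n0 : exists (n e j : nat) (C : seq vertex),
  [/\ (n0 <= n)%N, (0 < n)%N, (0 < e)%N & forall p0 p1 (d : R) m,
    C1_close d (F 0) (polyf p0) -> C1_close d (F 1) (polyf p1) ->
    32 * (e%:R * e%:R) * d <= 1 -> (16 * n <= m)%N ->
    certified n m e p0 p1 (squares_val R j C)].
Proof.
have [rho rho0 iso] := isolating_exists; have [M M0 hM] := pd_bound.
have [n1 hn1] := nat_above (4 / rho).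
pose n := (n0 + n1).+1; pose h : R := n%:R^-1.
have h0 : 0 < h by rewrite invr_gt0 ltr0n.
have hrho : 4 * h <= rho.
  rewrite /h ler_pdivrMr ?ltr0n // mulrC -ler_pdivrMr //; apply: ltW.
  by apply: lt_le_trans hn1 _; rewrite ler_nat leqW // leq_addl.
have h8 : 0 < h / 8 by rewrite divr_gt0.
(* Grid points at distance less than [h / 8] from a zero are inner points of its square, by
   [arith_inner]; all the others are covered by [nu]. *)
have [nu nu0 hnu] := far_bound h8.
(* [M + 1] leaves room for the approximation error in the entries. [8 u <= nu] makes one component
   of [f] at least [4 u] at far grid points, hence a polynomial value at least [3 u]. [2 u <= rho]
   lets the determinants lose half of their size. *)
have [e hme] := nat_above (M + 1 + 8 / nu + 2 / rho).
have p1 : 0 < 8 / nu by rewrite divr_gt0.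
have p2 : 0 < 2 / rho by rewrite divr_gt0.
have eR1 : 1 <= e%:R :> R by lra.
have eR : 0 < e%:R :> R by lra.
have e0 : (0 < e)%N by rewrite -(ltr_nat R).
pose u : R := e%:R^-1.
have u0 : 0 < u by rewrite invr_gt0.
have u1 : u <= 1 by rewrite invf_le1.
have eu : e%:R * u = 1 by rewrite divff // gt_eqF.
have unu : 8 * u <= nu.
  by rewrite /u ler_pdivrMr // mulrC -ler_pdivrMr //; lra.
have urho : 2 * u <= rho.
  by rewrite /u ler_pdivrMr // mulrC -ler_pdivrMr //; lra.
have Me : M + 1 <= e%:R by lra.
have [tau1 tau10 htau1] : exists2 r, 0 < r & forall z, z \in s ->
    forall x, `|x - z| <= r -> `|f x 0 0| <= u / 4 /\ `|f x 0 1| <= u / 4.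
  apply: uniform_radius => [z r r' hr _ rr x xz|z zs].
    by apply: hr; exact: le_trans xz rr.
  have [zK fz] := zero_s zs.
  have u4 : 0 < u / 4 by rewrite divr_gt0.
  have cF i : {for z, continuous (F i)}.
    by apply: differentiable_continuous; have [] := C1_on_grad i C1f zK.
  have [r r0 hr] := continuous_radius (cF 0) u4.
  have [r' r'0 hr'] := continuous_radius (cF 1) u4.
  exists (Num.min r r'); first by rewrite lt_min r0.
  move=> x; rewrite le_min => /andP[/hr k /hr' k'].
  by move: k k'; rewrite fz !mxE !subr0.
pose tau := Num.min tau1 (h / 8).
have tau0 : 0 < tau by rewrite lt_min tau10.
have tauh : 8 * tau <= h.
  have : tau <= h / 8 by rewrite ge_min lexx orbT.
  by lra.
have htau z x : z \in s -> `|x - z| <= tau -> `|f x 0 0| <= u / 4 /\ `|f x 0 1| <= u / 4.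
  move=> zs xz; apply: (htau1 z zs); apply: le_trans xz _.
  by rewrite ge_min lexx.
have [j /ltW] := pow_half_small tau0; rewrite exprVn => hj.
(* The ideal square is centered at the zero [z], with lower left vertex at [z - h / 2] in each
   coordinate; the dyadic vertex misses it by at most [tau], so [f] is still at most [u / 4] at the
   actual center. *)
have /choice [V hV] : forall z : pt, exists v : vertex,
    `|vertex_val R j v.1 - (z 0 0 - h / 2)| <= tau /\
    `|vertex_val R j v.2 - (z 0 1 - h / 2)| <= tau.
  move=> z; have [v1 hv1] := vertex_approx j (z 0 0 - h / 2).
  have [v2 hv2] := vertex_approx j (z 0 1 - h / 2).
  by exists (v1, v2); split; [exact: le_trans hv1 hj|exact: le_trans hv2 hj].
exists n, e, j, (map V s); split => //.
  by rewrite /n leqW // leq_addr.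
move=> p0 p1' d m close0 close1 hd hm.
have m0 : (0 < m)%N by apply: leq_trans hm; rewrite muln_gt0.
pose t : R := m%:R^-1.
have t0 : 0 < t by rewrite invr_gt0 ltr0n.
have th : 16 * t <= h.
  rewrite /t ler_pdivrMr ?ltr0n // /h mulrC ler_pdivlMr ?ltr0n //.
  by rewrite -natrM ler_nat.
have du : d <= u * u / 32 by exact: scaled_le eu hd.
have uu : u * u <= u by rewrite ler_piMl // ltW.
have du32 : d <= u / 32 by lra.
have duu : d <= u by lra.
have d1 : d <= 1 by lra.
have ud : u / 4 + d <= u / 2 by lra.
have Md : M + d <= e%:R by lra.
have taurho : tau <= rho by lra.
have small2 : 0 <= d -> (4 * M + 2) * d <= u / 2.
  move=> d0; have Me4 : 4 * M + 2 <= 4 * e%:R by lra.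
  apply: le_trans (ler_wpM2r d0 Me4) _.
  have k2 : 4 * e%:R * d <= 4 * e%:R * (u * u / 32).
    by rewrite ler_wpM2l // mulr_ge0 // ltW.
  apply: le_trans k2 _.
  have -> : 4 * e%:R * (u * u / 32) = (e%:R * u) * u / 8 by field.
  by rewrite eu mul1r; lra.
pose q z := (vertex_val R j (V z).1, vertex_val R j (V z).2).
have sqE : squares_val R j (map V s) = map q s by rewrite /squares_val -map_comp.
have polyE (x y : R) p : (polyv x y p).1 = polyf p (mkpt x y).
  by rewrite /polyf mkpt0 mkpt1.
have gK a b : (a <= 2 * m)%N -> (b <= 2 * m)%N ->
    K2 R (mkpt (gridv R m a b).1 (gridv R m a b).2).
  by move=> ha hb; apply/K2P; rewrite mkpt0 mkpt1; split; exact: gridv_in.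
rewrite sqE; split.
- move=> _ /mapP[z zs ->]; have [h1 _ _] := iso _ zs; have [v1 v2] := hV z.
  have [? ?] := arith_inside h0 tauh hrho (coord_norm_le z 0) h1 v1.
  have [? ?] := arith_inside h0 tauh hrho (coord_norm_le z 1) h1 v2.
  by split.
- rewrite size_map => i k ilt klt ik; rewrite !(nth_map 0) //.
  set z := nth 0 s i; set z' := nth 0 s k.
  have zs : z \in s by exact: mem_nth.
  have z's : z' \in s by exact: mem_nth.
  have zz : z' <> z by move=> /eqP; rewrite nth_uniq // => /eqP e'; apply: ik.
  have [_ _ /(_ z' z's zz) hz] := iso _ zs.
  have [v1 v2] := hV z; have [v1' v2'] := hV z'.
  have [c0|c0] := lerP `|z 0 0 - z' 0 0| rho; last first.
    by have [?|?] := arith_apart h0 tauh hrho c0 v1 v1'; [exact: Or41|exact: Or42].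
  have [c1|c1] := lerP `|z 0 1 - z' 0 1| rho; last first.
    by have [?|?] := arith_apart h0 tauh hrho c1 v2 v2'; [exact: Or43|exact: Or44].
  suff : `|z - z'| <= rho by rewrite leNgt hz.
  by apply/pt_norm_le; rewrite !mxE.
- move=> _ /mapP[z zs ->]; have [v1 v2] := hV z.
  have h2 : (2 * n)%N%:R^-1 = h / 2 by rewrite natrM invfM mulrC.
  have e2 : (2 * e)%N%:R^-1 = u / 2 :> R by rewrite natrM invfM mulrC.
  rewrite h2 e2 /= !polyE; set x := mkpt _ _.
  have xz : `|x - z| <= tau.
    by apply/pt_norm_le; rewrite !mxE /=; split; exact: arith_center.
  have [k0 k1] := htau z x zs xz.
  have xK : K2 R x.
    by apply: isolating_ball (iso _ zs) _; exact: le_trans xz taurho.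
  have [l0 _] := close0 x xK; have [l1 _] := close1 x xK.
  by split; [exact: close_norm l0 k0 ud|exact: close_norm l1 k1 ud].
- move=> a b ha hb /=; set g := gridv R m a b.
  have xK := gK a b ha hb; set x := mkpt _ _ in xK.
  have [/existsP|] := boolP [exists i : 'I_(size s), `|x - nth 0 s i| < h / 8].
    move=> [i hi]; apply: Or31; set z := nth 0 s i in hi.
    have zs : z \in s by exact: mem_nth.
    exists (q z); first exact: map_f.
    have [v1 v2] := hV z; have /pt_norm_le := ltW hi; rewrite !mxE /= => -[k1 k2].
    have [? ?] := arith_inner h0 th tauh v1 k1.
    have [? ?] := arith_inner h0 th tauh v2 k2.
    by apply/and4P; split.
  rewrite negb_exists => /forallP hx.
  have nux : nu <= `|f x 0 0| + `|f x 0 1|.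
    apply: hnu => // z zs; rewrite leNgt.
    have zi : (index z s < size s)%N by rewrite index_mem.
    by have := hx (Ordinal zi); rewrite /= nth_index.
  have [l0 _] := close0 x xK; have [l1 _] := close1 x xK.
  rewrite !polyE -/x -/u.
  by have [?|?] := arith_far u0 unu duu nux l0 l1; [exact: Or32|exact: Or33].
- move=> _ a b a' b' /mapP[z zs ->] ha hb ha' hb'.
  move=> g g' /and4P[n1' n2 n3 n4] /and4P[n1'' n2' n3' n4'].
  have [v1 v2] := hV z.
  have xz : `|mkpt g.1 g.2 - z| <= rho.
    by apply/pt_norm_le; rewrite !mxE /=; split; apply: (arith_near h0 th tauh hrho); eassumption.
  have yz : `|mkpt g'.1 g'.2 - z| <= rho.
    by apply/pt_norm_le; rewrite !mxE /=; split; apply: (arith_near h0 th tauh hrho); eassumption.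
  have xK := gK a b ha hb; have yK := gK a' b' ha' hb'.
  move: xz yz xK yK; set x := mkpt g.1 g.2; set y := mkpt g'.1 g'.2 => xz yz xK yK.
  have [_ l0] := close0 x xK; have [_ l1] := close1 y yK.
  have [_ g00 g01] := polyf_grad p0 x; have [_ g10 g11] := polyf_grad p1' y.
  have l00 := l0 0; have l01 := l0 1; have l10 := l1 0; have l11 := l1 1.
  rewrite g00 in l00; rewrite g01 in l01; rewrite g10 in l10; rewrite g11 in l11.
  move: l00 l01 l10 l11; rewrite !mkpt0 !mkpt1.
  set A := (polyv _ _ p0).2.1; set A' := (polyv _ _ p0).2.2.
  set B := (polyv _ _ p1').2.1; set B' := (polyv _ _ p1').2.2 => l00 l01 l10 l11.
  split; [exact: close_norm l00 (hM _ _ _ xK) Md|exact: close_norm l01 (hM _ _ _ xK) Md|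
    exact: close_norm l10 (hM _ _ _ yK) Md|exact: close_norm l11 (hM _ _ _ yK) Md|].
  have [_ /(_ _ _ xz yz) hdet _] := iso _ zs.
  rewrite distrC in l00; rewrite distrC in l01; rewrite distrC in l10; rewrite distrC in l11.
  have := det_close d1 l00 l01 l10 l11 (hM _ _ _ xK) (hM _ _ _ xK) (hM _ _ _ yK) (hM _ _ _ yK).
  set D := det x y in hdet *; set D' := A * B' - A' * B => hD.
  have d0 : 0 <= d by apply: le_trans l00.
  have u2D : u <= `|D| / 2.
    by rewrite ler_pdivlMr // mulrC; exact: le_trans urho hdet.
  apply: lower_half hD _ u2D; apply: le_trans (small2 d0) _.
  by apply: ler_wpM2r => //; apply: le_trans hdet; apply: le_trans urho; rewrite ler_peMl ?ler1n // ltW.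
Qed.
End Complete.

(** * Equilibria under orbit-preserving homeomorphisms *)

Section Trajectories.
Variable R : realType.
Notation pt := 'rV[R]_2.
Notation K := (K2 R).

Definition slope (phi : R -> pt) (t s : R) : pt := (s - t)^-1 *: (phi s - phi t).

Lemma slope_cvgP (J : set R) phi (t : R) (v : pt) :
  (slope phi t @ within (J `\ t) (nbhs t) --> v) <->
  (forall e : R, 0 < e -> exists2 r : R, 0 < r &
    forall s, J s -> s != t -> `|s - t| < r -> `|slope phi t s - v| < e).
Proof.
split=> [/cvgrPdist_lt cv e /cv|h].
  move=> /nbhs_ballP[r /= r0 hr]; exists r => // s Js st sr.
  rewrite distrC; apply: hr; last by split=> //; apply/eqP.
  by rewrite /ball /= distrC.
apply/cvgrPdist_lt => e /h[r r0 hr]; apply/nbhs_ballP; exists r => // s /= sr.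
move=> [Js /eqP st]; rewrite distrC; apply: hr => //.
by rewrite distrC; exact: sr.
Qed.

(** Two distinct times are required because the derivative condition is void on a single instant. *)
Lemma constant_solution f J phi (c : pt) a b :
  solution_in K f J phi -> J a -> J b -> a < b ->
  (forall t, J t -> phi t = c) -> f c = 0.
Proof.
move=> [iJ _ _ der] Ja Jb ab phic; have := der a Ja.
rewrite -/(slope phi a) phic // => /slope_cvgP h.
apply/eqP; rewrite -normr_le0; apply/ler_addgt0Pr => e e0; rewrite add0r.
have [r r0 hr] := h _ e0.
pose s := a + Num.min (r / 2) (b - a).
have s0 : 0 < Num.min (r / 2) (b - a) by rewrite lt_min divr_gt0 // subr_gt0.
have sr : Num.min (r / 2) (b - a) <= r / 2 by rewrite ge_min lexx.
have sb : Num.min (r / 2) (b - a) <= b - a by rewrite ge_min lexx orbT.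
have as_ : a < s by rewrite /s ltrDl.
have Js : J s by apply: (iJ a b) => //; rewrite (ltW as_) /s -lerBrDl.
have := hr s Js (negbT (gt_eqF as_)).
rewrite /s addrAC subrr add0r gtr0_norm //.
have rr : r / 2 < r by rewrite ltr_pdivrMr // ltr_pMr // ltr1n.
move=> /(_ (le_lt_trans sr rr)); rewrite /slope !phic // subrr scaler0 sub0r normrN.
exact: ltW.
Qed.

Lemma trajectory_const f x : K x -> f x = 0 -> trajectory_in K f setT (fun=> x).
Proof.
move=> xK fx; split; last by [].
split=> //; first by exists 0.
move=> t _; rewrite fx; apply/slope_cvgP => e e0; exists 1 => // s _ _ _.
by rewrite /slope !subrr scaler0 subrr normr0.
Qed.

(** The equilibrium is a trajectory defined for all times; its image stays at [h x], and [tau],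
    being strictly increasing, gives it two distinct times. *)
Lemma maps_zero f g h x : maps_trajectories K f g h ->
  K x -> f x = 0 -> g (h x) = 0.
Proof.
move=> hm xK fx.
have [J' [psi [tau [[sol _] tJ inc hpsi]]]] := hm _ _ (trajectory_const xK fx).
have Jt t : J' (tau t) by rewrite -tJ; exists t.
apply: (constant_solution sol (Jt 0) (Jt 1)); first exact: inc.
by move=> t; rewrite -tJ => -[u _ <-]; rewrite -hpsi.
Qed.

Section Maximal.
Variables (f : pt -> pt) (x : pt).
Hypothesis xK : K x.

Let sols := {p : set R * (R -> pt) | solution_in K f p.1 p.2 /\ p.1 0 /\ p.2 0 = x}.
Let extends (p q : set R * (R -> pt)) : Prop :=
  p.1 `<=` q.1 /\ forall t, p.1 t -> q.2 t = p.2 t.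
Let sols_le (p q : sols) : bool := `[< extends (sval p) (sval q) >].

Let trivial_sol : solution_in K f [set 0] (fun=> x).
Proof.
split=> //.
- by move=> a b /= -> -> z /andP[z0 z1]; apply/eqP; rewrite eq_le z0 z1.
- by exists 0.
- move=> t /= ->; apply/slope_cvgP => e e0; exists 1 => // s /= ->.
  by rewrite eqxx.
Qed.

Let chain_sup (A : set sols) : total_on A sols_le ->
  exists t : sols, forall s, A s -> sols_le s t.
Proof.
move=> tot.
have [[p0 Ap0]|A0] := pselect (A !=set0); last first.
  exists (exist _ ([set 0], fun=> x) (conj trivial_sol (conj erefl erefl))).
  by move=> s As; exfalso; apply: A0; exists s.
pose D := [set t | exists2 p, A p & (sval p).1 t].
pose phi t := if pselect (D t) is left h then (sval (s2val (cid2 h))).2 t else 0.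
have phiE p t : A p -> (sval p).1 t -> phi t = (sval p).2 t.
  move=> Ap pt_; rewrite /phi; case: pselect => [h|]; last by case; exists p.
  case: cid2 => q Aq qt /=.
  by have [/asboolP[_ ->]|/asboolP[_ ->]] := tot p q Ap Aq.
have join p q : A p -> A q -> exists2 r, A r &
    (sval p).1 `<=` (sval r).1 /\ (sval q).1 `<=` (sval r).1.
  move=> Ap Aq; have [/asboolP[pq _]|/asboolP[qp _]] := tot p q Ap Aq.
    by exists q => //; split.
  by exists p => //; split.
have sol : solution_in K f D phi.
  split.
  - move=> a b [p Ap pa] [q Aq qb] z zab; have [r Ar [pr_ qr]] := join p q Ap Aq.
    exists r => //; have [ [ir _ _ _] _] := svalP r.
    by apply: (ir a b) => //; [exact: pr_|exact: qr].
  - by exists 0, p0 => //; have [_ []] := svalP p0.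
  - move=> t [p Ap pt_]; rewrite (phiE p) //.
    by have [ [_ _ h _] _] := svalP p; exact: h.
  - move=> t [p Ap pt_].
    (* On each side of [t] the union coincides near [t] with a single member of the chain: either
       [D] has a point on that side, and a member containing it covers the interval in between, or
       [D] has nothing there. The derivative at [t] is then that of one member. *)
    have side (sg : R) p' : sg = 1 \/ sg = -1 -> A p' -> (sval p').1 t ->
        exists2 q, A q & (sval p').1 `<=` (sval q).1 /\ exists2 d : R, 0 < d &
          forall s, D s -> 0 < sg * (s - t) < d -> (sval q).1 s.
      move=> sgE Ap' p't.
      have [[s [q Aq qs] ts]|no] := pselect (exists2 s, D s & 0 < sg * (s - t)).
        have [r Ar [p'r qr]] := join p' q Ap' Aq; exists r => //; split=> //.
        exists (sg * (s - t)) => // u _ /andP[u0 us]; have [ [ir _ _ _] _] := svalP r.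
        have rs := qr _ qs; have rt := p'r _ p't.
        by case: sgE u0 us => ->; rewrite ?mul1r ?mulN1r => u0 us;
          [apply: (ir t s)|apply: (ir s t)] => //; apply/andP; split; lra.
      exists p' => //; split=> //; exists 1 => // s Ds /andP[s0 _].
      by case: no; exists s.
    have [q Aq [pq [d1 d10 hd1]]] := side 1 p (or_introl erefl) Ap pt_.
    have [r Ar [qr [d2 d20 hd2]]] := side (-1) q (or_intror erefl) Aq (pq _ pt_).
    have rt : (sval r).1 t by apply: qr; exact: pq.
    have [ [_ _ _ der] _] := svalP r.
    have := der t rt; rewrite -/(slope _ t) => /slope_cvgP h.
    have -> : f (phi t) = f ((sval r).2 t) by rewrite (phiE r).
    apply/slope_cvgP => e /h[d d0 hd].
    exists (Num.min d (Num.min d1 d2)); first by rewrite !lt_min d0 d10 d20.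
    move=> s Ds st; rewrite !lt_min => /and3P[sd /ltr_normlP[l1 l2] /ltr_normlP[l3 l4]].
    have rs : (sval r).1 s.
      have [ts|ts|e'] := ltgtP t s; last by rewrite e' eqxx in st.
        by apply: qr; apply: hd1 => //; rewrite mul1r subr_gt0 ts.
      by apply: hd2 => //; rewrite mulN1r oppr_gt0 subr_lt0 ts.
    by rewrite /slope (phiE r s) // (phiE r t) //; apply: hd.
have D0 : D 0 /\ phi 0 = x.
  have [_ [p00 px]] := svalP p0; split; first by exists p0.
  by rewrite (phiE p0).
exists (exist _ (D, phi) (conj sol D0)) => s As; apply/asboolP; split => /=.
  by move=> t st; exists s.
by move=> t st; exact: phiE.
Qed.

(** Zorn's lemma for extensions of solutions, starting from the solution on the single instant 0;
    this includes boundary points that a trajectory meets only once. *)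
Lemma maximal_solution :
  exists J phi, [/\ trajectory_in K f J phi, J 0 & phi 0 = x].
Proof.
have [|||p hp] := @ZL_preorder sols
  (exist _ ([set 0], fun=> x) (conj trivial_sol (conj erefl erefl))) sols_le.
- by move=> p; apply/asboolP; split.
- move=> r s t /asboolP[rs rs'] /asboolP[st st']; apply/asboolP; split.
    by move=> u ru; apply: st; exact: rs.
  by move=> u ru; rewrite st' ?rs' //; exact: rs.
- exact: chain_sup.
have [sol [J0 phi0]] := svalP p.
exists (sval p).1, (sval p).2; split=> //; split=> // J' phi' sol' JJ' ext.
have q0 : J' 0 /\ phi' 0 = x by split; [exact: JJ'|rewrite ext].
pose q : sols := exist _ (J', phi') (conj sol' q0).
have : sols_le p q by apply/asboolP; split.
by move=> /hp /asboolP[].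
Qed.
End Maximal.

Section Uniqueness.
Variables (g : pt -> pt) (y : pt) (L : R) (J : set R) (psi : R -> pt).
Hypotheses (L0 : 0 <= L) (lip : forall z, K z -> `|g z| <= L * `|z - y|).
Hypothesis sol : solution_in K g J psi.

(** The squared Euclidean distance to [y]; unlike the maximum norm, it is differentiable along the
    solution, with derivative [dw]. *)
Let w t : R := (psi t - y) 0 0 * (psi t - y) 0 0 + (psi t - y) 0 1 * (psi t - y) 0 1.
Let dw t : R := 2 * ((psi t - y) 0 0 * g (psi t) 0 0 + (psi t - y) 0 1 * g (psi t) 0 1).

Let w_ge0 t : 0 <= w t.
Proof. by rewrite /w addr_ge0 // -expr2 sqr_ge0. Qed.

(** With [N] the maximum norm of [psi t - y], each of the two products in [dw] is at most [L N^2],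
    and [N^2 <= w]; together with the factor 2 this makes 4. *)
Let dw_le t : J t -> `|dw t| <= 4 * L * w t.
Proof.
move=> Jt; have [_ _ hK _] := sol; have := lip (hK t Jt).
rewrite /dw /w; set a := (psi t - y) 0 0; set b := (psi t - y) 0 1.
set c := g _ 0 0; set d := g _ 0 1 => hg.
have hc : `|c| <= L * `|psi t - y| by apply: le_trans hg; exact: coord_norm_le.
have hd : `|d| <= L * `|psi t - y| by apply: le_trans hg; exact: coord_norm_le.
set N := `|psi t - y| in hc hd.
have N0 : 0 <= N by exact: normr_ge0.
have hN : N * N <= a * a + b * b.
  have [ab|ba] := lerP `|b| `|a|.
    have : N <= `|a| by apply/pt_norm_le; split.
    move=> Na; apply: le_trans (ler_pM N0 N0 Na Na) _.
    by rewrite -normrM ger0_norm -?expr2 ?sqr_ge0 // lerDl sqr_ge0.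
  have : N <= `|b| by apply/pt_norm_le; split; [exact: ltW|].
  move=> Na; apply: le_trans (ler_pM N0 N0 Na Na) _.
  by rewrite -normrM ger0_norm -?expr2 ?sqr_ge0 // lerDr sqr_ge0.
have ha : `|a| <= N by exact: coord_norm_le.
have hb : `|b| <= N by exact: coord_norm_le.
have h1 : `|a * c| <= L * (N * N).
  by rewrite normrM mulrCA; apply: ler_pM.
have h2 : `|b * d| <= L * (N * N).
  by rewrite normrM mulrCA; apply: ler_pM.
have h3 : L * (N * N) <= L * (a * a + b * b) by exact: ler_wpM2l.
rewrite normrM ger0_norm // -!mulrA.
apply: le_trans (ler_wpM2l _ (ler_normD _ _)) _ => //.
by move: h1 h2 h3; clear; lra.
Qed.

Let psi_derive t a b i : a < t < b -> (forall s, a < s < b -> J s) ->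
  is_derive t (1 : R) (fun s => psi s 0 i) (g (psi t) 0 i).
Proof.
move=> /andP[at_ tb] abJ; have [_ _ _ der] := sol.
have Jt : J t by apply: abJ; rewrite at_.
have /slope_cvgP h := der t Jt.
have cv : (fun h => h^-1 *: (psi (h *: 1 + t) 0 i - psi t 0 i)) @ 0^' -->
    g (psi t) 0 i.
  apply/cvgrPdist_lt => e /h[r r0 hr].
  have m0 : 0 < Num.min r (Num.min (t - a) (b - t)).
    by rewrite !lt_min r0 !subr_gt0 at_ tb.
  apply/nbhs_ballP; exists (Num.min r (Num.min (t - a) (b - t))) => // u.
  rewrite /ball /= sub0r normrN !lt_min => /and3P[ur ua ub] u0.
  have [k1 k2] := ler_normlP _ _ (lexx `|u|).
  have Js : J (u + t) by apply: abJ; apply/andP; split; lra.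
  have := hr _ Js; rewrite -subr_eq0 addrK => /(_ u0 ur) hh.
  have -> : u%:A + t = u + t by rewrite /GRing.scale /= mulr1.
  rewrite distrC; apply: le_lt_trans hh.
  have := coord_norm_le (slope psi t (u + t) - g (psi t)) i.
  by rewrite /slope !mxE addrK.
apply: DeriveDef; first by apply/cvg_ex; exists (g (psi t) 0 i).
exact: cvg_lim cv.
Qed.

Let psi_cont i t : J t -> (fun s => psi s 0 i) @ within J (nbhs t) --> psi t 0 i.
Proof.
move=> Jt; have [_ _ _ der] := sol; have /slope_cvgP h := der t Jt.
have [r r0 hr] := h 1 ltr01.
pose C := `|g (psi t)| + 1; have C0 : 0 < C by rewrite ltr_wpDl.
apply/cvgrPdist_lt => e e0.
have m0 : 0 < Num.min r (e / C) by rewrite lt_min r0 divr_gt0.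
apply/nbhs_ballP; exists (Num.min r (e / C)) => // s.
rewrite /ball /= distrC lt_min => /andP[sr se] Js.
have [->|st] := eqVneq s t; first by rewrite subrr normr0.
have hs := hr s Js st sr.
have sl : `|slope psi t s| < C.
  rewrite -[slope psi t s](subrKC (g (psi t))).
  by apply: le_lt_trans (ler_normD _ _) _; rewrite ltrD2l.
have st0 : s - t != 0 by rewrite subr_eq0.
have pE : psi s - psi t = (s - t) *: slope psi t s.
  by rewrite /slope scalerA divff // scale1r.
rewrite distrC; apply: le_lt_trans (_ : `|psi s - psi t| < _).
  by have := coord_norm_le (psi s - psi t) i; rewrite !mxE.
rewrite pE normrZ; apply: le_lt_trans (ler_wpM2l (normr_ge0 _) (ltW sl)) _.
by rewrite -ltr_pdivlMr.
Qed.

(* Gronwall: w e^{4 L t} is nondecreasing and w e^{- 4 L t} is nonincreasing. *)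
Let v (sg t : R) : R := w t * expR (sg * t).

Let v_derive sg t a b : a < t < b -> (forall s, a < s < b -> J s) ->
  is_derive t (1 : R) (v sg) ((dw t + sg * w t) * expR (sg * t)).
Proof.
move=> tab abJ.
have dP i : is_derive t (1 : R) (fun s => (psi s - y) 0 i) (g (psi t) 0 i).
  have -> : (fun s => (psi s - y) 0 i) = (fun s => psi s 0 i) - cst (y 0 i).
    by apply: funext => s; rewrite !mxE.
  have := is_deriveB (psi_derive i tab abJ) (is_derive_cst (y 0 i) t (1 : R)).
  by rewrite subr0.
have de : is_derive t (1 : R) (fun s => expR (sg * s)) (expR (sg * t) * sg).
  have dl : is_derive t (1 : R) (fun s : R => sg * s) sg.
    have := is_deriveZ sg (is_derive_id t (1 : R)).
    by rewrite /GRing.scale /= mulr1.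
  exact: is_derive1_comp (is_derive_expR (sg * t)) dl.
have dw0 := is_deriveD (is_deriveM (dP 0) (dP 0)) (is_deriveM (dP 1) (dP 1)).
have := is_deriveM dw0 de.
rewrite /GRing.scale /= => h; apply: is_derive_eq h _.
rewrite -/(w t) /dw /w; set a0 := (psi t - y) 0 0; set a1 := (psi t - y) 0 1.
set F := (X in X t * _); have -> : F t = a0 * a0 + a1 * a1 by [].
by ring.
Qed.

Let v_cont sg a b : (forall s, a <= s <= b -> J s) ->
  {within `[a, b], continuous (v sg)}.
Proof.
move=> abJ; apply/subspace_continuousP => t; rewrite /= in_itv /= => tab.
have Jt := abJ t tab.
have sub : within `[a, b] (nbhs t) `=>` within J (nbhs t).
  move=> P; apply: (@filterS _ (nbhs t)) => s hs.
  by rewrite /= in_itv /= => /abJ /hs.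
have ce : expR (sg * s) @[s --> within J (nbhs t)] --> expR (sg * t).
  apply: cvg_trans (_ : expR (sg * s) @[s --> t] --> _).
    by apply: cvg_app; exact: cvg_within.
  apply: continuous_comp; last exact: continuous_expR.
  exact: (cvgM (cvg_cst sg) cvg_id).
have cP i : (fun s => (psi s - y) 0 i) @ within J (nbhs t) --> (psi t - y) 0 i.
  have -> : (fun s => (psi s - y) 0 i) = (fun s => psi s 0 i - y 0 i).
    by apply: funext => s; rewrite !mxE.
  have -> : (psi t - y) 0 i = psi t 0 i - y 0 i by rewrite !mxE.
  exact: (cvgB (psi_cont (i := i) Jt) (cvg_cst (y 0 i))).
apply: cvg_trans (cvg_app _ sub) _.
exact: (cvgM (cvgD (cvgM (cP 0) (cP 0)) (cvgM (cP 1) (cP 1))) ce).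
Qed.

Let v_mono a b : a < b -> J a -> J b ->
  v (- (4 * L)) b <= v (- (4 * L)) a /\ v (4 * L) a <= v (4 * L) b.
Proof.
move=> ab Ja Jb; have [iJ _ _ _] := sol.
have abJ s : a <= s <= b -> J s by exact: (iJ a b).
have abJ' s : a < s < b -> J s by move=> /andP[h1 h2]; apply: abJ; rewrite !ltW.
have dv sg s : s \in `]a, b[%R -> is_derive s (1 : R) (v sg)
    ((dw s + sg * w s) * expR (sg * s)).
  by rewrite in_itv /= => st; apply: v_derive st abJ'.
have dw_itv s : s \in `]a, b[%R -> `|dw s| <= 4 * L * w s.
  by rewrite in_itv => st; apply: dw_le; exact: abJ'.
have aab : a \in `[a, b]%R by rewrite in_itv /= lexx ltW.
have bab : b \in `[a, b]%R by rewrite in_itv /= lexx ltW.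
split.
  apply: (ler0_derive1_le_cc (a := a) (b := b)) => //; try exact: v_cont.
  - by move=> s /(dv (- (4 * L)))[].
  - move=> s sin; rewrite derive1E; have [_ ->] := dv (- (4 * L)) s sin.
    rewrite pmulr_lle0 ?expR_gt0 // mulNr subr_le0.
    exact: le_trans (ler_norm _) (dw_itv s sin).
  - exact: ltW.
apply: (ger0_derive1_le_cc (a := a) (b := b)) => //; try exact: v_cont.
- by move=> s /(dv (4 * L))[].
- move=> s sin; rewrite derive1E; have [_ ->] := dv (4 * L) s sin.
  rewrite pmulr_lge0 ?expR_gt0 // -lerBlDr sub0r lerNl.
  by apply: le_trans (ler_norm _) _; rewrite normrN; exact: dw_itv.
- exact: ltW.
Qed.

Lemma equilibrium_solution t0 t : J t0 -> psi t0 = y -> J t -> psi t = y.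
Proof.
move=> J0 p0 Jt.
have w0 : w t0 = 0 by rewrite /w p0 subrr !mxE !mul0r addr0.
suff wt : w t <= 0.
  have : w t == 0 by rewrite eq_le wt w_ge0.
  rewrite /w paddr_eq0 -?expr2 ?sqr_ge0 // !sqrf_eq0 => /andP[/eqP h0 /eqP h1].
  by apply/eqP; rewrite -subr_eq0; apply/eqP; apply: ptP; rewrite [RHS]mxE.
have [lt|lt|<-] := ltgtP t0 t; last by rewrite w0.
  by have [] := v_mono lt J0 Jt; rewrite /v w0 mul0r pmulr_lle0 ?expR_gt0.
by have [_] := v_mono lt Jt J0; rewrite /v w0 mul0r pmulr_lle0 ?expR_gt0.
Qed.
End Uniqueness.
End Trajectories.

(** * Zeros under maps of trajectories, and smooth perturbations *)

Section Perturb.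
Variable R : realType.
Notation pt := 'rV[R]_2.
Notation K := (K2 R).
Implicit Types (f g : pt -> pt) (F G : pt -> R).

Lemma K2_convex (x y : pt) (t : R) : 0 <= t <= 1 -> K x -> K y -> K (y + t *: (x - y)).
Proof.
move=> /andP[t0 t1] /K2E x1 /K2E y1; apply/K2E.
have -> : y + t *: (x - y) = (1 - t) *: y + t *: x.
  by rewrite scalerBr scalerBl scale1r addrA addrAC.
apply: le_trans (ler_normD _ _) _; rewrite !normrZ (ger0_norm t0) ger0_norm ?subr_ge0 //.
have h1 : (1 - t) * `|y| <= 1 - t by rewrite ler_piMr // subr_ge0.
have h2 : t * `|x| <= t by rewrite ler_piMr.
by apply: le_trans (lerD h1 h2) _; rewrite subrK.
Qed.

Lemma C1_on_lipschitz g y : C1_on K g -> K y -> g y = 0 ->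
  exists2 L : R, 0 <= L & forall z, K z -> `|g z| <= L * `|z - y|.
Proof.
move=> Cg yK gy.
have [M M0 hM] := C1_bounded_uniform (fun i => C1_on_bounded i Cg).
exists (M + M); first by rewrite addr_ge0.
move=> z zK.
have seg (t : R) : 0 <= t <= 1 -> K (y + t *: (z - y)) by move=> ?; exact: K2_convex.
have comp i : `|g z 0 i| <= (M + M) * `|z - y|.
  have dseg (t : R) : 0 <= t <= 1 -> differentiable (fun x => g x 0 i) (y + t *: (z - y)).
    by move=> /seg /(C1_on_grad i Cg)[].
  have [t t01] := MVT_plane dseg; rewrite [in X in _ - X]gy [in X in _ - X]mxE subr0 => ->.
  apply: le_trans (ler_normD _ _) _; rewrite !normrM mulrDl.
  apply: lerD; rewrite mulrC; apply: ler_pM => //;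
    by [have [_] := hM i _ (seg _ t01)|exact: coord_norm_le].
by apply/pt_norm_le; split.
Qed.

(** The maximal trajectory of [f] through the preimage [x] of [y] is sent to a trajectory of [g]
    through [y]. By uniqueness the latter is constant, and being maximal it is defined for all
    times. Hence the former has two distinct times as well, and it is constant because [h] is
    injective. *)
Lemma maps_zero_surj f g h y : C1_on K g -> homeomorphism_on K h ->
  maps_trajectories K f g h -> K y -> g y = 0 ->
  exists x, [/\ K x, h x = y & f x = 0].
Proof.
move=> Cg [[hK hinj hsurj] _ _] hm yK gy.
have [x xK hx] := hsurj y yK; exists x; split=> //.
have [J [phi [trJ J0 phi0]]] := maximal_solution f xK.
have [J' [psi [tau [[sol mx] tJ inc hpsi]]]] := hm _ _ trJ.
have [L L0 lip] := C1_on_lipschitz Cg yK gy.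
have J'0 : J' (tau 0) by rewrite -tJ; exists 0.
have psi0 : psi (tau 0) = y by rewrite -hpsi // phi0.
have psic t : J' t -> psi t = y.
  exact: (equilibrium_solution L0 lip sol J'0 psi0).
have [solf _] := trJ.
have phic t : J t -> phi t = x.
  move=> Jt; have [_ _ phiK _] := solf; apply: hinj; rewrite ?inE //.
    exact: phiK.
  by rewrite hpsi // psic // -tJ; exists t.
have J'T : setT `<=` J'.
  have [sol' _] := trajectory_const yK gy.
  by apply: mx sol' _ _ => // t J't; rewrite psic.
have [a Ja ta] : (tau @` J) (0 : R) by rewrite tJ; exact: J'T.
have [b Jb tb] : (tau @` J) (1 : R) by rewrite tJ; exact: J'T.
have [ab|ba|ab] := ltgtP a b.
- exact: (constant_solution solf Ja Jb ab phic).
- exact: (constant_solution solf Jb Ja ba phic).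
- by have := oner_neq0 R; rewrite -tb -ab ta eqxx.
Qed.

Definition smooth F : Prop := exists a b : pt -> R,
  [/\ forall x, is_grad F x (a x) (b x), continuous a & continuous b].

Lemma smooth_differentiable F : smooth F -> forall x, differentiable F x.
Proof. by move=> [a [b [h _ _]]] x; case: (h x). Qed.

Lemma smooth_continuous F : smooth F -> continuous F.
Proof. by move=> h x; apply: differentiable_continuous; exact: smooth_differentiable. Qed.

Lemma smooth_cst c : smooth (cst c).
Proof.
exists (cst 0), (cst 0); split; [exact: is_grad_cst|exact: cst_continuous..].
Qed.

Lemma smooth_coord i : smooth (fun x => x 0 i).
Proof.
exists (cst (i == 0)%:R), (cst (i == 1)%:R).
split; [|exact: cst_continuous..].
by move=> x; case: (ord2P i) => ->; [exact: is_grad_coord0|exact: is_grad_coord1].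
Qed.

Lemma smoothD F G : smooth F -> smooth G -> smooth (fun x => F x + G x).
Proof.
move=> [a [b [h ca cb]]] [c [d [k cc cd]]].
exists (fun x => a x + c x), (fun x => b x + d x); split.
- by move=> x; exact: is_gradD.
- by move=> x; exact: cvgD (ca x) (cc x).
- by move=> x; exact: cvgD (cb x) (cd x).
Qed.

Lemma smoothM F G : smooth F -> smooth G -> smooth (fun x => F x * G x).
Proof.
move=> hF hG; have cF := smooth_continuous hF; have cG := smooth_continuous hG.
move: hF hG => [a [b [h ca cb]]] [c [d [k cc cd]]].
exists (fun x => F x * c x + G x * a x), (fun x => F x * d x + G x * b x); split.
- by move=> x; exact: is_gradM.
- by move=> x; exact: cvgD (cvgM (cF x) (cc x)) (cvgM (cG x) (ca x)).
- by move=> x; exact: cvgD (cvgM (cF x) (cd x)) (cvgM (cG x) (cb x)).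
Qed.

Lemma smoothX F n : smooth F -> smooth (fun x => F x ^+ n).
Proof.
move=> hF; elim: n => [|n IH].
  have -> : (fun x => F x ^+ 0) = cst 1 by apply: funext => x; rewrite expr0.
  exact: smooth_cst.
have -> : (fun x => F x ^+ n.+1) = (fun x => F x * F x ^+ n).
  by apply: funext => x; rewrite exprS.
exact: smoothM.
Qed.

Lemma smooth_polyf P : smooth (polyf P).
Proof.
have h1 p : smooth (fun x : pt => (dual1 0 +%R *%R (x 0 0) p).1).
  elim: p => [|c p IH]; first exact: smooth_cst.
  exact: (smoothD (smooth_cst c) (smoothM (smooth_coord 0) IH)).
elim: P => [|p P IH]; first exact: smooth_cst.
exact: (smoothD (h1 p) (smoothM (smooth_coord 1) IH)).
Qed.

Lemma smooth_bounded F : smooth F -> C1_bounded F.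
Proof.
move=> hF; have cF := smooth_continuous hF; case: hF => a [b [h ca cb]].
have [M0 h0] := compact_bounded_fun (fun x _ => cF x).
have [M1 h1] := compact_bounded_fun (fun x _ => ca x).
have [M2 h2] := compact_bounded_fun (fun x _ => cb x).
exists (Num.max M0 (Num.max M1 M2)) => x xK; have [_ -> ->] := h x.
by split; rewrite !le_max ?h0 ?h1 ?h2 ?orbT.
Qed.

Lemma mx22_norm_le (A : 'M[R]_2) (c : R) : 0 <= c ->
  (forall i j, `|A i j| <= c) -> `|A| <= c.
Proof.
move=> c0 h; rewrite [`|A|]/Num.Def.normr /= mx_normrE.
by apply: bigmax_le => // -[i j] _; exact: h.
Qed.

Lemma cvg_mx22 (A : pt -> 'M[R]_2) x :
  (forall i j, {for x, continuous (fun y => A y i j)}) -> {for x, continuous A}.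
Proof.
move=> h; rewrite /prop_for /continuous_at; apply/(@cvgrPdist_le _ _ _ (nbhs x)) => e e0.
have [r r0 hr] : exists2 r, 0 < r & forall ij, ij \in enum {: 'I_2 * 'I_2} ->
    forall y, `|y - x| <= r -> `|A y ij.1 ij.2 - A x ij.1 ij.2| <= e.
  apply: uniform_radius => [ij r r' hr _ rr y xy|[i j] _].
    by apply: hr; exact: le_trans xy rr.
  exact: (continuous_radius (h i j) e0).
apply/nbhs_ballP; exists r => // y; rewrite -ball_normE /ball_ /= => xy.
apply: mx22_norm_le; first exact: ltW.
move=> i j; rewrite !mxE distrC; apply: (hr (i, j)); first by rewrite mem_enum.
by rewrite distrC ltW.
Qed.

Lemma smooth_C1_on g : (forall i, smooth (fun x => g x 0 i)) -> C1_on K g.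
Proof.
move=> hg; exists setT; split=> // [|x _]; first exact: openT.
have dg y : differentiable g y.
  have -> : g = (fun y => g y 0 0 *: unitv R 0) + (fun y => g y 0 1 *: unitv R 1).
    by apply: funext => z; exact: pt_basis.
  by apply: differentiableD; apply: differentiableZl; exact: smooth_differentiable.
split=> //; apply: cvg_mx22 => l i.
have [a [b [h ca cb]]] := hg i.
have -> : (fun y => jacobian g y l i) = if l == 0 then a else b.
  apply: funext => y; rewrite -pd_coord //; have [_ h0 h1] := h y.
  by case: (ord2P l) => ->.
by case: ifP => _; [exact: ca|exact: cb].
Qed.

Lemma jacobianE f x i j : jacobian f x i j = pd i f x 0 j.
Proof. by rewrite /jacobian mxE. Qed.

Lemma jacobianB f g x : differentiable f x -> differentiable g x ->
  jacobian (f \- g) x = jacobian f x - jacobian g x.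
Proof.
have subE n m (A B : 'M[R]_(n, m)) i j : (A - B) i j = A i j - B i j by rewrite !mxE.
move=> df dg; have e : 'd (f \- g) x = 'd f x \- 'd g x :> (pt -> pt) := diffB df dg.
apply/matrixP => i j; apply: etrans (jacobianE (f \- g) x i j) _.
apply/esym; apply: etrans (subE _ _ _ _ _ _) _.
apply: etrans (congr2 (fun a b : R => a - b) (jacobianE f x i j) (jacobianE g x i j)) _.
have pdB : pd i (f \- g) x = pd i f x - pd i g x := congr1 (@^~ (unitv R i)) e.
by apply/esym; apply: etrans (congr1 (fun A : pt => A 0 j) pdB) (subE _ _ _ _ _ _).
Qed.

Lemma C1_onB f g : C1_on K f -> C1_on K g -> C1_on K (f \- g).
Proof.
move=> [U [oU KU hU]] [V [oV KV hV]]; exists (U `&` V); split.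
- exact: openI.
- by move=> x xK; split; [exact: KU|exact: KV].
move=> x [Ux Vx]; have [df cf] := hU _ Ux; have [dg cg] := hV _ Vx.
split; first exact: differentiableB.
have nUV : nbhs x (U `&` V) by apply: open_nbhs_nbhs; split=> //; exact: openI.
have eJ : \forall y \near x, jacobian f y - jacobian g y = jacobian (f \- g) y.
  apply: filterS nUV => y [Uy Vy]; have [dfy _] := hU _ Uy; have [dgy _] := hV _ Vy.
  by rewrite jacobianB.
have e0 : jacobian (f \- g) x = jacobian f x - jacobian g x by rewrite jacobianB.
rewrite /prop_for /continuous_at e0.
exact: cvg_trans (near_eq_cvg eJ) (cvgB cf cg).
Qed.

(** One [a] for the values and one for each partial derivative, whose norms add up to a bound of the
    operator norm. The perturbations below take [a = eps / 6], which gives half of [eps]. *)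
Lemma C1norm_sub_le f g (a : R) : C1_on K f -> C1_on K g ->
  (forall i, C1_close a (fun x => f x 0 i) (fun x => g x 0 i)) ->
  C1norm K (f \- g) <= a + (a + a).
Proof.
move=> Cf Cg h; apply: C1norm_le => x xK.
  by apply/pt_norm_le; rewrite !mxE; split; [case: (h 0 x xK)|case: (h 1 x xK)].
have subE n m (A B : 'M[R]_(n, m)) i j : (A - B) i j = A i j - B i j by rewrite !mxE.
have hl l : `|pd l (f \- g) x| <= a.
  have df := C1_on_diff Cf xK; have dg := C1_on_diff Cg xK.
  have E i : pd l (f \- g) x 0 i = pd l (fun y => f y 0 i) x - pd l (fun y => g y 0 i) x.
    rewrite (pd_coord i l df) (pd_coord i l dg) -(jacobianE (f \- g) x l i).
    by rewrite jacobianB //; exact: subE.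
  by apply/pt_norm_le; rewrite !E; split; [case: (h 0 x xK)|case: (h 1 x xK)].
exact: lerD.
Qed.
End Perturb.

(** * Zeros of structurally stable systems *)

Section FiniteSystem.
Variable R : realType.
Notation pt := 'rV[R]_2.

Lemma finite_roots (q : {poly R}) : q != 0 -> finite_set [set y | root q y].
Proof.
move=> q0; apply: contrapT => /(infinite_set_fset (size q)) [B sub sz].
have := max_poly_roots q0 (rs := finmap.enum_fset B).
rewrite ltnNge sz => /(_ _ (finmap.fset_uniq B)) h.
suff /h : all (root q) (finmap.enum_fset B) by [].
by apply/allP => y yB; exact: sub.
Qed.

Section Span.
Variables (a : nat) (Z : set pt).
Definition mono (i j : nat) (x : pt) : R := x 0 0 ^+ i * x 0 1 ^+ j.
Let basis (x : pt) : 'rV[R]_(a * a) := mxvec (\matrix_(i < a, j < a) mono i j x).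
(** Equality is asked on [Z] only: this is the span of finitely many monomials among the functions
    on [Z], where the equations defining [Z] may be used to rewrite. *)
Definition spanned (F : pt -> R) : Prop :=
  exists c : 'rV[R]_(a * a), forall x, Z x -> F x = (c *m (basis x)^T) 0 0.

Lemma eq_spanned F G : (forall x, Z x -> F x = G x) -> spanned G -> spanned F.
Proof. by move=> FG [c hc]; exists c => x Zx; rewrite FG // hc. Qed.

Lemma spanned0 : spanned (fun=> 0).
Proof. by exists 0 => x _; rewrite mul0mx mxE. Qed.

Lemma spannedD F G : spanned F -> spanned G -> spanned (fun x => F x + G x).
Proof.
by move=> [c hc] [d hd]; exists (c + d) => x Zx; rewrite mulmxDl mxE hc // hd.
Qed.

Lemma spannedZ k F : spanned F -> spanned (fun x => k * F x).
Proof.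
by move=> [c hc]; exists (k *: c) => x Zx; rewrite -scalemxAl mxE hc.
Qed.

Lemma spanned_mono i j : (i < a)%N -> (j < a)%N -> spanned (mono i j).
Proof.
move=> ia ja; exists (delta_mx 0 (mxvec_index (Ordinal ia) (Ordinal ja))) => x _.
by rewrite -rowE !mxE mxvecE mxE.
Qed.

(** The powers [G^0, ..., G^(a^2)] are one more than the [a^2] spanning monomials, so the matrix of
    their coordinates has a nonzero row in its left kernel, and this row lists the coefficients of
    [q]. *)
Lemma spanned_root (G : pt -> R) : (forall i : nat, spanned (fun x => G x ^+ i)) ->
  exists2 q : {poly R}, q != 0 & forall x, Z x -> root q (G x).
Proof.
move=> /choice [c hc]; pose n := (a * a)%N.
pose A : 'M[R]_(n.+1, n) := \matrix_i c i.
have : kermx A != 0.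
  rewrite kermx_eq0 /row_free; apply: contraTneq (rank_leq_col A) => ->.
  by rewrite ltnn.
move=> /rowV0Pn[u /sub_kermxP uA u0].
exists (\poly_(i < n.+1) u 0 (inord i)).
  apply: contra u0 => /eqP q0; apply/eqP/rowP => i; rewrite mxE.
  have := coef_poly n.+1 (fun i => u 0 (inord i)) i.
  by rewrite q0 coef0 ltn_ord inord_val.
move=> x Zx; rewrite /root horner_poly.
have z : (u *m A *m (basis x)^T) 0 0 = 0 by rewrite uA mul0mx mxE.
rewrite -mulmxA mxE in z; rewrite -[X in _ == X]z.
apply/eqP; apply: eq_bigr => i _; rewrite inord_val.
congr (_ * _); rewrite hc // [RHS]mxE [LHS]mxE.
by apply: eq_bigr => j _; rewrite !mxE.
Qed.

(* Degrees are measured by the lengths of the coefficient lists. *)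
Lemma spanned_polyf (b n k l : nat) (P : seq (seq R)) :
  (forall i j, (i + j < n)%N -> spanned (mono i j)) ->
  all (fun p => size p <= b)%N P -> (k + l + size P + b <= n)%N ->
  spanned (fun x => mono k l x * polyf P x).
Proof.
move=> hn.
have h1 k' l' p : (k' + l' + size p <= n)%N ->
    spanned (fun x => mono k' l' x * (dual1 0 +%R *%R (x 0 0) p).1).
  elim: p k' => [|c p IH] k' /= hs.
    by apply: eq_spanned spanned0 => x _; rewrite mulr0.
  have s1 : spanned (mono k' l') by apply: hn; lia.
  have hs' : (k'.+1 + l' + size p <= n)%N by rewrite !addSn -addnS.
  have s2 := IH k'.+1 hs'.
  apply: eq_spanned (spannedD (spannedZ c s1) s2) => x _.
  by rewrite /mono exprS; ring.
elim: P l => [|p P IH] l /=.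
  by move=> _ _; apply: eq_spanned spanned0 => x _; rewrite /polyf mulr0.
move=> /andP[pb Pb] hs.
have hs1 : (k + l + size p <= n)%N.
  by apply: leq_trans hs; apply: leq_add pb; rewrite leq_addr.
have hs2 : (k + l.+1 + size P + b <= n)%N by rewrite addnS addSn -addnS.
have s1 := h1 k l p hs1; have s2 := IH l.+1 Pb hs2.
apply: eq_spanned (spannedD s1 s2) => x _.
by rewrite /polyf /polyv /= /mono exprS; ring.
Qed.
End Span.

(* On the zeros every monomial is a combination of those with exponents below a,
   so the powers of each coordinate are linearly dependent. *)
Lemma finite_system (P0 P1 : seq (seq R)) (b a : nat) (d : R) : d != 0 ->
  all (fun p => size p <= b)%N P0 -> all (fun p => size p <= b)%N P1 ->
  (size P0 + b < a)%N -> (size P1 + b < a)%N ->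
  finite_set [set x : pt | polyf P0 x + d * x 0 0 ^+ a = 0 /\
                           polyf P1 x + d * x 0 1 ^+ a = 0].
Proof.
move=> d0 hb0 hb1 ha0 ha1; set Z := [set x | _].
have all_mono n i j : (i + j < n)%N -> spanned a Z (mono i j).
  (* On [Z] the power [x^a] of the first coordinate equals [- P0 / d]. As [size P0 + b < a], all
     terms of [P0] have total degree below [a], so the replacement lowers the total degree of the
     monomial; likewise for the second coordinate with [P1]. *)
  elim: n i j => // n IH i j ijn.
  have [ia|ia] := ltnP i a; last first.
    apply: eq_spanned (spannedZ (- d^-1) (@spanned_polyf a Z b n (i - a) j P0 IH hb0 _)); last by lia.
    move=> x [h _]; have {}h : polyf P0 x = - (d * x 0 0 ^+ a).
      by apply/eqP; rewrite -addr_eq0; apply/eqP.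
    rewrite h /mono -{1}(subnK ia) exprD.
    rewrite (_ : - d^-1 * _ = (d^-1 * d) * (x 0 0 ^+ (i - a) * x 0 0 ^+ a * x 0 1 ^+ j)); last by ring.
    by rewrite mulVf // mul1r.
  have [ja|ja] := ltnP j a; first exact: spanned_mono.
  apply: eq_spanned (spannedZ (- d^-1) (@spanned_polyf a Z b n i (j - a) P1 IH hb1 _)); last by lia.
  move=> x [_ h]; have {}h : polyf P1 x = - (d * x 0 1 ^+ a).
    by apply/eqP; rewrite -addr_eq0; apply/eqP.
  rewrite h /mono -{1}(subnK ja) exprD.
  rewrite (_ : - d^-1 * _ = (d^-1 * d) * (x 0 0 ^+ i * (x 0 1 ^+ (j - a) * x 0 1 ^+ a))); last by ring.
  by rewrite mulVf // mul1r.
have [q0 q00 h0] : exists2 q : {poly R}, q != 0 & forall x : pt, Z x -> root q (x 0 0).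
  apply: (spanned_root (a := a)) => i.
  apply: eq_spanned (all_mono i.+1 i 0%N ltac:(by rewrite addn0)) => x _.
  by rewrite /mono expr0 mulr1.
have [q1 q10 h1] : exists2 q : {poly R}, q != 0 & forall x : pt, Z x -> root q (x 0 1).
  apply: (spanned_root (a := a)) => i.
  apply: eq_spanned (all_mono i.+1 0%N i ltac:(by rewrite add0n)) => x _.
  by rewrite /mono expr0 mul1r.
apply: (@sub_finite_set _ _ ((fun p : R * R => mkpt p.1 p.2) @`
   ([set y | root q0 y] `*` [set y | root q1 y]))).
  move=> x Zx; exists (x 0 0, x 0 1); first by split; [exact: h0|exact: h1].
  by apply: ptP; rewrite /= ?mkpt0 ?mkpt1.
by apply: finite_image; apply: finite_setX; exact: finite_roots.
Qed.
End FiniteSystem.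

(** * Finiteness of the set of zeros *)

Section StableFinite.
Variable R : realType.
Notation pt := 'rV[R]_2.
Notation K := (K2 R).
Variables (f : pt -> pt) (P : nat -> 'I_2 -> {poly {poly rat}}).
Hypothesis fS : stable_systems K f.
Hypothesis fP : is_C1_name K f P.

Lemma stable_finite : finite_set (zeros K f).
Proof.
have [Cf [eps eps0 stab]] := fS.
have [k hk] := pow_half_small (divr_gt0 eps0 (ltr0n R 12)).
pose Q i := coefs_val R (coefs_of_poly (P k i)).
pose b := foldr maxn 0%N (map size (Q 0) ++ map size (Q 1)).
have le_b s n : n \in s -> (n <= foldr maxn 0%N s)%N.
  elim: s => //= m s IH; rewrite inE => /predU1P[->|/IH h]; first exact: leq_maxl.
  exact: leq_trans h (leq_maxr _ _).
have hb i : all (fun p => size p <= b)%N (Q i).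
  apply/allP => p pQ; apply: le_b; rewrite mem_cat.
  by case: (ord2P i) pQ => -> pQ; rewrite (map_f size pQ) ?orbT.
(* [a] exceeds the total degrees of both polynomials, as [finite_system] requires. *)
pose a := (size (Q 0) + size (Q 1) + b).+1.
have spow i : smooth (fun x : pt => x 0 i ^+ a) by apply: smoothX; exact: smooth_coord.
have [M M0 hM] := C1_bounded_uniform (fun i => smooth_bounded (spow i)).
pose C := M + 1; have C0 : 0 < C by rewrite ltr_wpDl.
have MC w : w <= M -> w <= C by move=> wM; apply: le_trans wM _; rewrite lerDl.
(* [C] dominates [x^a] and its partial derivatives on the ball, so the added term costs at most
   [eps / 12]; the polynomial costs another [eps / 12], and the sum is the [eps / 6] wanted by
   [C1norm_sub_le]. *)
pose d := eps / 12 / C.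
have d0 : 0 < d by rewrite !divr_gt0.
pose gi i := fun x : pt => polyf (Q i) x + d * x 0 i ^+ a.
pose g : pt -> pt := fun x => mkpt (gi 0 x) (gi 1 x).
have gE i : (fun x => g x 0 i) = gi i.
  by apply: funext => x; case: (ord2P i) => ->; rewrite ?mkpt0 ?mkpt1.
have sg i : smooth (gi i).
  apply: smoothD; first exact: smooth_polyf.
  exact: (smoothM (smooth_cst d) (spow i)).
have Cg : C1_on K g by apply: smooth_C1_on => i; rewrite gE.
have dC : d * C = eps / 12 by rewrite /d divfK // gt_eqF.
have close : C1norm K (f \- g) < eps.
  apply: le_lt_trans (_ : eps / 6 + (eps / 6 + eps / 6) < eps); last by lra.
  apply: C1norm_sub_le => // i x xK.
  have [c0 c1] := name_close Cf (lt_trans (fP k i) hk) xK.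
  have [m0 m1] := hM i x xK.
  have tri (u v w : R) : `|u - v| <= eps / 12 -> `|w| <= M -> `|u - (v + d * w)| <= eps / 6.
    move=> h1 h2; rewrite opprD addrA; apply: le_trans (ler_normB _ _) _.
    have h3 : `|d * w| <= eps / 12.
      by rewrite normrM gtr0_norm // -dC ler_wpM2l ?MC // ltW.
    by apply: le_trans (lerD h1 h3) _; lra.
  rewrite gE -[g x 0 i]/((fun x => g x 0 i) x) gE; split; first exact: tri.
  move=> l.
  have -> : pd l (gi i) x = pd l (polyf (Q i)) x + d * pd l (fun x : pt => x 0 i ^+ a) x.
    have g1 : is_grad (polyf (Q i)) x (pd 0 (polyf (Q i)) x) (pd 1 (polyf (Q i)) x).
      by split=> //; exact: smooth_differentiable (smooth_polyf _) _.
    have g2 : is_grad (fun x : pt => x 0 i ^+ a) x (pd 0 (fun x : pt => x 0 i ^+ a) x)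
        (pd 1 (fun x : pt => x 0 i ^+ a) x).
      by split=> //; exact: smooth_differentiable (spow i) _.
    have [_ e0 e1] := is_gradD g1 (is_gradM (is_grad_cst d x) g2).
    by case: (ord2P l) => ->; rewrite ?e0 ?e1 mulr0 addr0.
  by apply: tri; [exact: c1|exact: m1].
have [h [[hbij _ [k' [_ hk']]] hm]] := stab g Cg close.
have fin : finite_set (zeros K g).
  apply: sub_finite_set (finite_system (a := a) (lt0r_neq0 d0) (hb 0) (hb 1) _ _); last 2 first.
  - by rewrite /a ltnS -addnA leq_add2l leq_addl.
  - by rewrite /a ltnS leq_add2r leq_addl.
  by move=> x [_ gx]; have := congr1 (fun v : pt => v 0 0) gx;
    have := congr1 (fun v : pt => v 0 1) gx; rewrite /= mkpt0 mkpt1 !mxE.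
apply: sub_finite_set (finite_image k' fin) => x [xK fx].
exists (h x); last exact: hk'.
by split; [case: hbij => hK _ _; exact: hK|exact: maps_zero hm xK fx].
Qed.
End StableFinite.

(** * Contraction of the argument *)

Section Scale.
Variable R : realType.
Notation pt := 'rV[R]_2.
Notation K := (K2 R).

Lemma diff_scale (f : pt -> pt) (c : R) (x u : pt) : differentiable f (c *: x) ->
  differentiable (f \o *:%R c : pt -> pt) x /\
  'd (f \o *:%R c : pt -> pt) x u = c *: 'd f (c *: x) u.
Proof.
move=> df.
have dc : differentiable ( *:%R c : pt -> pt) x by have [] := is_diff_scaler c x.
have vc : 'd ( *:%R c : pt -> pt) x u = c *: u.
  by have [_ ->] := is_diff_scaler c x.
split; first exact: (differentiable_comp dc df).
have e := congr1 (@^~ u) (diff_comp dc df).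
apply: etrans e _.
apply: etrans (congr1 ('d f (c *: x)) vc) _.
exact: linearZ.
Qed.

Lemma pd_scale (f : pt -> pt) (c : R) (x : pt) l : differentiable f (c *: x) ->
  differentiable (fun y : pt => f (c *: y) : pt) x /\
  pd l (fun y : pt => f (c *: y) : pt) x = c *: pd l f (c *: x).
Proof. by move=> df; exact: diff_scale. Qed.

Lemma pd_scale_coord (f : pt -> pt) (c : R) (x : pt) i l :
  differentiable f (c *: x) ->
  pd l (fun y : pt => f (c *: y) 0 i) x = c * pd l (fun y => f y 0 i) (c *: x).
Proof.
move=> df; have [dg eg] := pd_scale l df.
have zE (A : pt) : (c *: A) 0 i = c * A 0 i by rewrite mxE.
apply: etrans (pd_coord i l dg) _; apply: etrans (jacobianE _ _ _ _) _.
apply: etrans (congr1 (fun A : pt => A 0 i) eg) _.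
apply: etrans (zE _) _; congr (c * _); apply/esym.
apply: etrans (pd_coord i l df) _; exact: jacobianE.
Qed.

Lemma K2_scale (c : R) (x : pt) : 0 <= c <= 1 -> K x -> K (c *: x).
Proof.
move=> /andP[c0 c1] /K2E x1; apply/K2E; rewrite normrZ ger0_norm //.
by rewrite mulr_ile1.
Qed.

Lemma C1_on_scale f (c : R) : 0 <= c <= 1 -> C1_on K f ->
  C1_on K (fun x => f (c *: x)).
Proof.
move=> c01 [U [oU KU hU]].
exists (( *:%R c : pt -> pt) @^-1` U); split.
- by apply: open_comp => // x _; exact: scaler_continuous.
- by move=> x /(K2_scale c01) /KU.
have jE x : U (c *: x) -> jacobian (fun x => f (c *: x)) x = c *: jacobian f (c *: x).
  move=> /hU[df _]; have zE (A : 'M[R]_2) i j : (c *: A) i j = c * A i j by rewrite mxE.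
  have zE' (A : pt) i j : (c *: A) i j = c * A i j by rewrite mxE.
  apply/matrixP => i j; apply: etrans (jacobianE _ _ _ _) _.
  have [_ e] := pd_scale i df.
  apply: etrans (congr1 (fun A : pt => A 0 j) e) _.
  apply: etrans (zE' _ _ _) _; apply/esym; apply: etrans (zE _ _ _) _.
  by congr (_ * _); exact: jacobianE.
move=> x Ux; have [df cJ] := hU _ Ux; split; first by case: (pd_scale 0 df).
have nU : nbhs x (( *:%R c : pt -> pt) @^-1` U).
  apply: open_nbhs_nbhs; split => //.
  by apply: open_comp => // z _; exact: scaler_continuous.
have eJ : \forall y \near x, c *: jacobian f (c *: y) = jacobian (fun x => f (c *: x)) y.
  by apply: filterS nU => y Uy; rewrite jE.
have cs : {for x, continuous ( *:%R c : pt -> pt)} by exact: scaler_continuous.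
have cJ' : c *: jacobian f (c *: y) @[y --> x] --> c *: jacobian f (c *: x).
  have cc : jacobian f (c *: y) @[y --> x] --> jacobian f (c *: x) by apply: cvg_trans cJ; exact: cvg_app cs.
  exact: (cvgZl_tmp cc).
have ex := jE x Ux.
suff : jacobian (fun x => f (c *: x)) y @[y --> x] --> c *: jacobian f (c *: x).
  by rewrite -ex.
exact: cvg_trans (near_eq_cvg eJ) cJ'.
Qed.

Lemma scale_dist (x0 eta : R) : `|x0| <= 1 -> 0 <= eta -> `|x0 - (1 - eta) * x0| <= eta.
Proof.
move=> h e0; rewrite (_ : x0 - _ = eta * x0); last by ring.
by rewrite normrM (ger0_norm e0) ler_piMr.
Qed.

Lemma sixths (e : R) : 0 < e -> e / 6 + (e / 6 + e / 6) < e.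
Proof. by move=> e0; lra. Qed.

(** Compares [f] with its contraction through a polynomial [p] of the name: [a], [b], [c], [d] stand
    for [f x], [p x], [p y], [f y] with [y] the contracted point, or for partial derivatives there.
    The middle step uses the Lipschitz bound of [p]. The factor [1 - e2] in the second conclusion is
    the one that the chain rule puts on derivatives. *)
Lemma chain4 (a b c d e1 e2 q : R) : `|a - b| <= e1 -> `|b - c| <= e1 ->
  `|d - c| <= e1 -> `|e2 * d| <= e1 -> 4 * e1 <= q ->
  `|a - d| <= q /\ `|a - (1 - e2) * d| <= q.
Proof.
move=> h1 h2 h3 h4 h5.
have e0 : 0 <= e1 by exact: le_trans h1.
have k1 : `|a - d| <= 3 * e1.
  rewrite (_ : a - d = (a - b) + (b - c) - (d - c)); last by ring.
  apply: le_trans (ler_normB _ _) _; apply: le_trans (lerD (ler_normD _ _) (lexx _)) _.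
  lra.
split; first by lra.
rewrite (_ : a - _ = (a - d) + e2 * d); last by ring.
by apply: le_trans (ler_normD _ _) _; lra.
Qed.

End Scale.

(** * Zeros of a stable system are interior and regular *)

Section Stable.
Variable R : realType.
Notation pt := 'rV[R]_2.
Notation K := (K2 R).
Variables (f : pt -> pt) (P : nat -> 'I_2 -> {poly {poly rat}}).
Hypothesis fS : stable_systems K f.
Hypothesis fP : is_C1_name K f P.
Variable s : seq pt.
Hypothesis uniq_s : uniq s.
Hypothesis zeros_s : zeros K f = [set` s].

Let zero_s z : (z \in s) <-> K z /\ f z = 0.
Proof.
have e : [set` s] z = zeros K f z by rewrite zeros_s.
by split=> [zs|Kz]; [rewrite -[_ /\ _]/(zeros K f z) -e|rewrite -[is_true _]/([set` s] z) e].
Qed.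

(* Each zero of f is 1 - eta times a zero of x |-> f ((1 - eta) x) in K, since
   otherwise the latter map would have fewer zeros in K than f. *)
Lemma stable_interior z : z \in s -> `|z| < 1.
Proof.
move=> zs; rewrite ltNge; apply/negP => z1.
have [Cf [eps eps0 stab]] := fS.
have [k hk] := pow_half_small (divr_gt0 eps0 (ltr0n R 24)).
pose Q i := coefs_val R (coefs_of_poly (P k i)).
have [M M0 hM] := C1_bounded_uniform (fun i => C1_on_bounded i Cf).
pose C := rbound2 (Q 0) + rbound2 (Q 1) + M + 1.
have r0 := rbound2_ge0 (Q 0); have r1 := rbound2_ge0 (Q 1).
have C1 : 1 <= C by rewrite lerDr !addr_ge0.
have C0 : 0 < C by exact: lt_le_trans C1.
pose eta := Num.min (1 / 2) (eps / 24 / C).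
have eta0 : 0 < eta by rewrite lt_min !divr_gt0.
have eta2 : eta <= 1 / 2 by rewrite ge_min lexx.
have etaC : C * eta <= eps / 24.
  by rewrite mulrC -ler_pdivlMr // ge_min lexx orbT.
have small (a : R) : a <= C -> a * eta <= eps / 24.
  by move=> aC; apply: le_trans etaC; rewrite ler_wpM2r // ltW.
have rC i : rbound2 (Q i) <= C by case: (ord2P i) => ->; rewrite /C; lra.
have MC w : w <= M -> w <= C by rewrite /C; lra.
have c01 : 0 <= 1 - eta <= 1 by clear -eta0 eta2; apply/andP; split; lra.
pose g (x : pt) : pt := f ((1 - eta) *: x).
have Cg : C1_on K g by exact: C1_on_scale.
have close : C1norm K (f \- g) < eps.
  apply: le_lt_trans (sixths eps0).
  apply: C1norm_sub_le => // i x xK; set y := (1 - eta) *: x.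
  have yK : K y by exact: K2_scale.
  have [c0 c1] := name_close Cf (lt_trans (fP k i) hk) xK.
  have [d0 d1] := name_close Cf (lt_trans (fP k i) hk) yK.
  have /K2P[x0 x1] := xK; have /K2P[y0 y1] := yK.
  have dist0 : `|x 0 0 - y 0 0| <= eta by rewrite mxE; apply: scale_dist => //; exact: ltW.
  have dist1 : `|x 0 1 - y 0 1| <= eta by rewrite mxE; apply: scale_dist => //; exact: ltW.
  have [ [_ _ p0] [_ _ p1] [_ _ p2] ] := polyv_close (ltW eta0) (Q i) x0 x1 y0 y1 dist0 dist1.
  have q0 := le_trans p0 (small _ (rC i)).
  have q1 := le_trans p1 (small _ (rC i)).
  have q2 := le_trans p2 (small _ (rC i)).
  have [fb0 fb1] := hM i y yK.
  have etab (w : R) : `|w| <= M -> `|eta * w| <= eps / 24.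
    move=> /MC wC; rewrite normrM (gtr0_norm eta0) mulrC; apply: le_trans etaC.
    by rewrite ler_wpM2r // ltW.
  have q6 : 4 * (eps / 24) <= eps / 6 by lra.
  split; first by have [] := chain4 c0 q0 d0 (etab _ fb0) q6.
  move=> l; rewrite -/y in d1.
  have [_ e0 e1] := polyf_grad (Q i) x; have [_ e2 e3] := polyf_grad (Q i) y.
  have gl : pd l (fun y => g y 0 i) x = (1 - eta) * pd l (fun y => f y 0 i) y.
    by apply: pd_scale_coord; exact: C1_on_diff Cf yK.
  rewrite gl; have := c1 l; have := d1 l.
  case: (ord2P l) => ->; rewrite ?e0 ?e1 ?e2 ?e3 => k1 k2.
    by have [] := chain4 k2 q1 k1 (etab _ (fb1 0)) q6.
  by have [] := chain4 k2 q2 k1 (etab _ (fb1 1)) q6.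
have [h [[hbij _ [k' [_ hk']]] hm]] := stab g Cg close.
have [hK hinj _] := hbij.
(* [g (h z) = 0] says that [f] vanishes at [(1 - eta) *: h z]. So [G] maps the finite set [s]
   injectively into itself, hence onto, and every value of [G] on [s] has norm at most [1 - eta]. *)
pose G z := (1 - eta) *: h z.
have Gs z' : z' \in s -> G z' \in s.
  move=> /zero_s[zK fz]; apply/zero_s; split.
    by apply: K2_scale => //; exact: hK.
  exact: (maps_zero hm zK fz).
have uG : uniq (map G s).
  rewrite map_inj_in_uniq // => a b as_ bs.
  have [aK _] := (zero_s a).1 as_; have [bK _] := (zero_s b).1 bs.
  move=> /(congr1 (fun v : pt => (1 - eta)^-1 *: v)).
  rewrite /G !scalerA mulVf ?scale1r; last by rewrite gt_eqF //; lra.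
  by move=> e; rewrite -(hk' a aK) -(hk' b bK) e.
have [_ hmem] := uniq_min_size uG (s2 := s) ltac:(by move=> _ /mapP[a /Gs ? ->])
  ltac:(by rewrite size_map).
have : z \in map G s by rewrite hmem.
move=> /mapP[a /zero_s[aK _] za].
have /K2E ha : K (h a) by exact: hK.
move: z1; rewrite za normrZ ger0_norm; last by case/andP: c01.
rewrite leNgt => /negP; apply; apply: le_lt_trans (_ : 1 - eta < 1); last by lra.
by rewrite ler_piMr //; case/andP: c01.
Qed.

Lemma singular2 (a b c d : R) : a * d - b * c = 0 ->
  exists v : pt, [/\ v != 0, v 0 0 * a + v 0 1 * b = 0 & v 0 0 * c + v 0 1 * d = 0].
Proof.
move=> e; pose A : 'M[R]_2 := \matrix_(i, j)
  (if j == 0 then if i == 0 then a else b else if i == 0 then c else d).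
have /det0P[v v0 vA] : \det A == 0.
  rewrite (expand_det_row _ 0) !big_ord_recl big_ord0 /cofactor !det_mx11 !mxE /=.
  by apply/eqP; rewrite -[RHS]e /bump /= addr0 expr1; ring.
exists v; have h j : v 0 0 * A 0 j + v 0 1 * A 1 j = 0.
  have := congr1 (fun w : pt => w 0 j) vA; rewrite !mxE !big_ord_recl big_ord0 addr0.
  have -> : lift ord0 ord0 = 1 :> 'I_2 by exact: val_inj.
  by rewrite !mxE.
by have := h 0; have := h 1; rewrite !mxE.
Qed.

(** A product of affine factors, one for each point of [t], each in a coordinate where that point
    differs from [z]. *)
Lemma separating (t : seq pt) (z : pt) : z \notin t ->
  exists W : pt -> R, [/\ smooth W, W z != 0 & forall y, y \in t -> W y = 0].
Proof.
elim: t => [_|y t IH].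
  by exists (cst 1); split=> //; [exact: smooth_cst|exact: oner_neq0].
rewrite inE negb_or => /andP[zy /IH[W [sW Wz Wt]]].
have [l hl] : exists l, z 0 l != y 0 l.
  have [e0|] := eqVneq (z 0 0) (y 0 0); last by exists 0.
  have [e1|] := eqVneq (z 0 1) (y 0 1); last by exists 1.
  by move: zy; rewrite (ptP e0 e1) eqxx.
exists (fun x : pt => (x 0 l + cst (- y 0 l) x) * W x); split.
- by apply: smoothM => //; apply: smoothD; [exact: smooth_coord|exact: smooth_cst].
- by rewrite mulf_neq0 //= subr_eq0.
- move=> x; rewrite inE => /predU1P[->|/Wt ->]; last by rewrite mulr0.
  by rewrite /= subrr mul0r.
Qed.

(** This is [F (x + r v) = o(r)]: both the value at [x] and the derivative along [v] vanish. *)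
Lemma line_small (F : pt -> R) (x v : pt) : differentiable F x -> F x = 0 ->
  v 0 0 * pd 0 F x + v 0 1 * pd 1 F x = 0 ->
  forall e : R, 0 < e -> exists2 r0 : R, 0 < r0 &
    forall r, 0 < r -> r < r0 -> `|F (x + r *: v)| <= e * r.
Proof.
move=> dF Fx dv e e0.
have x0 : x + 0 *: v = x by rewrite scale0r addr0.
have [|ex val] := @is_derive_line R F x v 0; first by rewrite x0.
rewrite x0 dv in val.
have := ex; rewrite /derivable => /cvg_ex[l hl].
have l0 : l = 0 by rewrite -val; apply/esym; exact: cvg_lim hl.
move: hl => /cvgrPdist_le /(_ e e0) /nbhs_ballP[r0 /= r00 hr].
exists r0 => // r rp rr; have := hr r.
rewrite /ball /= sub0r normrN gtr0_norm // => /(_ rr (lt0r_neq0 rp)).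
rewrite l0 sub0r normrN x0 Fx subr0 addr0.
have -> : r%:A = r by rewrite /GRing.scale /= mulr1.
rewrite normrZ normfV gtr0_norm // mulrC ler_pdivrMr //.
Qed.

(* If Df(z) v = 0 and Q vanishes at the zeros of f but has nonzero derivative
   along v at z, then f - (f(x1) / Q(x1)) Q has the additional zero x1 = z + r v,
   and it is close to f because f(x1) = o(r). *)
Lemma stable_regular z : z \in s ->
  pd 0 (fun x => f x 0 0) z * pd 1 (fun x => f x 0 1) z -
  pd 1 (fun x => f x 0 0) z * pd 0 (fun x => f x 0 1) z != 0.
Proof.
move=> zs; apply/eqP => /singular2[v [v0 dv0 dv1]].
have [Cf [eps eps0 stab]] := fS; have [zK fz] := (zero_s z).1 zs.
have z1 := stable_interior zs.
have [W [sW Wz Ws]] : exists W : pt -> R, [/\ smooth W, W z != 0 &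
    forall y, y \in rem z s -> W y = 0].
  by apply: separating; rewrite mem_rem_uniqF.
have [l vl] : exists l, v 0 l != 0.
  have [e0|] := eqVneq (v 0 0) 0; last by exists 0.
  have [e1|] := eqVneq (v 0 1) 0; last by exists 1.
  by move: v0; rewrite (_ : v = 0) ?eqxx //; apply: ptP; rewrite [RHS]mxE.
pose Q (x : pt) := (x 0 l + cst (- z 0 l) x) * W x.
have sQ : smooth Q.
  by apply: smoothM => //; apply: smoothD; [exact: smooth_coord|exact: smooth_cst].
have Qs y : y \in s -> Q y = 0.
  move=> ys; have [->|yz] := eqVneq y z; first by rewrite /Q /= subrr mul0r.
  by rewrite /Q Ws ?mulr0 // mem_rem_uniq // inE yz.
have [M hM] := smooth_bounded sQ.
pose C := `|M| + 1; have C0 : 0 < C by rewrite ltr_wpDl.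
have MC : M <= C by apply: le_trans (ler_norm M) _; rewrite lerDl.
pose dl := `|v 0 l| * (`|W z| / 2).
have dl0 : 0 < dl by rewrite mulr_gt0 ?normr_gt0 // divr_gt0 // normr_gt0.
(* [dl * r] will bound [|Q x1|] from below: the affine factor of [Q] is [r * v 0 l] there, and [W]
   keeps half of its size at [z]. With [|f x1 0 i| <= e * r], the coefficient [|c i|] is at most
   [e / dl], which is [eps / 6 / C]. *)
pose e := eps / 6 / C * dl.
have e0 : 0 < e by rewrite mulr_gt0 // !divr_gt0.
have gF i : is_grad (fun y => f y 0 i) z (pd 0 (fun y => f y 0 i) z) (pd 1 (fun y => f y 0 i) z).
  exact: C1_on_grad.
have lsm (i : 'I_2) : exists2 r0 : R, 0 < r0 &
    forall r, 0 < r -> r < r0 -> `|f (z + r *: v) 0 i| <= e * r.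
  have fz0 : f z 0 i = 0 by rewrite fz mxE.
  have hd : v 0 0 * pd 0 (fun y => f y 0 i) z + v 0 1 * pd 1 (fun y => f y 0 i) z = 0.
    by case: (ord2P i) => ->; [exact: dv0|exact: dv1].
  by have [dF _ _] := gF i; exact: (line_small dF fz0 hd e0).
have [ra ra0 ha] := lsm 0; have [rb rb0 hb] := lsm 1.
have W2 : 0 < `|W z| / 2 by rewrite divr_gt0 // normr_gt0.
have [rc rc0 hc] := continuous_radius (smooth_continuous sW (x := z)) W2.
have nv : 0 < `|v| by rewrite normr_gt0.
(* The four terms keep both components of [f] below [e * r], keep [W] above half of [|W z|], and
   keep [z + r v] in the ball; the last one is positive because [z] is an interior point. *)
pose r := Num.min (Num.min (ra / 2) (rb / 2)) (Num.min (rc / `|v|) ((1 - `|z|) / `|v|)).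
have r0 : 0 < r by rewrite !lt_min !divr_gt0 // subr_gt0.
have half (a : R) : 0 < a -> a / 2 < a by move=> a0; rewrite ltr_pdivrMr // ltr_pMr // ltr1n.
have rra : r < ra by apply: le_lt_trans (half _ ra0); rewrite !ge_min lexx.
have rrb : r < rb by apply: le_lt_trans (half _ rb0); rewrite !ge_min lexx orbT.
have rv : `|r *: v| = r * `|v| by rewrite normrZ gtr0_norm.
have rrc : r * `|v| <= rc by rewrite -ler_pdivlMr // !ge_min lexx !orbT.
have rrd : r * `|v| <= 1 - `|z| by rewrite -ler_pdivlMr // !ge_min lexx !orbT.
pose x1 := z + r *: v.
have x1K : K x1.
  apply/K2E; apply: le_trans (ler_normD _ _) _; rewrite rv.
  by rewrite -lerBrDl.
have Wx1 : `|W z| / 2 <= `|W x1|.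
  have := hc x1; rewrite /x1 addrAC subrr add0r rv => /(_ rrc) hW.
  by apply: (lower_half hW).
have Qx1 : dl * r <= `|Q x1|.
  rewrite /Q normrM /x1 !mxE /= addrAC subrr add0r normrM gtr0_norm // -/x1.
  have -> : dl * r = r * `|v 0 l| * (`|W z| / 2) by rewrite /dl; ring.
  by apply: ler_wpM2l => //; apply: mulr_ge0 => //; exact: ltW.
have Q0 : 0 < `|Q x1| by apply: lt_le_trans Qx1; rewrite mulr_gt0.
have Q00 : Q x1 != 0 by rewrite -normr_gt0.
pose c i := f x1 0 i / Q x1.
have hci i : `|c i| * C <= eps / 6.
  rewrite -ler_pdivlMr // normrM normfV ler_pdivrMr //.
  have hfi : `|f x1 0 i| <= e * r.
    by case: (ord2P i) => ->; [exact: ha|exact: hb].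
  apply: le_trans hfi _; rewrite /e -mulrA ler_wpM2l //.
  by rewrite !divr_ge0 // ltW.
pose q x : pt := mkpt (c 0 * Q x) (c 1 * Q x).
have qE i : (fun x => q x 0 i) = (fun x => cst (c i) x * Q x).
  by apply: funext => x; case: (ord2P i) => ->; rewrite ?mkpt0 ?mkpt1.
have Cq : C1_on K q.
  by apply: smooth_C1_on => i; rewrite qE; apply: smoothM => //; exact: smooth_cst.
pose g := f \- q.
have Cg : C1_on K g by exact: C1_onB.
have close : C1norm K (f \- g) < eps.
  apply: le_lt_trans (sixths eps0).
  apply: C1norm_sub_le => // i x xK.
  have [m0 m1 m2] := hM x xK.
  have cb (w : R) : `|w| <= M -> `|c i * w| <= eps / 6.
    move=> wM; apply: le_trans (hci i); rewrite normrM ler_wpM2l //.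
    exact: le_trans wM MC.
  have gqE : (fun x => g x 0 i) = (fun x => f x 0 i - c i * Q x).
    apply: funext => y; rewrite -[c i * Q y]/((fun x => cst (c i) x * Q x) y) -qE.
    by rewrite /g !mxE.
  split.
    rewrite -[g x 0 i]/((fun x => g x 0 i) x) gqE opprB addrC subrK; exact: cb.
  have gQ : is_grad Q x (pd 0 Q x) (pd 1 Q x).
    by split=> //; exact: smooth_differentiable.
  have [_ e1 e2] := is_gradB (C1_on_grad i Cf xK) (is_gradM (is_grad_cst (c i) x) gQ).
  move=> l'; rewrite gqE; case: (ord2P l') => ->.
    by rewrite e1 mulr0 addr0 opprB addrC subrK; exact: cb.
  by rewrite e2 mulr0 addr0 opprB addrC subrK; exact: cb.
have [h [hh hm]] := stab g Cg close.
have gs y : y \in s -> K y /\ g y = 0.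
  move=> ys; have [yK fy] := (zero_s y).1 ys; split=> //.
  rewrite /g /= fy sub0r; apply/eqP; rewrite oppr_eq0; apply/eqP.
  by apply: ptP; rewrite ?mkpt0 ?mkpt1 Qs // mulr0 [RHS]mxE.
have gx1 : g x1 = 0.
  apply/eqP; rewrite subr_eq0; apply/eqP; apply: ptP; rewrite ?mkpt0 ?mkpt1.
    by rewrite /c divfK.
  by rewrite /c divfK.
have x1s : x1 \notin s by apply: contra Q00 => /Qs ->.
(* Every zero of [g] is the image of a zero of [f], so [g] has at most [size s] zeros, although [x1]
   and the elements of [s] are [size s + 1] of them. *)
have sub : {subset x1 :: s <= map h s}.
  move=> y ys; have [yK gy] : K y /\ g y = 0.
    by move: ys; rewrite inE => /predU1P[->|/gs].
  have [x [xK <- fx]] := maps_zero_surj Cg hh hm yK gy.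
  by apply: map_f; apply/zero_s.
have := uniq_leq_size (_ : uniq (x1 :: s)) sub.
by rewrite /= x1s uniq_s size_map ltnn => /(_ isT).
Qed.
End Stable.

Lemma prefix_mkseq (p : nat -> bool) k l : (l <= k)%N ->
  map (nth false (mkseq p k)) (iota 0 l) = mkseq p l.
Proof.
move=> lk; apply/eq_in_map => i; rewrite mem_iota add0n => /= il.
by rewrite nth_mkseq // (leq_trans il).
Qed.

Definition vertex_rat (j : nat) (v : bool * nat) : rat :=
  (-1) ^+ v.1 * (2 * v.2 + 1)%N%:R / (2 ^ j)%N%:R.

Lemma code_vertex_rat j v : code_rat (vertex_rat j v) = code_coef (vertex_coef j v).
Proof. exact: code_rat_odd. Qed.

(** * From accepted certificates to the output *)

Section Final.
Variable R : realType.
Notation pt := 'rV[R]_2.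
Notation K := (K2 R).

Lemma ratr_vertex j v : ratr (vertex_rat j v) = vertex_val R j v.
Proof.
rewrite /vertex_rat /vertex_val /vertex_num /num_of_coef /vertex_coef /numv.
rewrite fmorph_div rmorphM rmorphXn rmorphN1 /= !ratr_nat.
by case: v => -[] b /=; rewrite ?sub0r ?subr0 ?mulN1r ?mul1r.
Qed.

Lemma square_vertex n j v : @square R n (vertex_rat j v.1, vertex_rat j v.2) =
  in_square n%:R^-1 (vertex_val R j v.1, vertex_val R j v.2).
Proof. by rewrite /square /in_square /= !ratr_vertex. Qed.

Section Squares.
Variables (f : pt -> pt) (n : nat) (C : seq (rat * rat)).
Hypothesis sq1 : forall q, q \in C -> exists! x, zeros K f x /\ square n q x.
Hypothesis sq2 : forall x, zeros K f x -> exists2 q, q \in C & square n q x.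

(** The choice of the zero in each square maps the indices onto the zeros because the squares cover
    them, and it is injective because the squares are disjoint. *)
Lemma squares_card :
  (forall i k, (i < size C)%N -> (k < size C)%N -> i <> k ->
    forall x : pt, square n (nth (0, 0) C i) x ->
      square n (nth (0, 0) C k) x -> False) ->
  (zeros K f #= `I_(size C))%card.
Proof.
move=> disj.
have /choice[z hz] : forall i, exists x, (i < size C)%N ->
    zeros K f x /\ square n (nth (0, 0) C i) x.
  move=> i; have [iC|iC] := ltnP i (size C); last by exists 0.
  by have [x [hx _]] := sq1 (mem_nth (0, 0) iC); exists x.
have -> : zeros K f = z @` `I_(size C).
  apply/seteqP; split=> [x xz|_ [i /= iC <-]]; last by have [] := hz i iC.
  have [q qC qx] := sq2 xz.
  exists (index q C); rewrite /= ?index_mem //.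
  have iC : (index q C < size C)%N by rewrite index_mem.
  have := hz _ iC; rewrite nth_index // => zi.
  have [y [_ uy]] := sq1 qC.
  by rewrite -(uy _ zi); apply: uy.
apply: inj_card_eq => i k; rewrite !inE /= => iC kC e.
apply/eqP; apply/negP => /negP/eqP ik.
have [_ si] := hz i iC; have [_ sk] := hz k kC.
by apply: (disj i k iC kC ik (z i)) => //; rewrite e.
Qed.

(** In the maximum norm two points of a square of side [1/n] are at distance at most [1/n], and
    every square contains a zero. *)
Lemma squares_hausdorff : (hausdorff_dist (zeros K f)
  (\bigcup_(q in [set` C]) square n q) <= (n%:R^-1)%:E)%E.
Proof.
have n0 : (0 : R) <= n%:R^-1 by rewrite invr_ge0.
rewrite /hausdorff_dist !ge_max lee_fin n0 /=; apply/andP; split.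
  apply: ge_ereal_sup => _ [x xz <-]; have [q qC qx] := sq2 xz.
  apply: le_trans (_ : (`|x - x|%:E <= _)%E); last by rewrite subrr normr0 lee_fin.
  by apply: ereal_inf_lbound; exists x => //; exists q.
apply: ge_ereal_sup => _ [x [q qC [/andP[x1 x2] /andP[x3 x4]]] <-].
have [y [[yz [/andP[y1 y2] /andP[y3 y4]]] _]] := sq1 qC.
apply: le_trans (_ : (`|x - y|%:E <= _)%E).
  by apply: ereal_inf_lbound; exists y.
rewrite lee_fin; apply/pt_norm_le; rewrite !mxE !ler_norml.
by split; apply/andP; split; lra.
Qed.
End Squares.

Section Input.
Variables (f : pt -> pt) (P : nat -> 'I_2 -> {poly {poly rat}}) (n0 : nat).
Hypothesis fS : stable_systems K f.
Hypothesis fP : is_C1_name K f P.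

Let words k := input_words P k.
Let val0 k := coefs_val R (words k).1.
Let val1 k := coefs_val R (words k).2.

Lemma words_ok k : coefs_ok (words k).1 /\ coefs_ok (words k).2.
Proof. by split; exact: coefs_ok_poly. Qed.

Lemma words_close k :
  C1_close (2^-1 ^+ k) (fun x => f x 0 0) (polyf (val0 k)) /\
  C1_close (2^-1 ^+ k) (fun x => f x 0 1) (polyf (val1 k)).
Proof.
have [Cf _] := fS.
have e1 : lift ord0 ord0 = 1 :> 'I_2 by exact: val_inj.
split; first exact: name_close Cf (fP k 0).
by rewrite /val1 /words /input_words /= e1; exact: name_close Cf (fP k 1).
Qed.

Lemma check_exists : exists (c : cert_enc) l, forall k, (l <= k)%N ->
  check c (mkseq (code_input n0 P) k).
Proof.
have [s0 hs0] := (finite_seqP _).1 (stable_finite fS fP).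
pose s := undup s0; have us : uniq s by exact: undup_uniq.
have hs : zeros K f = [set` s].
  by rewrite hs0; apply/seteqP; split => x /=; rewrite mem_undup.
have [Cf _] := fS.
have [n [e [j [C [n0n np ep hC]]]]] := certified_data Cf us hs
  (stable_interior fS fP us hs) (stable_regular fS fP us hs) n0.
(* Any number is below its power of two, so this [k] gives the required precision. Only then is [b]
   known, from the coefficients of the [k]-th polynomials, and [m] is chosen last. *)
pose k := (32 * (e * e))%N.
have hk : (32 * (e * e) <= 2 ^ k)%N by rewrite ltnW // ltn_expl.
pose b := (bound2 (words k).1 + bound2 (words k).2)%N.
pose m := (32 * b * (e * e) + 16 * n)%N.
have mp : (0 < m)%N by rewrite addn_gt0; apply/orP; right; rewrite muln_gt0.
pose c : cert_enc := ((n0, (mkseq words k, words k)), (((n, m), (e, j)), C)).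
pose w := code_words n0 (mkseq words k.+1).
exists c, (size w) => l wl; rewrite /check.
have -> : code_words c.1.1 (c.1.2.1 ++ [:: c.1.2.2]) = w.
  by rewrite /= cats1 -mkseqS.
rewrite size_mkseq wl prefix_mkseq // code_input_prefix eqxx /=.
have [c0 c1] := words_close k; have [ok0 ok1] := words_ok k.
have cert := (checkP R j C np mp ep ok0 ok1).2.
rewrite /check_body /= size_mkseq n0n np mp ep hk -/b leq_addr /=.
apply: cert.
apply: hC c0 c1 _ _; last by rewrite leq_addl.
rewrite -natrM -[32]/(32%:R) -natrM exprVn -natrX ler_pdivrMr.
  by rewrite mul1r ler_nat.
by rewrite ltr0n expn_gt0.
Qed.

Lemma check_sound (c : cert_enc) k : check c (mkseq (code_input n0 P) k) ->
  exists (n N : nat) (C : seq (rat * rat)),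
    [/\ cert_output c = code_output n N C,
        (n0 <= n)%N /\ (0 < n)%N,
        (zeros K f #= `I_N)%card,
        (forall q, q \in C -> exists! x, zeros K f x /\ square n q x) /\
        (forall x, zeros K f x -> exists2 q, q \in C & square n q x) &
        (hausdorff_dist (zeros K f)
           (\bigcup_(q in [set` C]) square n q) <= (n%:R^-1)%:E)%E].
Proof.
case: c => [[n0' [pre [p q]]] [[[n m] [e j]] C]].
rewrite /check size_mkseq /=; set w := code_words _ _.
move=> /andP[/andP[wk /eqP ew] hb].
have {ew} : mkseq (code_input n0 P) (size w) = w by rewrite -[RHS]ew prefix_mkseq.
(* The copy of the input inside the certificate is the true one, so [p] and [q] come from the
   polynomials of index [size pre] in the name, whose distance to [f] is controlled by that
   index. *)
move=> /code_input_inj[en0]; rewrite size_cat addn1 cats1 mkseqS => /rcons_inj[_ ep eq].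
set i := size pre in hb ep eq.
move: hb; rewrite /check_body en0 => /andP[/andP[/andP[/andP[/andP[/andP[/andP[nn np] mp] e0] hi] hm] hs] hz].
have hc : check_squares j n C && check_zeros j n m e p q C by rewrite hs.
have [c0 c1] := words_close i; have [ok0 ok1] := words_ok i.
rewrite {}ep {}eq -![coefs_of_poly (P i ord0)]/((words i).1) in hm hc.
rewrite -![coefs_of_poly (P i (lift _ _))]/((words i).2) in hm hc.
have cert := (checkP R j C np mp e0 ok0 ok1).1 hc.
have [Cf _] := fS.
have df x : K x -> differentiable f x by exact: C1_on_diff.
have d_le : 32 * (e%:R * e%:R) * 2^-1 ^+ i <= 1 :> R.
  rewrite -natrM -[32]/(32%:R) -natrM exprVn -natrX ler_pdivrMr.
    by rewrite mul1r ler_nat.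
  by rewrite ltr0n expn_gt0.
pose B : R := (bound2 (words i).1 + bound2 (words i).2)%:R.
have B0 : rbound2 (val0 i) <= B.
  by apply: le_trans (rbound2_coefs R ok0) _; rewrite ler_nat leq_addr.
have B1 : rbound2 (val1 i) <= B.
  by apply: le_trans (rbound2_coefs R ok1) _; rewrite ler_nat leq_addl.
have B_le : 32 * B * (e%:R * e%:R) <= m%:R.
  by rewrite /B -!natrM ler_nat.
pose C' := map (fun v : vertex => (vertex_rat j v.1, vertex_rat j v.2)) C.
have sq1 r : r \in C' -> exists! x, zeros K f x /\ square n r x.
  move=> /mapP[v vC ->]; rewrite square_vertex.
  have vq : (vertex_val R j v.1, vertex_val R j v.2) \in squares_val R j C.
    by apply/mapP; exists v.
  have [x [xz xq]] := certified_exists np mp e0 df c0 c1 d_le B0 B1 B_le cert vq.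
  exists x; split=> // y [yz yq].
  exact: (certified_inj mp e0 df c0 c1 d_le B0 B1 B_le cert vq xz xq yz yq).
have sq2 x : zeros K f x -> exists2 r, r \in C' & square n r x.
  move=> xz; have [r /mapP[v vC ->] xr] :=
    certified_covers mp e0 c0 c1 d_le B0 B1 B_le cert xz.
  exists (vertex_rat j v.1, vertex_rat j v.2); last by rewrite square_vertex.
  by apply/mapP; exists v.
have v0 : vertex by exact: ((false, 0%N), (false, 0%N)).
exists n, (size C'), C'; split => //.
- rewrite /cert_output /code_output size_map; congr (_ ++ _ ++ _).
  rewrite /C' code_seq_map /code_seq; congr (_ ++ flatten _).
  by apply: eq_map => v; rewrite -!code_vertex_rat.
- apply: (squares_card sq1 sq2) => a b; rewrite size_map => aC bC ab x.
  rewrite !(nth_map v0) // !square_vertex.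
  move=> [/andP[h1 h2] /andP[h3 h4]] [/andP[h5 h6] /andP[h7 h8]].
  have := certified_apart cert (i := a) (k := b).
  rewrite size_map => /(_ aC bC ab).
  rewrite !(nth_map v0) //.
  case=> h; move: h1 h2 h3 h4 h5 h6 h7 h8 h => /=; lra.
- exact: squares_hausdorff.
Qed.
End Input.
End Final.

Theorem theorem1 (R : realType) :
  exists M : machine,
    forall (f : 'rV[R]_2 -> 'rV[R]_2) (P : nat -> 'I_2 -> {poly {poly rat}})
           (n0 : nat),
      stable_systems (K2 R) f -> is_C1_name (K2 R) f P ->
      exists (n N : nat) (C : seq (rat * rat)),
        [/\ halts_with M (code_input n0 P) (code_output n N C),
            (n0 <= n)%N /\ (0 < n)%N,
            (zeros (K2 R) f #= `I_N)%card,
            (forall q, q \in C ->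
               exists! x, zeros (K2 R) f x /\ square n q x) /\
            (forall x, zeros (K2 R) f x ->
               exists2 q, q \in C & square n q x) &
            (hausdorff_dist (zeros (K2 R) f)
               (\bigcup_(q in [set` C]) square n q) <= (n%:R^-1)%:E)%E].
Proof.
have [M hM] := search_machine pr_check pr_cert_output.
exists M => f P n0 fS fP.
have [c [k [hc halt]]] := hM _ (check_exists n0 fS fP).
have [n [N [C [e hn hN hC hd]]]] := check_sound fS fP hc.
by exists n, N, C; split => //; rewrite -e.
Qed.
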